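(* (Noumi–Okada–Okamoto–Umemura conjecture.) Let $b_1,b_2$ be indeterminates, and let $T_n=T_n(v)$, $n\ge 0$, be the sequence determined by $T_0=T_1=1$ and $$T_{n-1}T_{n+1}=\left\{\tfrac14\left(-2b_1^2-2b_2^2+(b_1^2-b_2^2)v\right)+\left(n-\tfrac12\right)^2\right\}T_n^2+\tfrac14(v^2-4)^2\left\{T_n\frac{d^2T_n}{dv^2}-\left(\frac{dT_n}{dv}\right)^2\right\}+\tfrac14(v^2-4)\,v\,T_n\frac{dT_n}{dv}\qquad(n\ge 1).$$ Then for all $n\ge 1$, $$2^{n(n-1)}T_n(v)=\sum_{I\subset[n-1]}\mathbf d_n(I)\;c_I\;d_{[n-1]\setminus I}\;z^{|I|}\,w^{|[n-1]\setminus I|},$$ where $z=\frac{2-v}{4}$, $w=\frac{2+v}{4}$, $c=-4b_1^2$, $d=-4b_2^2$, and the remaining notation is as in the context.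
   Context: $[n-1]=\{1,2,\ldots,n-1\}$ ($[0]=\emptyset$). For a finite set $I$ of positive integers, $|I|$ denotes the SUM of its elements. Put $\bar c_k=c+(2k-1)^2$, $\bar d_k=d+(2k-1)^2$, $c_k=\bar c_1\bar c_2\cdots\bar c_k$, $d_k=\bar d_1\bar d_2\cdots\bar d_k$, and $c_I=\prod_{i\in I}c_i$, $d_I=\prod_{i\in I}d_i$. For $I=\{i_1>i_2>\cdots>i_p\}\subset[n-1]$, $\mathbf d_n(I)$ is the dimension of the irreducible polynomial representation of $GL(n)$ whose highest weight is the partition $\lambda(I)$ with Frobenius symbol $(i_1-1,i_2-1,\ldots,i_p-1\,|\,i_1,i_2,\ldots,i_p)$. Here $(\alpha_1,\ldots,\alpha_p|\beta_1,\ldots,\beta_p)$ is the standard Frobenius notation: $p$ is the length of the main diagonal of the Young diagram of $\lambda$, $\alpha_i=\lambda_i-i$ is the arm length and $\beta_i=\lambda'_i-i$ the leg length of the $i$-th diagonal box. The polynomials $2^{n(n-1)}T_n$ are the Umemura polynomials $U_n(z,w,b_1,b_2)$ attached to Painlevé VI. *)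

(* Defs.v *)
From mathcomp Require Import all_boot all_order all_algebra.
From mathcomp Require Import ring.
From mathcomp Require Import mpoly.

Set Implicit Arguments.
Unset Strict Implicit.
Unset Printing Implicit Defensive.

Import Order.TTheory GRing.Theory Num.Theory.
Local Open Scope ring_scope.

Notation "x %:F" := (@FracField.tofrac _ x) : ring_scope.

(* d/dv on the rational functions in one variable v over the integral domain  *)
(* R: the quotient rule, applied to the chosen representative of a fraction.  *)
(* The choice does not matter, see dfracE.                                    *)
Definition dfrac (R : idomainType) (f : {fraction {poly R}}) :
    {fraction {poly R}} :=
  let p := \n_(generic_quotient.repr f) in
  let q := \d_(generic_quotient.repr f) in
  (p^`() * q - p * q^`())%:F / (q ^+ 2)%:F.

Lemma dfracE (R : idomainType) (p q : {poly R}) : q != 0 ->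
  dfrac (p%:F / q%:F) = (p^`() * q - p * q^`())%:F / (q ^+ 2)%:F.
Proof.
move=> q0; rewrite /dfrac; set f := p%:F / q%:F.
set r := generic_quotient.repr f.
have r0 : \d_r != 0 by exact: denom_ratioP.
have fE : f * (\d_r)%:F = (\n_r)%:F.
  rewrite -[f]generic_quotient.reprK -/r; unlock FracField.tofrac.
  rewrite -[LHS]FracField.pi_mul; apply/generic_quotient.eqmodP => /=.
  rewrite FracField.equivfE /FracField.mulf.
  by rewrite !numden_Ratio ?(oner_eq0, mulr1) // mulrC.
have e : p * \d_r = \n_r * q.
  apply/eqP; rewrite -tofrac_eq !tofracM -fE /f.
  by rewrite mulrAC divfK ?tofrac_eq0.
have e' := congr1 (@deriv _) e; rewrite !derivM in e'.
apply/eqP; rewrite eqr_div ?tofrac_eq0 ?expf_neq0 // -!tofracM tofrac_eq.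
apply/eqP; move: e e'; move: (\d_r) (\n_r) => q1 p1 e e'.
have -> : (p1^`() * q1 - p1 * q1^`()) * q ^+ 2 =
  (p1^`() * q + p1 * q^`()) * (q1 * q) - (p1 * q) * (q^`() * q1 + q1^`() * q).
  by ring.
rewrite -e' -e; ring.
Qed.

(* C(b1, b2, v), as fractions of polynomials in v over C[b1, b2]              *)
Definition ratfun (C : numClosedFieldType) : fieldType :=
  {fraction {poly {mpoly C[2]}}}.

Definition b1 (C : numClosedFieldType) : ratfun C :=
  (('X_(0 : 'I_2) : {mpoly C[2]})%:P)%:F.
Definition b2 (C : numClosedFieldType) : ratfun C :=
  (('X_(1 : 'I_2) : {mpoly C[2]})%:P)%:F.
Definition v (C : numClosedFieldType) : ratfun C :=
  ('X : {poly {mpoly C[2]}})%:F.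

Definition toda_rhs (C : numClosedFieldType) (n : nat) (f : ratfun C) :
    ratfun C :=
  let b1 := b1 C in let b2 := b2 C in let v := v C in
  (1 / 4 * (- 2 * b1 ^+ 2 - 2 * b2 ^+ 2 + (b1 ^+ 2 - b2 ^+ 2) * v)
     + (n%:R - 1 / 2) ^+ 2) * f ^+ 2
  + 1 / 4 * (v ^+ 2 - 4) ^+ 2 * (f * dfrac (dfrac f) - dfrac f ^+ 2)
  + 1 / 4 * (v ^+ 2 - 4) * v * f * dfrac f.

Definition toda_sequence (C : numClosedFieldType) (T : nat -> ratfun C) : Prop :=
  [/\ T 0%N = 1, T 1%N = 1 &
      forall n, (1 <= n)%N -> T n.-1 * T n.+1 = toda_rhs n (T n)].

(* \prod_(1 <= k <= i) (x + (2k - 1)^2): this is c_i for x = c, d_i for x = d *)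
Definition oddsq_prod (F : fieldType) (x : F) (i : nat) : F :=
  \prod_(1 <= k < i.+1) (x + (2 * k%:R - 1) ^+ 2).

(* [n-1] = {1, ..., n-1} inside 'I_n = {0, ..., n-1}                          *)
Definition brange (n : nat) : {set 'I_n} := [set i : 'I_n | (0 < i)%N].

Definition wt (n : nat) (I : {set 'I_n}) : nat := (\sum_(i in I) i)%N.

(* Partitions are weakly decreasing sequences of positive integers; parts,    *)
(* rows and columns are numbered from 0, whence the .+1 in arms and legs.     *)
Definition is_partition (lam : seq nat) : bool :=
  sorted geq lam && (0 \notin lam)%N.

Definition conj_part (lam : seq nat) (j : nat) : nat :=
  count (fun x => j < x)%N lam.

Definition diag_length (lam : seq nat) : nat :=
  count (fun i => i < nth 0 lam i)%N (iota 0 (size lam)).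

Definition frobenius_symbol (lam : seq nat) : seq nat * seq nat :=
  ([seq nth 0 lam i - i.+1 | i <- iota 0 (diag_length lam)]%N,
   [seq conj_part lam i - i.+1 | i <- iota 0 (diag_length lam)]%N).

(* i_1 > i_2 > ... > i_p                                                      *)
Definition decreasing_elts (n : nat) (I : {set 'I_n}) : seq nat :=
  sort geq [seq val i | i <- enum I].

Definition has_symbol_of (n : nat) (I : {set 'I_n}) (lam : seq nat) : Prop :=
  is_partition lam /\
  frobenius_symbol lam =
    ([seq i.-1 | i <- decreasing_elts I], decreasing_elts I).

(* A representation of GL(n, C) on V is given by a function on all matrices,  *)
(* of which only the values at invertible matrices matter.                    *)
Section PolynomialRepresentations.
Variables (C : numClosedFieldType) (n : nat) (V : vectType C).
Variable rho : 'M[C]_n -> 'End(V).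

Definition is_repr : Prop :=
  rho 1%:M = \1%VF /\
  {in unitmx &, forall g h, rho (g *m h) = (rho g \o rho h)%VF}.

(* All matrix coefficients are polynomials in the entries of g.               *)
Definition is_polynomial_repr : Prop :=
  forall (phi : 'Hom(V, C^o)) (x : V), exists P : {mpoly C[n * n]},
    {in unitmx, forall g, phi (rho g x) = P.@[fun k => mxvec g 0 k]}.

Definition is_irreducible : Prop :=
  fullv != 0%VS :> {vspace V} /\
  forall W : {vspace V},
    {in unitmx, forall g, (rho g @: W <= W)%VS} -> W = 0%VS \/ W = fullv.

(* A nonzero vector on which the Borel subgroup of upper triangular matrices  *)
(* acts by the character g |-> \prod_i g_ii^(lam_i).                          *)
Definition has_highest_weight (lam : seq nat) : Prop :=
  (size lam <= n)%N /\
  exists2 u : V, u != 0 &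
    {in unitmx, forall g : 'M[C]_n,
      (forall i j : 'I_n, (j < i)%N -> g i j = 0) ->
      rho g u = (\prod_i g i i ^+ nth 0%N lam i) *: u}.

End PolynomialRepresentations.

(* m is the dimension of the irreducible polynomial representation of         *)
(* GL(n, C) with highest weight lambda(I)                                     *)
Definition is_dim_irr (C : numClosedFieldType) (n : nat) (I : {set 'I_n})
    (m : nat) : Prop :=
  exists (lam : seq nat) (V : vectType C) (rho : 'M[C]_n -> 'End(V)),
    [/\ has_symbol_of I lam,
        is_repr rho, is_polynomial_repr rho, is_irreducible rho
      & has_highest_weight rho lam] /\ \dim (fullv : {vspace V}) = m.

(* Main.v *)
Require Import Defs.
From HB Require Import structures.
From mathcomp Require Import all_boot all_order all_algebra.
From mathcomp Require Import perm ring zify.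
From mathcomp Require Import mpoly.

Set Implicit Arguments.
Unset Strict Implicit.
Unset Printing Implicit Defensive.

Import Order.TTheory GRing.Theory Num.Theory.
Local Open Scope ring_scope.

(* Put x = z/w = e^(2s). Up to a power of w and the factor 0! 1! ... (n-1)!,
   2^(n(n-1)) T_n is the Wronskian in s of g_k = c_k e^(ks) + (-1)^k d_k e^(-ks),
   0 <= k < n. Expanding each column into its two exponentials gives Vandermonde
   determinants in the points k (k in I) and -k (k not in I), one for each subset
   I of [n-1].

   The Toda equation: the operator e^s (c + (2 d/ds + 1)^2) - e^(-s) (d + (2 d/ds - 1)^2)
   maps each g_k into the span of its neighbours. Hence the ratio mu of the minor
   with last column g_(n-1) replaced by g_n to W_n is an affine function of
   W_n'/W_n, while Jacobi's identity expresses the derivative of mu through mu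
   and W_(n+1) W_(n-1) / W_n^2.

   The dimension: the points n-1+k (k in I) and n-1-k (k not in I) are the parts
   of lambda(I) shifted by the staircase, so the Vandermonde determinant above is
   the dimension times 0! 1! ... (n-1)! by Weyl's formula. That formula holds for
   any irreducible polynomial representation V of highest weight lambda: the
   Casimir element acts on V by a scalar, whence the product of the character
   with the Vandermonde determinant is an eigenvector of sum_i (t_i d/dt_i)^2.
   Its exponents are therefore all on one sphere, and as the weights are bounded
   by lambda (density of the products L U of triangular matrices) only the
   permutations of the shifted highest weight remain. *)

(** * Derivations and determinants *)

(** The Toda equation results from differentiating the affine expression of mu and comparing with
    Jacobi's identity, for each n separately. This divides by W_n, and uniqueness of the sequence
    divides by T_(n-1); so the nonvanishing of all T_n needs its own argument, a specialization of
    the explicit sum.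

    On the side of the dimension, only the values at invertible matrices matter. Every fact about
    the representation is therefore turned into an identity between polynomials in one parameter and
    checked off finitely many values of it. This extends the representation to all matrices, makes
    differentiation along lines formal, and isolates a projector on the highest weight line, which
    replaces eigenvalues in Schur's lemma. On the torus the off-diagonal part of the Casimir element
    becomes a first-order operator, because conjugation by t multiplies E_ij by t_i / t_j;
    multiplying the character by the Vandermonde determinant absorbs these first-order terms. *)

Definition derivation (S : comNzRingType) (D : S -> S) : Prop :=
  {morph D : x y / x + y} /\ forall x y, D (x * y) = D x * y + x * D y.

Section Derivation.
Variables (S : comNzRingType) (D : S -> S).
Hypothesis HD : derivation D.

Lemma derivation0 : D 0 = 0.
Proof. by case: HD => DD _; apply: (addrI (D 0)); rewrite -DD !addr0. Qed.

Lemma derivation1 : D 1 = 0.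
Proof.
case: HD => _ DM; apply: (addrI (D 1)).
by rewrite addr0 -[in RHS](mulr1 1) DM mulr1 mul1r.
Qed.

Lemma derivationN x : D (- x) = - D x.
Proof.
by case: HD => DD _; apply: (addrI (D x)); rewrite -DD !subrr derivation0.
Qed.

Lemma derivationB x y : D (x - y) = D x - D y.
Proof. by case: HD => DD _; rewrite DD derivationN. Qed.

Lemma derivation_sum (I : Type) (r : seq I) (P : pred I) (F : I -> S) :
  D (\sum_(i <- r | P i) F i) = \sum_(i <- r | P i) D (F i).
Proof. by apply: (big_morph D); [case: HD | exact: derivation0]. Qed.

Lemma derivation_nat n : D n%:R = 0.
Proof.
elim: n => [|n IHn]; first exact: derivation0.
by rewrite -addn1 natrD; case: (HD) => -> _; rewrite IHn derivation1 addr0.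
Qed.

Lemma derivation_prod (I : eqType) (r : seq I) (F : I -> S) : uniq r ->
  D (\prod_(i <- r) F i) = \sum_(i <- r) D (F i) * \prod_(j <- r | j != i) F j.
Proof.
case: (HD) => _ DM; elim: r => [|a r IHr] /=.
  by rewrite !big_nil derivation1.
case/andP=> ar /IHr {}IHr; rewrite !big_cons DM IHr eqxx /=; congr (_ + _).
  congr (_ * _); rewrite big_seq [RHS]big_seq_cond; apply: eq_bigl => j.
  by case: (boolP (j \in r)) => //= jr; rewrite (memPn ar).
rewrite mulr_sumr; apply: eq_big_seq => i ir.
by rewrite big_cons eq_sym (memPn ar) // mulrCA.
Qed.

Lemma derivationX x n : D (x ^+ n) = x ^+ n.-1 * D x *+ n.
Proof.
case: (HD) => _ DM; case: n => [|n]; first by rewrite derivation1 mulr0n.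
elim: n => [|n IHn]; first by rewrite expr1 expr0 mul1r.
rewrite exprS DM IHn /= [in RHS]mulrS [D x * _]mulrC; congr (_ + _).
by rewrite -mulrnAr mulrA -exprS mulrnAr.
Qed.

(** Jacobi's formula: one row is differentiated at a time, and [B i], where this is row i, is
    expanded along that row. *)
Lemma derivation_det n (A : 'M[S]_n) :
  D (\det A) = \tr (\adj A *m map_mx D A).
Proof.
case: (HD) => _ DM.
have sgnD (b : bool) x : D ((-1) ^+ b * x) = (-1) ^+ b * D x.
  by case: b; rewrite ?mulN1r ?mul1r ?derivationN.
pose B i := \matrix_(k, l) (if k == i then D (A k l) else A k l).
have detB i : \det (B i) = \sum_j D (A i j) * cofactor A i j.
  rewrite (expand_det_row _ i); apply: eq_bigr => j _.
  rewrite mxE eqxx; congr (_ * _); rewrite /cofactor; congr (_ * \det _).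
  by apply/matrixP => k l; rewrite !mxE eq_sym (negbTE (neq_lift _ _)).
transitivity (\sum_i \det (B i)).
  rewrite derivation_sum [RHS]exchange_big /=; apply: eq_bigr => s _.
  rewrite sgnD derivation_prod ?index_enum_uniq // mulr_sumr.
  apply: eq_bigr => i _; congr (_ * _). rewrite [in RHS](bigD1 i) //=. rewrite !mxE eqxx.
  by congr (_ * _); apply: eq_bigr => j /negbTE ji; rewrite mxE ji.
rewrite (eq_bigr _ (fun i _ => detB i)) exchange_big /mxtrace.
apply: eq_bigr => j _; rewrite mxE.
by apply: eq_bigr => i _; rewrite !mxE mulrC.
Qed.

Lemma derivation_mulmx m n p (A : 'M[S]_(m, n)) (B : 'M[S]_(n, p)) :
  map_mx D (A *m B) = map_mx D A *m B + A *m map_mx D B.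
Proof.
case: (HD) => _ DM; apply/matrixP => i k; rewrite !mxE derivation_sum -big_split.
by apply: eq_bigr => j _; rewrite !mxE DM.
Qed.

End Derivation.

(** A corner of an infinite array, so that determinants of consecutive orders come from the same
    [a]. *)
Definition minor_mx (K : comNzRingType) (a : nat -> nat -> K) (n : nat) :
  'M[K]_n := \matrix_(i, k) a i k.

Lemma ltn_neq_ord_max n (i : 'I_n.+1) : i != ord_max -> (i < n)%N.
Proof. by rewrite -(inj_eq val_inj) /= ltn_neqAle -[(i <= n)%N]ltnS ltn_ord andbT. Qed.

Lemma sum_ord_eq (K : pzSemiRingType) n j (F : nat -> K) :
  \sum_(l < n) F l * (l == j :> nat)%:R = if (j < n)%N then F j else 0.
Proof.
case: ltnP => [jn|nj].
  rewrite (bigD1 (Ordinal jn)) //= eqxx mulr1 big1 ?addr0 // => l.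
  by rewrite -(inj_eq val_inj) /= => /negbTE ->; rewrite mulr0.
by rewrite big1 // => l _; rewrite ltn_eqF ?mulr0 // (leq_trans _ nj).
Qed.

Section BorderedDeterminant.
Variables (K : comNzRingType) (a : nat -> nat -> K) (n : nat).

Lemma adj_minor_mx_max :
  \adj (minor_mx a n.+1) ord_max ord_max = \det (minor_mx a n).
Proof.
rewrite mxE /cofactor -signr_odd /= addnn odd_double mul1r; congr (\det _).
by apply/matrixP => i k; rewrite !mxE !lift_max.
Qed.

(** Schur complement, by the column operation [y]. The adjugate replaces the inverse, so the corner
    may be singular. *)
Lemma det_border (x : nat -> K) :
    (forall i, (i < n)%N -> a i n = \sum_(k < n) a i k * x k) ->
  \det (minor_mx a n.+1) =
  \det (minor_mx a n) * (a n n - \sum_(k < n) a n k * x k).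
Proof.
move=> ax; pose A := minor_mx a n.+1.
pose y : 'cV[K]_n.+1 := \col_k (if k == ord_max then 1 else - x k).
have Ay : A *m y = \col_i (if i == ord_max then
                             a n n - \sum_(k < n) a n k * x k else 0).
  apply/matrixP => i j; rewrite !mxE big_ord_recr /= !mxE eqxx mulr1.
  under eq_bigr => k _ do
    rewrite !mxE /= -(inj_eq val_inj) /= ltn_eqF // mulrN.
  rewrite sumrN addrC; case: eqVneq => [->//|i_n].
  by rewrite ax ?subrr ?ltn_neq_ord_max.
have := congr1 (fun B : 'cV_n.+1 => B ord_max 0) (mulmxA (\adj A) A y).
rewrite mul_adj_mx Ay mul_scalar_mx mxE (bigD1 ord_max) //= [RHS]mxE [in RHS]mxE.
rewrite eqxx mulr1 [in LHS]mxE eqxx -/A adj_minor_mx_max.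
set s := a n n - _; rewrite [in X in _ + X]big1 => [|i /negbTE i_n].
  by rewrite addr0.
by rewrite !mxE i_n mulr0.
Qed.

End BorderedDeterminant.

Section TodaDeterminant.
Variables (K : fieldType) (D : K -> K) (a : nat -> nat -> K) (n : nat).
Hypothesis HD : derivation D.
Hypothesis aD : forall i k, D (a i k) = a i.+1 k + k%:R * a i k.

Let N := n.+1.
Let A := minor_mx a N.
Let W k := \det (minor_mx a k).
Hypothesis A_unit : W N != 0.

Let g : 'cV[K]_N := \col_i a i N.
(* By Cramer's rule, the last entry of u is the minor in which column N replaces
   column n, divided by W N. *)
Let u := invmx A *m g.
Let K1 : 'M[K]_N := diag_mx (\row_k (k : nat)%:R).
Let Ash : 'M[K]_N := \matrix_(i, k) a i.+1 k.

Let Au : A \in unitmx.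
Proof. by rewrite unitmxE unitfE. Qed.

Let DA : map_mx D A = Ash + A *m K1.
Proof.
apply/matrixP => i k; rewrite !mxE aD; congr (_ + _).
rewrite (bigD1 k) //= !mxE eqxx mulr1n mulrC big1 ?addr0 // => l /negbTE lk.
by rewrite !mxE lk mulr0.
Qed.

(** Differentiate [A *m u = g]. The rows of [Ash] are those of [A] moved up by one, so [D g - Ash u]
    is [N g] outside the last row, where the Schur complement [s], equal to [W N.+1 / W N], is
    added. The corner of [invmx A] is [W n / W N], and the coefficient 1 of [u] is N - n. *)
Lemma toda_mu_deriv :
  D (u ord_max 0) = u ord_max 0 + W N.+1 * W n / W N ^+ 2.
Proof.
have Aug : A *m u = g by rewrite mulKVmx.
have gE i : (i < N)%N -> a i N = \sum_(k < N) a i k * u (inord k) 0.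
  move=> iN; have := congr1 (fun B : 'cV_N => B (Ordinal iN) 0) Aug.
  rewrite !mxE => <-; apply: eq_bigr => k _; rewrite mxE.
  by rewrite inord_val.
have WE := @det_border K a N (fun k => u (inord k) 0) gE.
set s := _ - _ in WE.
have DAu : map_mx D g = Ash *m u + A *m K1 *m u + A *m map_mx D u.
  by rewrite -Aug derivation_mulmx // DA mulmxDl.
have e1 : map_mx D g - Ash *m u = N%:R *: g + s *: delta_mx ord_max 0.
  apply/matrixP => i j; rewrite !mxE aD ord1 eqxx andbT.
  rewrite [a i.+1 N + _]addrC -addrA; congr (_ + _).
  case: eqVneq => [->|i_n] /=.
    rewrite mulr1 /s; congr (_ - _); apply: eq_bigr => k _.
    by rewrite [Ash _ _]mxE inord_val.
  rewrite mulr0; apply/eqP; rewrite subr_eq0; apply/eqP.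
  rewrite gE; last exact: (ltn_neq_ord_max i_n).
  by apply: eq_bigr => k _; rewrite [Ash _ _]mxE inord_val.
have e2 : map_mx D u = N%:R *: u + s *: (invmx A *m delta_mx ord_max 0)
                       - K1 *m u.
  apply: (can_inj (mulKmx Au)); rewrite mulmxBr mulmxDr -!scalemxAr.
  rewrite Aug mulKVmx // -e1 DAu [A *m (K1 *m u)]mulmxA.
  by rewrite -[Ash *m u + _ + _]addrA [Ash *m u + _]addrC addrK [RHS]addrAC subrr add0r.
have := congr1 (fun B : 'cV_N => B ord_max 0) e2.
have K1u : (K1 *m u) ord_max 0 = n%:R * u ord_max 0.
  by rewrite mul_diag_mx mxE [(\row__ _) _ _]mxE.
rewrite mxE => ->; rewrite mxE [X in X + _]mxE [X in _ + X = _]mxE K1u.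
rewrite [X in X + _ - _]mxE [X in _ + X - _]mxE -colE [col _ _ _ _]mxE.
have -> : invmx A ord_max ord_max = W n / W N.
  by rewrite /invmx Au mxE adj_minor_mx_max mulrC.
rewrite -[W N.+1]/(\det (minor_mx a N.+1)) WE -/(W N) /N -natr1.
have WN : W N != 0 := A_unit.
by field.
Qed.

(* Multiplying A on the right by the recursion in k equals multiplying it on the
   left by a lower Hessenberg matrix, up to the term in k^2; compare traces. *)
Lemma toda_mu (b r : nat -> K) (s : K) (c : nat -> nat -> K) :
    (forall i k, (i < N)%N -> (k < N)%N ->
       a i k.+1 - (if k is k'.+1 then b k * a i k' else 0) =
       s * k%:R ^+ 2 * a i k + r i * a i.+1 k + \sum_(l < i.+1) c i l * a l k) ->
  u ord_max 0 = s * (\sum_(k < N) k%:R ^+ 2)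
    + r n * (D (W N) / W N - \sum_(k < N) k%:R) + \sum_(i < N) c i i.
Proof.
move=> rec.
(* The recursion in k as a matrix with zero diagonal. In the last column the entry [a i N] falls
   outside [A]; the term with [g] in [M] puts it back, and it alone contributes to the trace of
   [M *m invmx A]. *)
pose X0 : 'M[K]_N := \matrix_(k', k)
  ((k' == k.+1 :> nat)%:R - (k == k'.+1 :> nat)%:R * b k).
pose M := A *m X0 + g *m delta_mx 0 ord_max.
pose L : 'M[K]_N := \matrix_(i, l) (if (l <= i)%N then c i l else 0).
pose K2 : 'M[K]_N := diag_mx (\row_k (k : nat)%:R ^+ 2).
pose R1 : 'M[K]_N := diag_mx (\row_k r k).
have ME : M = s *: (A *m K2) + R1 *m Ash + L *m A.
  apply/matrixP => i k; rewrite !mxE.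
  transitivity (a i k.+1 - (if k : nat is k'.+1 then b k * a i k' else 0)).
    rewrite big_ord1 !mxE eqxx /= -(inj_eq val_inj) /=.
    under eq_bigr => l _ do rewrite !mxE mulrBr.
    rewrite sumrB sum_ord_eq addrAC; congr (_ - _).
      rewrite ltnS; case: (ltngtP k n) => kn; last by rewrite kn mulr1 add0r.
        by rewrite mulr0 addr0.
      by move: (ltn_ord k); rewrite ltnS leqNgt kn.
    case: (k : nat) (ltn_ord k) => [|k'] k'n.
      by rewrite big1 // => l _; rewrite mul0r mulr0.
    under eq_bigr => l _ do rewrite eqSS [k' == _]eq_sym mulrCA mulrC mulrAC.
    by rewrite -mulr_suml sum_ord_eq (ltnW k'n) mulrC.
  rewrite rec //; congr (_ + _ + _).
  - rewrite (bigD1 k) //= !mxE eqxx mulr1n big1 ?addr0; last first.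
      by move=> l /negbTE lk; rewrite !mxE lk mulr0.
    by rewrite mulrAC -mulrA.
  - rewrite (bigD1 i) //= !mxE eqxx mulr1n big1 ?addr0 // => l /negbTE li.
    by rewrite !mxE eq_sym li mul0r.
  - rewrite (big_ord_widen_cond N (fun l => true) (fun l => c i l * a l k)) //.
    rewrite big_mkcond; apply: eq_bigr => l _; rewrite !mxE ltnS.
    by case: leqP; rewrite ?mul0r.
have trM : \tr (M *m invmx A) = u ord_max 0.
  rewrite mxtrace_mulC mulmxDr mulKmx // mxtraceD.
  rewrite [X in X + _](_ : _ = 0) ?add0r; last first.
    rewrite /mxtrace big1 // => k _; rewrite mxE.
    by rewrite !(ltn_eqF (ltnSn _)) mul0r subrr.
  by rewrite mulmxA -/u mxtrace_mulC -rowE trace_mx11 mxE.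
have trAsh : \tr (Ash *m invmx A) = D (W N) / W N - \sum_(k < N) k%:R.
  have -> : Ash = map_mx D A - A *m K1 by rewrite DA addrK.
  rewrite mulmxBl raddfB /= [\tr (A *m K1 *m _)]mxtrace_mulC mulKmx //.
  rewrite mxtrace_diag; congr (_ - _); last by apply: eq_bigr => k _; rewrite mxE.
  rewrite mxtrace_mulC /invmx Au -scalemxAl mxtraceZ -derivation_det //.
  by rewrite mulrC.
(* Outside its last row [Ash *m invmx A] is a shift with zero diagonal, so its trace is its last
   diagonal entry, and of all [r i] only [r n] appears. *)
have AshE i j : (i < n)%N -> (Ash *m invmx A) (inord i) j = (j == i.+1 :> nat)%:R.
  move=> i_n; have /matrixP/(_ (inord i.+1) j) := mulmxV Au.
  rewrite !mxE => e; rewrite -(inj_eq val_inj) /= inordK // in e.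
  rewrite eq_sym in e; rewrite -e; apply: eq_bigr => k _.
  by rewrite !mxE !inordK // ltnS ltnW.
rewrite -trM ME !mulmxDl !mxtraceD -scalemxAl mxtraceZ.
congr (_ * _ + _ + _).
- rewrite mxtrace_mulC mulKmx // mxtrace_diag.
  by apply: eq_bigr => k _; rewrite mxE.
- rewrite -trAsh -mulmxA /mxtrace mulr_sumr; apply: eq_bigr => i _.
  rewrite mul_diag_mx !mxE; case: (ltngtP i n) => [i_n||->//].
    have := AshE i i i_n; rewrite inord_val mxE (ltn_eqF (ltnSn _)) => ->.
    by rewrite !mulr0.
  by rewrite ltnNge -ltnS ltn_ord.
- rewrite mulmxK // /mxtrace; apply: eq_bigr => i _; by rewrite mxE leqnn.
Qed.

End TodaDeterminant.

(** * Toda equation for a Wronskian of exponentials *)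

Section ExponentialWronskian.
Variable K : fieldType.
Variables (D : K -> K) (x c d : K).
Hypotheses (HD : derivation D) (Dx : D x = x) (Dc : D c = 0) (Dd : D d = 0).

(* With x = e^(2s), so that D = x d/dx and 2 D = d/ds, entry (i, k) is e^(ks)
   times the i-th derivative in s of c_k e^(ks) + (-1)^k d_k e^(-ks). For k = 0
   the two exponentials coincide and only one of them is kept. *)
Definition exp_pos (k : nat) : K := oddsq_prod c k * x ^+ k *+ (0 < k)%N.
Definition exp_neg (k : nat) : K := (-1) ^+ k * oddsq_prod d k.
Definition exp_wronskian_entry (i k : nat) : K :=
  k%:R ^+ i * exp_pos k + (- k%:R) ^+ i * exp_neg k.

Local Notation a := exp_wronskian_entry.

Lemma oddsq_prodS (y : K) i :
  oddsq_prod y i.+1 = oddsq_prod y i * (y + (2 * i%:R + 1) ^+ 2).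
Proof.
rewrite /oddsq_prod big_nat_recr //=; congr (_ * (_ + _ ^+ 2)).
by rewrite -natr1; ring.
Qed.

Lemma derivation_oddsq_prod (y : K) i : D y = 0 -> D (oddsq_prod y i) = 0.
Proof.
move=> Dy; case: (HD) => DD DM; elim: i => [|i IHi].
  by rewrite /oddsq_prod big_geq // (derivation1 HD).
have -> : oddsq_prod y i.+1 = oddsq_prod y i * (y + (2 * i + 1)%:R ^+ 2).
  by rewrite oddsq_prodS natrD natrM.
by rewrite DM IHi mul0r add0r DD Dy (derivationX HD) (derivation_nat HD) !(mulr0, mul0rn, addr0).
Qed.

Lemma derivation_double : derivation (fun y => 2 * D y).
Proof.
case: (HD) => DD DM; split=> [y z|y z]; first by rewrite DD mulrDr.
by rewrite DM; ring.
Qed.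

Lemma derivation_wronskian_entry i k :
  2 * D (a i k) = a i.+1 k + k%:R * a i k.
Proof.
case: (HD) => DD DM; rewrite /a.
have Dk j : D (k%:R ^+ j) = 0.
  by rewrite (derivationX HD) (derivation_nat HD) mulr0 mul0rn.
have DkN j : D ((- k%:R) ^+ j) = 0.
  by rewrite (derivationX HD) (derivationN HD) (derivation_nat HD) oppr0 mulr0 mul0rn.
have Dp : D (exp_pos k) = k%:R * exp_pos k.
  rewrite /exp_pos; case: k {Dk DkN} => [|k]; first by rewrite mul0r (derivation0 HD).
  rewrite mulr1n DM derivation_oddsq_prod // (derivationX HD) Dx -exprSr -mulr_natr /=.
  by ring.
have Dn : D (exp_neg k) = 0.
  rewrite /exp_neg DM derivation_oddsq_prod // (derivationX HD) (derivationN HD).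
  by rewrite (derivation1 HD) oppr0 mulr0 mul0rn mul0r mulr0 addr0.
rewrite DD DM [D (_ * exp_neg k)]DM Dk DkN Dp Dn !exprS.
by ring.
Qed.

(** Multiplication by e^(es) before i differentiations replaces t^i by (t + e)^i, and for g = 1 + c
    the quadratic factor is (2 t + e)^2 + c. The remainder [w], of degree below i, yields the
    entries below the diagonal of the Hessenberg matrix in [toda_mu]. *)
Lemma shifted_power_expansion (e g : K) i : e ^+ 2 = 1 ->
  {w : {poly K} | (size w <= i)%N &
    forall t, (t + e) ^+ i * (4 * t ^+ 2 + 4 * e * t + g) =
      4 * t ^+ i.+2 + 4 * i.+1%:R * e * t ^+ i.+1
      + (2 * i%:R ^+ 2 + 2 * i%:R + g) * t ^+ i + w.[t]}.
Proof.
move=> e2; elim: i => [|i [w sw IHi]].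
  by exists 0 => [|t]; rewrite ?size_poly0 // horner0 !expr0; ring.
set h : K := 2 * i%:R ^+ 2 + 2 * i%:R + g in IHi *.
exists ((h * e) *: 'X^i + w * 'X + e *: w) => [|t].
  rewrite (leq_trans (size_polyD _ _)) // geq_max; apply/andP; split.
    rewrite (leq_trans (size_polyD _ _)) // geq_max; apply/andP; split.
      by rewrite (leq_trans (size_scale_leq _ _)) // size_polyXn.
    have [->|w0] := eqVneq w 0; first by rewrite mul0r size_poly0.
    by rewrite size_mulX.
  by rewrite (leq_trans (size_scale_leq _ _)) // ltnW.
rewrite exprS -mulrA IHi !(hornerD, hornerZ, hornerM, hornerXn, hornerX) /h.
(* [ring] cannot use e^2 = 1; this is the multiple of e^2 - 1 by which the two sides differ. *)
have e3 : 4 * (i%:R + 1) * (t * t ^+ i) * (e ^+ 2 - 1) = 0.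
  by rewrite e2 subrr mulr0.
by rewrite -[RHS]addr0 -e3 -!natr1 !exprS; ring.
Qed.

(* The functions g_k satisfy a three-term recursion whose step is the operator
   e^s (c + (2 d/ds + 1)^2) - e^(-s) (d + (2 d/ds - 1)^2) up to the factor e^s;
   it is written here after i differentiations. *)
Lemma wronskian_entry_recursion i :
  {w : {poly K} | (size w <= i)%N & forall k,
  a i k.+1 - (if k is k'.+1 then
     x * (c + (2 * k'%:R + 1) ^+ 2) * (d + (2 * k'%:R + 1) ^+ 2)
       * (k' == 0)%N.+1%:R * a i k' else 0) =
  4 * (x - 1) * k%:R ^+ 2 * a i k + 4 * (i.+1)%:R * (x + 1) * a i.+1 k
  + (x * (2 * i%:R ^+ 2 + 2 * i%:R + 1 + c) - (2 * i%:R ^+ 2 + 2 * i%:R + 1 + d))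
    * a i k + (w.[k%:R] * exp_pos k + w.[- k%:R] * exp_neg k)}.
Proof.
have [|w1 sw1 e1] := @shifted_power_expansion 1 (1 + c) i.
  by rewrite expr1n.
have [|w2 sw2 e2] := @shifted_power_expansion (-1) (1 + d) i.
  by rewrite sqrrN expr1n.
exists (x *: w1 - w2) => [|k].
  rewrite (leq_trans (size_polyD _ _)) // geq_max size_polyN sw2 andbT.
  by rewrite (leq_trans (size_scale_leq _ _)).
have E1 t : w1.[t] = _ := canRL (addKr _) (esym (e1 t)).
have E2 t : w2.[t] = _ := canRL (addKr _) (esym (e2 t)).
rewrite !hornerD !hornerN !hornerZ !E1 !E2 /a.
have op0 y : oddsq_prod y 0 = 1 by rewrite /oddsq_prod big_geq.
have p0 : exp_pos 0 = 0 by rewrite /exp_pos mulr0n.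
have p1 : exp_pos 1 = x * (c + 1).
  by rewrite /exp_pos mulr1n oddsq_prodS op0; ring.
have n0 : exp_neg 0 = 1 by rewrite /exp_neg op0 mulr1.
have pS j : exp_pos j.+2 = x * (c + (2 * j.+1%:R + 1) ^+ 2) * exp_pos j.+1.
  by rewrite /exp_pos !mulr1n oddsq_prodS [x ^+ _.+1]exprS; ring.
have nS j : exp_neg j.+1 = - (d + (2 * j%:R + 1) ^+ 2) * exp_neg j.
  by rewrite /exp_neg oddsq_prodS [(-1) ^+ j.+1]exprS; ring.
case: k => [|k].
  rewrite nS p0 p1 n0 subr0 !(exprS _ i.+1) !(exprS _ i) oppr0 !sub0r !add0r.
  rewrite !mulr1n -(natr1 i) !expr1n.
  by move: (0 ^+ i) ((-1) ^+ i) => Z S; ring.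
have b1 : k.+1%:R + 1 = k.+2%:R :> K by rewrite natr1.
have b2 : k.+1%:R - 1 = k%:R :> K by rewrite -natr1 addrK.
have b3 : - k.+1%:R + 1 = - k%:R :> K by rewrite -b2 opprB addrC.
have b4 : - k.+1%:R - 1 = - k.+2%:R :> K by rewrite -b1 opprD.
rewrite b1 b2 b3 b4 !nS !(exprS _ i.+1) !(exprS _ i).
(* For the index 1 both exponentials are lowered to the constant function, of which g_0 keeps a
   single copy; hence the factor [(k' == 0)%N.+1], which is 2 there. *)
case: k {b1 b2 b3 b4} => [|k].
  rewrite pS p0 n0 p1 eqxx oppr0.
  move: (1 ^+ i) (2 ^+ i) (0 ^+ i) ((- 1) ^+ i) ((- 2) ^+ i) => A1 A2 A3 A4 A5.
  by rewrite -!natr1; ring.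
rewrite !pS /= mulr1.
move: (k.+1%:R ^+ i) (k.+2%:R ^+ i) (k.+3%:R ^+ i) ((- k.+1%:R) ^+ i)
  ((- k.+2%:R) ^+ i) ((- k.+3%:R) ^+ i) => A1 A2 A3 A4 A5 A6.
by rewrite -!natr1; ring.
Qed.

Definition exp_wronskian n := \det (minor_mx a n).
Local Notation W := exp_wronskian.

Lemma double_sum_nat n : 2 * (\sum_(k < n) k%:R) = n%:R ^+ 2 - n%:R :> K.
Proof.
elim: n => [|n IHn]; first by rewrite big_ord0; ring.
by rewrite big_ord_recr mulrDr IHn -natr1; ring.
Qed.

Lemma sextuple_sum_sqr n :
  6 * (\sum_(k < n) k%:R ^+ 2) = n%:R * (n%:R - 1) * (2 * n%:R - 1) :> K.
Proof.
elim: n => [|n IHn]; first by rewrite big_ord0; ring.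
by rewrite big_ord_recr mulrDr IHn -natr1; ring.
Qed.

Lemma exp_wronskian_toda n : W n.+1 != 0 ->
  W n.+2 * W n = n.+1%:R *
   (((c + 1) * x + d + (2 * n.+1%:R - 1) ^+ 2) * W n.+1 ^+ 2
    + 16 * (1 + x) * (W n.+1 * D (D (W n.+1)) - D (W n.+1) ^+ 2)
    - 8 * (1 - x) * W n.+1 * D (W n.+1)).
Proof.
case: (HD) => DD DM W0.
(* The recursion lemma yields its remainder as data, so the remainder of row i can be named; its
   coefficients fill row i of [e] left of the diagonal. *)
pose h i := let: exist2 w _ _ := wronskian_entry_recursion i in w.
pose e i l := if l == i then
    x * (2 * i%:R ^+ 2 + 2 * i%:R + 1 + c) - (2 * i%:R ^+ 2 + 2 * i%:R + 1 + d)
  else (h i)`_l.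
pose b k := if k is k'.+1 then
  x * (c + (2 * k'%:R + 1) ^+ 2) * (d + (2 * k'%:R + 1) ^+ 2)
       * (k' == 0)%N.+1%:R else 0.
have Mu1 := toda_mu_deriv derivation_double derivation_wronskian_entry W0.
have Mu2 := @toda_mu _ _ _ _ derivation_double derivation_wronskian_entry W0
  b (fun i => 4 * (i.+1)%:R * (x + 1)) (4 * (x - 1)) e.
(* The affine expression of mu is put into the formula for its derivative; the side goal is the
   recursion. *)
rewrite {}Mu2 in Mu1; last first.
  move=> i k _ _.
  rewrite big_ord_recr /e /h /= eqxx.
  case: (wronskian_entry_recursion i) => w sw ew.
  transitivity (a i k.+1 - (if k is k'.+1 then
     x * (c + (2 * k'%:R + 1) ^+ 2) * (d + (2 * k'%:R + 1) ^+ 2)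
       * (k' == 0)%N.+1%:R * a i k' else 0)); first by case: (k).
  rewrite ew -!addrA; congr (_ + (_ + _)); rewrite [RHS]addrC; congr (_ + _).
  rewrite !(horner_coef_wide _ sw) !mulr_suml -big_split; apply: eq_bigr => l _.
  by rewrite ltn_eqF // /a mulrDr !mulrA.
set w := W n.+1 in W0 *.
have dg i : e i i = (x - 1) * (2 * i%:R ^+ 2 + 2 * i%:R + 1) + (c * x - d).
  by rewrite /e eqxx; ring.
have sdg : \sum_(i < n.+1) e i i =
    (x - 1) * (2 * (\sum_(k < n.+1) k%:R ^+ 2) + 2 * (\sum_(k < n.+1) k%:R) + n.+1%:R)
    + (c * x - d) * n.+1%:R.
  under eq_bigr => i _ do rewrite dg.
  rewrite big_split /= sumr_const card_ord mulr_natr.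
  rewrite -mulr_sumr !big_split /= -!mulr_sumr sumr_const card_ord.
  by [].
rewrite sdg -/(W n.+2) -/(W n.+1) -/(W n) -/w in Mu1.
have e0 := double_sum_nat n.+1; have e1 := sextuple_sum_sqr n.+1.
have D0 : D (\sum_(k < n.+1) k%:R) = 0.
  by rewrite derivation_sum // big1 // => k _; rewrite (derivation_nat HD).
have D1 : D (\sum_(k < n.+1) k%:R ^+ 2) = 0.
  rewrite derivation_sum // big1 // => k _.
  by rewrite (derivationX HD) (derivation_nat HD) mulr0 mul0rn.
move: e0 e1 D0 D1 Mu1.
move: (\sum_(k < n.+1) k%:R) (\sum_(k < n.+1) k%:R ^+ 2) => S0 S1 e0 e1 D0 D1.
have DN := derivation_nat HD n.+1; have D2 := derivation_nat HD 2.
have D4 := derivation_nat HD 4; have D1' := derivation1 HD.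
move: DN; move: (n.+1%:R : K) e0 e1 => N e0 e1 DN.
have Dq : D (D w / w) = (w * D (D w) - D w ^+ 2) / w ^+ 2.
  have : D (D w / w * w) = D (D w) by rewrite divfK.
  rewrite DM => e2; apply: (mulIf W0); rewrite -[LHS](addrK (D w / w * D w)) e2.
  by field.
have -> : 2 * D w / w = 2 * (D w / w) by rewrite mulrA.
rewrite !(Dq, DD, DM, derivationN HD, Dc, Dd, Dx, D0, D1, D1', DN).
move: (D w) (D (D w)) => w1 w2 /esym/(canRL (addKr _)) e2.
have {}e2 := canRL (divfK (expf_neq0 2 W0)) e2.

(* The power sums [S0] and [S1] are symbols for [field]; [z0] and [z1] are the multiples of their
   closed forms by which the two sides differ. *)
have z0 : (x + 1) * w ^+ 2 * (6 * S1 - N * (N - 1) * (2 * N - 1)) = 0.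
  by rewrite e1 subrr mulr0.
have z1 : (- 2 * N * (x - 1) + (x + 1)) * w ^+ 2 * (2 * S0 - (N ^+ 2 - N)) = 0.
  by rewrite e0 subrr mulr0.
rewrite e2 -[RHS]addr0 -[X in _ = _ + X]z0 -[RHS]addr0 -[X in _ = _ + X]z1.
by field.
Qed.

End ExponentialWronskian.

(** * Expansion of the Wronskian over subsets *)

Section SignedVandermonde.
Variables (n : nat) (I : {set 'I_n}).

(** For i < j, the distance between the points k (k in I) and -k (k not in I) attached to i and
    j. *)
Definition signed_dist (i j : 'I_n) : nat :=
  if (i \in I) == (j \in I) then (j - i)%N else (j + i)%N.

Definition signed_vandermonde : nat :=
  (\prod_(i < n) \prod_(j < n | (i < j)%N) signed_dist i j)%N.

(** For i < j the sign of a difference is that of the point attached to j; each j outside I thus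
    contributes one sign for each of the j indices below it. *)
Lemma signed_vandermondeE (R : comNzRingType) :
  \det (\matrix_(i < n, j < n) (if j \in I then j%:R else - j%:R : R) ^+ i) =
  (\prod_(j < n | j \notin I) (-1) ^+ j) * signed_vandermonde%:R.
Proof.
pose a : 'rV[R]_n := \row_j (if j \in I then j%:R else - j%:R).
have -> : \matrix_(i < n, j < n) (if j \in I then j%:R else - j%:R : R) ^+ i
  = Vandermonde n a by apply/matrixP => i j; rewrite !mxE.
rewrite det_Vandermonde /signed_vandermonde [LHS](exchange_big_dep predT) //=.
rewrite [in RHS](exchange_big_dep predT) //=.
rewrite natr_prod [X in X * _]big_mkcond -big_split; apply: eq_bigr => j _ /=.
rewrite natr_prod.
have -> : (if j \notin I then (-1) ^+ j else 1) =
          \prod_(i < n | (i < j)%N) (if j \notin I then -1 else 1) :> R.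
  case: (j \notin I); last by rewrite big1.
  rewrite -(big_ord_widen_cond n predT (fun=> -1) (ltnW (ltn_ord j))).
  by rewrite prodr_const card_ord.
rewrite -big_split; apply: eq_bigr => i ij /=.
rewrite !mxE /signed_dist; case: (j \in I); case: (i \in I) => /=.
- by rewrite mul1r natrB // ltnW.
- by rewrite mul1r natrD opprK.
- by rewrite mulN1r natrD opprD.
- by rewrite mulN1r natrB ?(ltnW ij) // opprB opprK addrC.
Qed.

Lemma signed_vandermonde_gt0 : (0 < signed_vandermonde)%N.
Proof.
apply: prodn_cond_gt0 => i _; apply: prodn_cond_gt0 => j ij.
rewrite /signed_dist; case: ifP => _; first by rewrite subn_gt0.
by rewrite addn_gt0 (leq_trans _ ij).
Qed.

End SignedVandermonde.

(** Multilinearity in the columns. Sets containing 0 drop out since [exp_pos] vanishes at 0, and the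
    signs in [exp_neg] cancel those of [signed_vandermondeE]. *)
Lemma exp_wronskianE (K : fieldType) (x c d : K) n :
  exp_wronskian x c d n =
  \sum_(I : {set 'I_n} | I \subset brange n)
    (signed_vandermonde I)%:R * (\prod_(i in I) oddsq_prod c i)
    * (\prod_(i in brange n :\: I) oddsq_prod d i) * x ^+ wt I.
Proof.
pose P k := exp_pos x c k; pose Q k := exp_neg d k.
have -> : exp_wronskian x c d n = \sum_(I : {set 'I_n})
   (\prod_i (if i \in I then P i else Q i)) *
   \det (\matrix_(i < n, j < n) (if j \in I then j%:R else - j%:R : K) ^+ i).
  under [RHS]eq_bigr => I _ do rewrite -det_tr.
  rewrite /exp_wronskian -[LHS]det_tr /determinant.
  transitivity (\sum_(s : 'S_n) \sum_(I : {set 'I_n}) (-1) ^+ s *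
    \prod_i (if i \in I then i%:R ^+ s i * P i else (- i%:R) ^+ s i * Q i)).
    apply: eq_bigr => s _; rewrite -big_distrr -bigA_distr /=; congr (_ * _).
    by apply: eq_bigr => i _; rewrite !mxE.
  rewrite exchange_big /=; apply: eq_bigr => I _.
  rewrite big_distrr /=; apply: eq_bigr => s _.
  rewrite mulrCA -big_split /=; congr (_ * _); apply: eq_bigr => i _ /=.
  by rewrite !mxE; case: ifP => _; rewrite mulrC.
rewrite (bigID (fun I : {set 'I_n} => I \subset brange n)) /=.
rewrite [X in _ + X]big1 ?addr0 => [|I]; last first.
  case/subsetPn => i iI; rewrite inE lt0n negbK => /eqP i0.
  by rewrite (bigD1 i) //= iI /P i0 /exp_pos mulr0n !mul0r.
apply: eq_bigr => I sI; rewrite signed_vandermondeE.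
have PE : \prod_(i in I) P i = (\prod_(i in I) oddsq_prod c i) * x ^+ wt I.
  rewrite /wt -prodrXr -big_split; apply: eq_bigr => i /(subsetP sI).
  by rewrite inE /P /exp_pos => ->.
have QE : \prod_(i in brange n :\: I) oddsq_prod d i =
          \prod_(i | i \notin I) oddsq_prod d i.
  rewrite [RHS](bigID [pred i | i \in brange n]) /= [X in _ * X]big1 ?mulr1.
    by apply: eq_bigl => i; rewrite inE.
  move=> i /andP[_]; rewrite inE lt0n negbK => /eqP ->.
  by rewrite /oddsq_prod big_geq.
rewrite QE big_if /= PE /Q /exp_neg big_split /=.
set s := \prod_(i < n | _) (-1) ^+ i.
have s2 : s * s = 1.
  by rewrite -big_split big1 // => i _ /=; rewrite -expr2 sqrr_sign.
set e := \prod_(i < n | i \notin I) oddsq_prod d i; set f := \prod_(i in I) _.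
set t := x ^+ _; rewrite [RHS](_ : _ = (s * s) * (f * t * e * (signed_vandermonde I)%:R)).
  by ring.
by rewrite s2; ring.
Qed.

(** * The Umemura polynomials *)

(** Stated for arbitrary field elements, so that [field] handles atoms instead of embedded
    polynomials and their derivatives. *)
Lemma quotient_ruleD (F : fieldType) (p q p' q' dp dq dp' dq' : F) :
    q != 0 -> q' != 0 ->
  (dp * q' + p * dq' + (dp' * q + p' * dq)) * (q * q')
    - (p * q' + p' * q) * (dq * q' + q * dq') =
  (q * q' * (q * q')) * ((dp * q - p * dq) / (q * q) + (dp' * q' - p' * dq') / (q' * q')).
Proof. by move=> q0 q'0; field; rewrite q0 q'0. Qed.

Lemma quotient_ruleM (F : fieldType) (p q p' q' dp dq dp' dq' : F) :
    q != 0 -> q' != 0 ->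
  (dp * p' + p * dp') * (q * q') - p * p' * (dq * q' + q * dq') =
  (q * q' * (q * q')) * ((dp * q - p * dq) / (q * q) * (p' / q')
    + p / q * ((dp' * q' - p' * dq') / (q' * q'))).
Proof. by move=> q0 q'0; field; rewrite q0 q'0. Qed.

(** * The derivation d/dv on rational functions *)

Section DerivationOfFractions.
Variable R : idomainType.
Implicit Types (f g : {fraction {poly R}}) (p q : {poly R}).

Lemma frac_ex f : exists p q, q != 0 /\ f = p%:F / q%:F.
Proof.
pose r := generic_quotient.repr f; exists (\n_r), (\d_r).
have r0 : \d_r != 0 by exact: denom_ratioP.
split=> //; apply: (canRL (mulfK _)); first by rewrite tofrac_eq0.
rewrite -[f]generic_quotient.reprK -/r; unlock FracField.tofrac.
rewrite -[LHS]FracField.pi_mul; apply/generic_quotient.eqmodP => /=.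
rewrite FracField.equivfE /FracField.mulf.
by rewrite !numden_Ratio ?(oner_eq0, mulr1) // mulrC.
Qed.

Lemma dfrac_tofrac p : dfrac p%:F = (p^`())%:F.
Proof.
rewrite -[X in dfrac X]divr1 -tofrac1 dfracE ?oner_neq0 //.
by rewrite derivC mulr0 subr0 mulr1 expr1n tofrac1 divr1.
Qed.

Lemma derivation_dfrac : derivation (@dfrac R).
Proof.
split=> f g; have [p [q [q0 ->]]] := frac_ex f;
  have [p' [q' [q'0 ->]]] := frac_ex g.
all: have qF : q%:F != 0 by rewrite tofrac_eq0.
all: have q'F : q'%:F != 0 by rewrite tofrac_eq0.
all: have qq'0 := mulf_neq0 q0 q'0.
all: have qq2 := mulf_neq0 (mulf_neq0 qF q'F) (mulf_neq0 qF q'F).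
  rewrite addf_div; [|exact: qF|exact: q'F].
  rewrite -!tofracM -tofracD (dfracE _ qq'0) (dfracE _ q0) (dfracE _ q'0).
  rewrite !derivD !derivM !(tofracD, tofracM, tofracXn, tofracN).
  by rewrite (quotient_ruleD _ _ _ _ _ _ qF q'F) [LHS]mulrC (mulKf qq2).
rewrite mulf_div -!tofracM (dfracE _ qq'0) (dfracE _ q0) (dfracE _ q'0).
rewrite !derivM !(tofracD, tofracM, tofracXn, tofracN).
by rewrite (quotient_ruleM _ _ _ _ _ _ qF q'F) [LHS]mulrC (mulKf qq2).
Qed.

End DerivationOfFractions.

Definition superfact (n : nat) : nat := (\prod_(k < n) k`!)%N.

Lemma superfact_gt0 n : (0 < superfact n)%N.
Proof. by apply: prodn_gt0 => k; apply: fact_gt0. Qed.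

Lemma superfactS n : superfact n.+1 = (superfact n * n`!)%N.
Proof. exact: big_ord_recr. Qed.

(** This lets the prefactor w^C(n,2) turn x^|I| into a product of powers of z and w without
    denominators. *)
Lemma wt_compl n (I : {set 'I_n}) : I \subset brange n ->
  (wt I + wt (brange n :\: I) = 'C(n, 2))%N.
Proof.
move=> sI; rewrite -bin2_sum big_mkord /wt.
rewrite [RHS](bigID [pred i | i \in brange n]) /= [X in _ = (_ + X)%N]big1; last first.
  by move=> i; rewrite inE lt0n negbK => /eqP.
rewrite addn0 [RHS](bigID [pred i | i \in I]) /=; congr addn; apply: eq_bigl => i.
  by case: (boolP (i \in I)) => [/(subsetP sI)->|]; rewrite ?andbF ?andbT.
by rewrite !inE andbC; case: (i \in I).
Qed.

Section UmemuraToda.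
Variables (K : fieldType) (dv : K -> K) (v b1 b2 : K).
Hypotheses (Hdv : derivation dv) (dv_v : dv v = 1).
Hypotheses (dv_b1 : dv b1 = 0) (dv_b2 : dv b2 = 0).
Hypothesis natr_neq0 : forall n, n.+1%:R != 0 :> K.
Hypothesis v2 : 2 + v != 0.

Local Notation z := ((2 - v) / 4).
Local Notation w := ((2 + v) / 4).
Local Notation c := (- 4 * b1 ^+ 2).
Local Notation d := (- 4 * b2 ^+ 2).
Local Notation x := (z / w).

Let nz4 : 4 != 0 :> K := natr_neq0 3.
Let nz2 : 2 != 0 :> K := natr_neq0 1.

Let w_neq0 : w != 0.
Proof. by rewrite mulf_neq0 ?invr_eq0. Qed.

(** This is (v^2 - 4)/4 d/dv. Since z' = -1/4, w' = 1/4 and z + w = 1, it is x d/dx for x = z/w, as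
    the Wronskian requires. *)
Let D (f : K) : K := - 4 * z * w * dv f.

Let HD : derivation D.
Proof.
have [DD DM] := Hdv; split=> f g; first by rewrite /D DD mulrDr.
by rewrite /D DM; ring.
Qed.

Let Dz : D z = z * w.
Proof.
have [DD DM] := Hdv.
have : dv (z * 4) = dv (2 - v) by rewrite divfK.
rewrite DM (derivationB Hdv) !(derivation_nat Hdv) dv_v mulr0 addr0 sub0r => e.
by rewrite /D -[dv z](mulfK nz4) e; field.
Qed.

Let Dw : D w = - (z * w).
Proof.
have -> : w = 1 - z by field.
rewrite (derivationB HD) (derivation1 HD) Dz sub0r; congr (- (_ * _)).
by field.
Qed.

Let Dx : D x = x.
Proof.
have [DD DM] := HD; have w0 := w_neq0.
have : D (x * w) = z * w by rewrite divfK // Dz.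
rewrite DM Dw => /(canRL (addrK _)) e.
apply: (mulIf w0); rewrite e divfK //.
by field; rewrite ?nz4 ?v2.
Qed.

Let Dconst b : dv b = 0 -> D (- 4 * b ^+ 2) = 0.
Proof.
move=> b0; rewrite /D; have [DD DM] := Hdv.
rewrite DM (derivationN Hdv) (derivation_nat Hdv) (derivationX Hdv) b0.
by ring.
Qed.

(** The body of [toda_rhs] over an abstract differential field; [toda_rhsE] identifies the two by
    conversion. *)
Definition toda_operator n (f : K) : K :=
  (1 / 4 * (- 2 * b1 ^+ 2 - 2 * b2 ^+ 2 + (b1 ^+ 2 - b2 ^+ 2) * v)
     + (n%:R - 1 / 2) ^+ 2) * f ^+ 2
  + 1 / 4 * (v ^+ 2 - 4) ^+ 2 * (f * dv (dv f) - dv f ^+ 2)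
  + 1 / 4 * (v ^+ 2 - 4) * v * f * dv f.

Lemma toda_operatorE n (f : K) : toda_operator n f =
  (c * z + d * w + (2 * n%:R - 1) ^+ 2) / 4 * f ^+ 2
  + 4 * (f * D (D f) - D f ^+ 2) - 2 * (w - z) * f * D f.
Proof.
have [DD DM] := HD.
have -> : D (D f) = - 4 * (z * w * (w - z) * dv f + z * w * D (dv f)).
  have D4 : D (- 4) = 0 by rewrite (derivationN HD) (derivation_nat HD) oppr0.
  by rewrite {2}/D DM DM DM D4 Dz Dw; ring.
rewrite /toda_operator /D.
by field; rewrite nz2 nz4.
Qed.

Definition umemura_tau n : K :=
  w ^+ 'C(n, 2) * exp_wronskian x c d n / (superfact n)%:R.

Lemma umemura_tauE n : umemura_tau n =
  \sum_(I : {set 'I_n} | I \subset brange n)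
    (signed_vandermonde I)%:R / (superfact n)%:R
    * (\prod_(i in I) oddsq_prod c i) * (\prod_(i in brange n :\: I) oddsq_prod d i)
    * z ^+ wt I * w ^+ wt (brange n :\: I).
Proof.
rewrite /umemura_tau exp_wronskianE mulr_sumr mulr_suml.
apply: eq_bigr => I sI; rewrite -(wt_compl sI) exprD (expr_div_n z w).
have := expf_neq0 (wt I) w_neq0.
have := natr_neq0 (superfact n).-1; rewrite prednK ?superfact_gt0 //.
move: ((superfact n)%:R : K) (w ^+ wt I) (w ^+ wt (brange n :\: I)) (z ^+ wt I)
  (\prod_(i in I) _) (\prod_(i in _ :\: _) _) => a b e f g h a0 b0.
by field; rewrite a0 b0.
Qed.

Definition umemura_T n : K := umemura_tau n / 2 ^+ (n * (n - 1)).

Definition umemura_denom m : nat := (superfact m * 2 ^ (m * (m - 1)))%N.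

(** The factor n + 1 cancels the one in [exp_wronskian_toda], and 4 turns its coefficients 16 and 8
    into the 4 and 2 of [toda_operatorE]. *)
Lemma umemura_denomM n :
  (umemura_denom n * umemura_denom n.+2 = 4 * n.+1 * umemura_denom n.+1 ^ 2)%N.
Proof.
rewrite /umemura_denom !superfactS factS.
have e : (n * (n - 1) + n.+2 * (n.+2 - 1) = 2 + (n.+1 * (n.+1 - 1)) * 2)%N.
  by case: n => // n; rewrite !subn1 /=; ring.
transitivity (superfact n * (superfact n * n`! * (n.+1 * n`!)) *
   2 ^ (n * (n - 1) + n.+2 * (n.+2 - 1)))%N.
  by rewrite expnD; ring.
by rewrite e expnD expnM; ring.
Qed.

Lemma double_bin2 n : 2 * 'C(n.+1, 2)%:R = n.+1%:R * n%:R :> K.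
Proof.
elim: n => [|n IHn]; first by rewrite bin_small //; ring.
by rewrite binS bin1 natrD mulrDr IHn -!natr1; ring.
Qed.

Local Notation W := (exp_wronskian x c d).

Lemma umemura_T_toda n : umemura_tau n.+1 != 0 ->
  umemura_T n * umemura_T n.+2 = toda_operator n.+1 (umemura_T n.+1).
Proof.
move=> t0; have [DD DM] := HD.
have W0 : W n.+1 != 0.
  by apply: contraNneq t0 => W0; rewrite /umemura_tau W0 mulr0 mul0r.
have toda := exp_wronskian_toda HD Dx (Dconst dv_b1) (Dconst dv_b2) W0.
have TE m : umemura_T m = (umemura_denom m)%:R^-1 * (w ^+ 'C(m, 2) * W m).
  rewrite /umemura_T /umemura_tau /umemura_denom natrM natrX invfM.
  by ring.
have Dw_exp j : D (w ^+ j) = - (j%:R * z * w ^+ j).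
  rewrite (derivationX HD) Dw; case: j => [|j]; first by rewrite !mul0r oppr0.
  by rewrite -mulr_natl /= [w ^+ j.+1]exprSr; ring.
have k0 m : (umemura_denom m)%:R != 0 :> K.
  by rewrite -(prednK (_ : 0 < umemura_denom m)%N) // muln_gt0 superfact_gt0 expn_gt0.
have Dk m : D (umemura_denom m)%:R^-1 = 0.
  have := derivation1 HD; rewrite -[X in D X](mulfV (k0 m)) DM (derivation_nat HD).
  by rewrite mul0r add0r => /eqP; rewrite mulf_eq0 (negbTE (k0 m)) => /eqP.
set N : K := 'C(n.+1, 2)%:R.
have DN : D N = 0 := derivation_nat HD _.
pose k : K := (umemura_denom n.+1)%:R^-1; pose u : K := w ^+ 'C(n.+1, 2).
have Du : D u = - (N * z * u) := Dw_exp _.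
have DT : D (umemura_T n.+1) = k * (u * (D (W n.+1) - N * z * W n.+1)).
  by rewrite TE DM Dk DM Dw_exp -/k -/u -/N; ring.
have DDT : D (D (umemura_T n.+1)) = k * (u * (D (D (W n.+1)) - 2 * N * z * D (W n.+1)
    - N * z * w * W n.+1 + N ^+ 2 * z ^+ 2 * W n.+1)).
  rewrite DT DM Dk DM Du (derivationB HD) [D (N * z * _)]DM [D (N * z)]DM DN Dz.
  by ring.
rewrite toda_operatorE DDT DT !TE -/k -/u.
transitivity (k ^+ 2 * u ^+ 2 * w / 4 * (n.+1%:R^-1 * (W n.+2 * W n))).
  (* The exponent exceeds twice the middle one by 1; this extra w clears the denominator of x =
     z/w. *)
  have e : ('C(n, 2) + 'C(n.+2, 2) = 'C(n.+1, 2) * 2 + 1)%N.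
    by rewrite [in LHS]binS bin1 [in RHS]binS [in LHS]binS !bin1; lia.
  transitivity (((umemura_denom n)%:R * (umemura_denom n.+2)%:R)^-1 *
     w ^+ ('C(n, 2) + 'C(n.+2, 2)) * (W n.+2 * W n)).
    by rewrite exprD invfM; ring.
  rewrite e exprD exprM expr1 -(natrM K (umemura_denom n) (umemura_denom n.+2)) umemura_denomM natrM natrM natrX -/u /k.
  have := natr_neq0 n; have := k0 n.+1.
  move: ((umemura_denom n.+1)%:R : K) (n.+1%:R : K) => q m q0 m0.
  by field; rewrite q0 m0 nz4.
rewrite toda mulKf //.
(* [N] is a symbol for [field]; this multiple of 2 N = (n + 1) n is the difference of the two
   sides. *)
have e2 : z * k ^+ 2 * u ^+ 2 * W n.+1 ^+ 2 * (n.+1%:R * n%:R - 2 * N) = 0.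
  by rewrite /N double_bin2 subrr mulr0.
rewrite -[LHS]addr0 -[X in _ + X = _]e2 -(natr1 n).
move: (W n.+1) (n%:R) => W' m; move: (D (D W')) (D W') {DT DDT Du DN Dk} => W2 W1.
by field; rewrite ?nz4 ?v2.
Qed.

End UmemuraToda.

(** * Polynomial representations *)

Section PolynomialEvaluation.
Variables (R : comNzRingType) (n : nat).
Implicit Types p q : {mpoly R[n]}.

Lemma rmorph_mmap (S S' : comNzRingType) (h : {rmorphism R -> S})
    (g : {rmorphism S -> S'}) (f : 'I_n -> S) p :
  g (mmap h f p) = mmap (g \o h) (g \o f) p.
Proof.
rewrite /mmap rmorph_sum; apply: eq_bigr => m _.
rewrite rmorphM; congr (_ * _); rewrite rmorph_prod.
by apply: eq_bigr => i _; rewrite rmorphXn.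
Qed.

(** Chain rule: both sides satisfy the Leibniz rule in p, so constants and variables suffice. *)
Lemma derivation_mmap (S : comNzRingType) (h : {rmorphism R -> S}) (D : S -> S)
    (f : 'I_n -> S) p : derivation D -> (forall c, D (h c) = 0) ->
  D (mmap h f p) = \sum_i mmap h f p^`M(i) * D (f i).
Proof.
move=> HD Dh; have [DD DM] := HD.
pose Q q := D (mmap h f q) = \sum_i mmap h f q^`M(i) * D (f i).
have QD q1 q2 : Q q1 -> Q q2 -> Q (q1 + q2).
  rewrite /Q rmorphD DD => -> ->; rewrite -big_split; apply: eq_bigr => i _.
  by rewrite mderivD rmorphD mulrDl.
have QM q1 q2 : Q q1 -> Q q2 -> Q (q1 * q2).
  rewrite /Q rmorphM DM => -> ->; rewrite mulr_suml mulr_sumr -big_split.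
  apply: eq_bigr => i _; rewrite mderivM rmorphD !rmorphM /=; ring.
have QC c : Q c%:MP.
  by rewrite /Q mmapC Dh big1 // => i _; rewrite mderivC mmap0 mul0r.
have QX i : Q 'X_i.
  rewrite /Q mmapX mmap1U (bigD1 i) //= mderivX mnm1E eqxx scale1r -[X in (X - _)%MM]add0m addmK.
  rewrite mpolyX0 rmorph1 mul1r big1 ?addr0 // => j /negbTE ji.
  by rewrite mderivX mnm1E eq_sym ji scale0r mmap0 mul0r.
have QXm m : Q 'X_[m].
  rewrite mpolyXE_id; elim/big_ind: _ => [|//|i _]; first by rewrite -mpolyC1.
  by elim: (m i) => [|k IHk]; rewrite ?exprS ?expr0 -?mpolyC1 //; apply: QM.
rewrite -/(Q p); elim/mpolyind: p => [|b m p _ _ IHp]; first by rewrite -mpolyC0.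
by apply: QD; rewrite // -mul_mpolyC; apply: QM.
Qed.

Definition euler (i : 'I_n) p : {mpoly R[n]} := 'X_i * p^`M(i).

Lemma derivation_mderiv (i : 'I_n) : derivation (@mderiv n R i).
Proof. by split=> p q; rewrite ?mderivD ?mderivM. Qed.

Lemma derivation_euler i : derivation (euler i).
Proof.
split=> p q; rewrite /euler ?mderivD ?mderivM; first exact: mulrDr.
by rewrite mulrDr !mulrA [p * _]mulrC.
Qed.

Lemma eulerX i (mu : 'X_{1..n}) : euler i 'X_[mu] = (mu i)%:R *: 'X_[mu].
Proof.
rewrite /euler mderivX -scalerAr; case: (posnP (mu i)) => [->|mu0].
  by rewrite !scale0r.
by rewrite -mpolyXD addmC submK // lep1mP -lt0n.
Qed.

Lemma eulerZ i c p : euler i (c *: p) = c *: euler i p.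
Proof. by rewrite /euler mderivZ scalerAr. Qed.

Lemma mcoeff_euler i p mu : (euler i p)@_mu = (mu i)%:R * p@_mu.
Proof.
rewrite [p in LHS]mpolyE (derivation_sum (derivation_euler i)) raddf_sum.
rewrite [p in RHS]mpolyE raddf_sum mulr_sumr; apply: eq_bigr => q _ /=.
rewrite eulerZ eulerX !mcoeffZ mcoeffX; case: eqP => [->|_].
  by rewrite mulrCA.
by rewrite !mulr0.
Qed.

End PolynomialEvaluation.

(** * Polynomial identities and Kronecker substitution *)

Lemma digits_lt B n (a : nat -> nat) : (forall i, (i < n)%N -> (a i < B)%N) ->
  (\sum_(i < n) a i * B ^ i < B ^ n)%N.
Proof.
elim: n => [|n IHn] aB; first by rewrite big_ord0 expn0.
rewrite big_ord_recr /= expnS.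
have := IHn (fun i i_n => aB i (ltnW i_n)); have := aB n (ltnSn n).
by move: (B ^ n)%N (\sum_(i < n) _)%N => b s; nia.
Qed.

(** Uniqueness of base B digits: under t_i = X^(B^i), distinct monomials of degree below B stay
    distinct. *)
Lemma digits_inj B n (a b : nat -> nat) :
    (forall i, (i < n)%N -> (a i < B)%N) -> (forall i, (i < n)%N -> (b i < B)%N) ->
    (\sum_(i < n) a i * B ^ i = \sum_(i < n) b i * B ^ i)%N ->
  forall i, (i < n)%N -> a i = b i.
Proof.
elim: n => [//|n IHn] aB bB; rewrite !big_ord_recr /=.
have la := digits_lt (fun i i_n => aB i (ltnW i_n)).
have lb := digits_lt (fun i i_n => bB i (ltnW i_n)).
move=> e; have en : a n = b n.
  have := congr1 (divn^~ (B ^ n)%N) e.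
  have B0 : (0 < B ^ n)%N by apply: leq_ltn_trans la.
  by rewrite /= !divnDMl // !divn_small.
move: e; rewrite en => /addIn e i; rewrite ltnS leq_eqVlt => /predU1P[->//|].
by apply: IHn => // j jn; [apply: aB | apply: bB]; apply: ltnW.
Qed.

Section InfiniteField.
Variable C : numFieldType.

(** The polynomial [e] cuts out the exceptional parameters: zeros of determinants, of pivots, or 0
    itself. *)
Lemma poly_ext_nonroot (e p q : {poly C}) : e != 0 ->
  (forall s, e.[s] != 0 -> p.[s] = q.[s]) -> p = q.
Proof.
move=> e0 pq; apply/eqP; rewrite -subr_eq0; apply: contraT => pq0.
have epq0 : e * (p - q) != 0 by rewrite mulf_neq0.
pose rs := [seq i%:R | i <- iota 0 (size (e * (p - q)))] : seq C.
have := max_poly_roots epq0 (_ : all (root _) rs) (_ : uniq rs).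
rewrite size_map size_iota ltnn; apply.
  apply/allP => s _; rewrite rootE hornerM hornerD hornerN.
  have [->|/pq ->] := eqVneq e.[s] 0; first by rewrite mul0r.
  by rewrite subrr mulr0.
by rewrite map_inj_uniq ?iota_uniq // => i j /eqP; rewrite eqr_nat => /eqP.
Qed.

Lemma poly_ext (p q : {poly C}) : (forall s, p.[s] = q.[s]) -> p = q.
Proof. by move=> pq; apply: (@poly_ext_nonroot 1) => // ; rewrite oner_neq0. Qed.

(** A one-parameter subgroup of the diagonal torus; [cochar_weight] is the exponent to which it
    sends a monomial. *)
Definition cocharacter n (k : 'I_n -> nat) (i : 'I_n) : {poly C} := 'X^(k i).

Definition cochar_weight n (k : 'I_n -> nat) (m : 'X_{1..n}) : nat :=
  \sum_i m i * k i.

Lemma mmap_cocharacter n (k : 'I_n -> nat) (p : {mpoly C[n]}) :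
  mmap polyC (cocharacter k) p =
  \sum_(m <- msupp p) p@_m *: 'X^(cochar_weight k m).
Proof.
rewrite /mmap; apply: eq_bigr => m _; rewrite -mul_polyC; congr (_ * _).
rewrite /mmap1 /cochar_weight -prodrXr; apply: eq_bigr => i _.
by rewrite /cocharacter -exprM mulnC.
Qed.

Lemma coef_mmap_cocharacter n (k : 'I_n -> nat) (p : {mpoly C[n]}) m0 :
    {in msupp p, forall m, cochar_weight k m = cochar_weight k m0 -> m = m0} ->
  (mmap polyC (cocharacter k) p)`_(cochar_weight k m0) = p@_m0.
Proof.
move=> inj; rewrite mmap_cocharacter coef_sum.
have [m0p|m0p] := boolP (m0 \in msupp p).
  rewrite (bigD1_seq m0) ?msupp_uniq //= coefZ coefXn eqxx mulr1.
  rewrite big_seq_cond big1 ?addr0 // => m /andP[mp /eqP mm0].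
  by rewrite coefZ coefXn; case: eqP => [/esym/(inj m mp)//|]; rewrite mulr0.
rewrite (memN_msupp_eq0 m0p) big_seq big1 // => m mp.
rewrite coefZ coefXn; case: eqP => [/esym/(inj m mp) e|]; last by rewrite mulr0.
by rewrite -e mp in m0p.
Qed.

Lemma cochar_digits_inj n B (m m' : 'X_{1..n}) :
    (mdeg m < B)%N -> (mdeg m' < B)%N ->
    cochar_weight (fun i : 'I_n => B ^ i)%N m =
    cochar_weight (fun i : 'I_n => B ^ i)%N m' ->
  m = m'.
Proof.
move=> mB m'B; rewrite /cochar_weight.
pose a (q : 'X_{1..n}) i := if insub i is Some j then q j else 0%N.
have aE q (i : 'I_n) : a q i = q i by rewrite /a valK.
have aB q i : (mdeg q < B)%N -> (i < n)%N -> (a q i < B)%N.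
  move=> qB i_n; rewrite -[i]/(val (Ordinal i_n)) aE; apply: leq_ltn_trans qB.
  by rewrite mdegE (bigD1 (Ordinal i_n)) //= leq_addr.
rewrite -(eq_bigr _ (fun i _ => congr1 (muln^~ _) (aE m i))).
rewrite -(eq_bigr _ (fun i _ => congr1 (muln^~ _) (aE m' i))).
move=> /digits_inj e; apply/mnmP => i; rewrite -!aE; apply: e => //.
  by move=> j; apply: aB.
by move=> j; apply: aB.
Qed.

Lemma cochar_digits_lt n B (m : 'X_{1..n}) : (mdeg m < B)%N ->
  (cochar_weight (fun i : 'I_n => B ^ i)%N m < B ^ n)%N.
Proof.
move=> mB; pose a i := if insub i is Some j then m j else 0%N.
have aE (i : 'I_n) : a i = m i by rewrite /a valK.
rewrite /cochar_weight -(eq_bigr _ (fun i _ => congr1 (muln^~ _) (aE i))).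
apply: (@digits_lt B n a) => i i_n; rewrite -[i]/(val (Ordinal i_n)) aE.
by apply: leq_ltn_trans mB; rewrite mdegE (bigD1 (Ordinal i_n)) //= leq_addr.
Qed.

Lemma mpoly_ext n (p q : {mpoly C[n]}) : (forall t, p.@[t] = q.@[t]) -> p = q.
Proof.
move=> pq; apply/eqP; rewrite -subr_eq0; apply/eqP.
have {pq} : forall t, (p - q).@[t] = 0 by move=> t; rewrite mevalB pq subrr.
move: (p - q) => {}p p0; pose k (i : 'I_n) := (msize p ^ i)%N.
have pk0 : mmap polyC (cocharacter k) p = 0.
  apply: poly_ext => s; rewrite horner0 -[LHS]/(horner_eval s _) rmorph_mmap.
  rewrite -[RHS](p0 (fun i => s ^+ k i)) /meval /mmap.
  apply: eq_bigr => m _; rewrite /= /horner_eval hornerC; congr (_ * _).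
  by apply: eq_bigr => i _; rewrite /= hornerXn.
apply/mpolyP => m; rewrite mcoeff0.
have [mp|/memN_msupp_eq0//] := boolP (m \in msupp p).
rewrite -(@coef_mmap_cocharacter _ k) ?pk0 ?coef0 // => m' m'p.
by apply: cochar_digits_inj; apply: msize_mdeg_lt.
Qed.

End InfiniteField.

Lemma mmap_eq (R S : comNzRingType) n (h h' : R -> S) (f f' : 'I_n -> S)
    (p : {mpoly R[n]}) : h =1 h' -> f =1 f' -> mmap h f p = mmap h' f' p.
Proof.
by move=> hh' ff'; apply: eq_bigr => m _; rewrite hh' (mmap1_eq _ ff').
Qed.

(** * Matrix-valued polynomials and their differentials *)

Section MatrixValuedPolynomials.
Variables (C : numFieldType) (n m : nat) (P : 'I_m -> 'I_m -> {mpoly C[n * n]}).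

(** The ring S is free: over C this is the representation, over [{poly C}] its values along a
    polynomial curve of matrices, which can be differentiated. *)
Definition pmx (S : comNzRingType) (h : C -> S) (A : 'M[S]_n) : 'M[S]_m :=
  \matrix_(a, b) mmap h (fun k => mxvec A 0 k) (P a b).

Lemma map_pmx (S S' : comNzRingType) (h : {rmorphism C -> S})
    (g : {rmorphism S -> S'}) (h' : C -> S') (A : 'M[S]_n) : g \o h =1 h' ->
  map_mx g (pmx h A) = pmx h' (map_mx g A).
Proof.
move=> gh; apply/matrixP => a b; rewrite !mxE rmorph_mmap.
by apply: mmap_eq => // k; rewrite -map_mxvec mxE.
Qed.

Local Notation r := (pmx idfun).
Local Notation rp := (pmx polyC).

Lemma horner_pmx (A : 'M[{poly C}]_n) s :
  map_mx (horner_eval s) (rp A) = r (map_mx (horner_eval s) A).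
Proof. by apply: map_pmx => c; rewrite /= /horner_eval hornerC. Qed.

Lemma polymx_ext p q (e : {poly C}) (A B : 'M[{poly C}]_(p, q)) : e != 0 ->
  (forall s, e.[s] != 0 -> map_mx (horner_eval s) A = map_mx (horner_eval s) B) ->
  A = B.
Proof.
move=> e0 AB; apply/matrixP => i j; apply: (poly_ext_nonroot e0) => s /AB.
by move/matrixP/(_ i j); rewrite !mxE.
Qed.

(** The differential of the polynomial map at g in the direction Z. *)
Definition dpmx (g Z : 'M[C]_n) : 'M[C]_m :=
  \matrix_(a, b) \sum_k (P a b)^`M(k).@[fun k => mxvec g 0 k] * mxvec Z 0 k.

Lemma dpmx_is_linear g : linear (dpmx g).
Proof.
move=> c Z Z'; apply/matrixP => a b; rewrite !mxE mulr_sumr -big_split.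
by apply: eq_bigr => k _; rewrite linearP /= !mxE mulrDr mulrCA.
Qed.

HB.instance Definition _ g := GRing.isLinear.Build C _ _ *:%R (dpmx g)
  (dpmx_is_linear g).

Lemma derivation_deriv : derivation (@deriv C).
Proof. by split=> p q; rewrite ?derivD ?derivM. Qed.

Lemma deriv_pmx (A : 'M[{poly C}]_n) s :
  map_mx (horner_eval s \o @deriv C) (rp A) =
  dpmx (map_mx (horner_eval s) A) (map_mx (horner_eval s \o @deriv C) A).
Proof.
apply/matrixP => a b; rewrite !mxE /= (derivation_mmap _ _ derivation_deriv).
  rewrite /horner_eval horner_sum; apply: eq_bigr => k _.
  rewrite hornerM -!map_mxvec !mxE; congr (_ * _).
  rewrite -[LHS]/(horner_eval s _) rmorph_mmap; apply: mmap_eq => [c|j] /=.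
    by rewrite /horner_eval hornerC.
  by rewrite mxE.
by move=> c; rewrite derivC.
Qed.

End MatrixValuedPolynomials.

Section PolynomialMatrixRepresentation.
Variables (C : numFieldType) (n m : nat) (P : 'I_m -> 'I_m -> {mpoly C[n * n]}).
Local Notation r := (pmx P idfun).
Local Notation rp := (pmx P polyC).
Local Notation "g %:pmx" := (map_mx polyC g) (at level 2, format "g %:pmx").
Hypothesis r1 : r 1%:M = 1%:M.
Hypothesis rM_unit : {in unitmx &, forall g h, r (g *m h) = r g *m r h}.

(** g + s and h + s are invertible except at the roots of two characteristic polynomials, so
    multiplicativity holds as an identity in s and can be read at s = 0, even for singular g and
    h. *)
Lemma pmxM (g h : 'M[C]_n) : r (g *m h) = r g *m r h.
Proof.
pose c (g : 'M[C]_n) := g%:pmx + 'X%:M.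
have cE s (k : 'M[C]_n) : map_mx (horner_eval s) (c k) = k + s%:M.
  rewrite map_mxD -map_mx_comp map_scalar_mx /= /horner_eval hornerX.
  by congr (_ + _); apply/matrixP => i j; rewrite mxE /= hornerC.
have cN k : \det (c k) = char_poly (- k).
  by rewrite /char_poly /char_poly_mx map_mxN opprK addrC.
have e0 : \det (c g) * \det (c h) != 0.
  by rewrite !cN mulf_neq0 // monic_neq0 ?char_poly_monic.
have : rp (c g *m c h) = rp (c g) *m rp (c h).
  apply: (polymx_ext e0) => s; rewrite hornerM mulf_eq0 => /norP[gs hs].
  rewrite map_mxM !horner_pmx map_mxM /=; apply: rM_unit.
    by rewrite unitmxE unitfE det_map_mx.
  by rewrite unitmxE unitfE det_map_mx.
move/(congr1 (map_mx (horner_eval 0))); rewrite map_mxM !horner_pmx map_mxM !cE.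
by rewrite !raddf0 !addr0.
Qed.

Lemma pmxM_poly (A B : 'M[{poly C}]_n) : rp (A *m B) = rp A *m rp B.
Proof.
apply: (@polymx_ext _ _ _ 1) => [|s _]; first exact: oner_neq0.
by rewrite map_mxM !horner_pmx map_mxM pmxM.
Qed.

(** The representation of the Lie algebra. *)
Definition lie_pmx (X : 'M[C]_n) : 'M[C]_m := dpmx P 1%:M X.
Local Notation dr := lie_pmx.

Lemma horner_line (g X : 'M[C]_n) s :
  map_mx (horner_eval s) (g%:pmx + 'X *: X%:pmx) = g + s *: X.
Proof.
by apply/matrixP => i j; rewrite !mxE /horner_eval hornerD hornerM hornerX !hornerC.
Qed.

Lemma deriv_line (g X : 'M[C]_n) s :
  map_mx (horner_eval s \o @deriv C) (g%:pmx + 'X *: X%:pmx) = X.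
Proof.
apply/matrixP => i j; rewrite !mxE /= derivD derivM !derivC derivX mulr0 addr0.
by rewrite add0r mul1r /horner_eval hornerC.
Qed.

Lemma deriv_rp_line (g X : 'M[C]_n) :
  map_mx (horner_eval 0 \o @deriv C) (rp (g%:pmx + 'X *: X%:pmx)) = dpmx P g X.
Proof. by rewrite deriv_pmx horner_line deriv_line scale0r addr0. Qed.

Lemma rp_const (g : 'M[C]_n) : rp g%:pmx = (r g)%:pmx.
Proof. by rewrite (@map_pmx _ _ _ P _ _ idfun polyC polyC). Qed.

Lemma deriv_mulmx p q k (A : 'M[{poly C}]_(p, q)) (B : 'M[{poly C}]_(q, k)) s :
  map_mx (horner_eval s \o @deriv C) (A *m B) =
  map_mx (horner_eval s \o @deriv C) A *m map_mx (horner_eval s) B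
  + map_mx (horner_eval s) A *m map_mx (horner_eval s \o @deriv C) B.
Proof.
by rewrite !map_mx_comp (derivation_mulmx (@derivation_deriv C)) map_mxD !map_mxM.
Qed.

Lemma horner_constmx p q (A : 'M[C]_(p, q)) s : map_mx (horner_eval s) A%:pmx = A.
Proof. by apply/matrixP => i j; rewrite !mxE /horner_eval hornerC. Qed.

Lemma deriv0_constmx p q (A : 'M[C]_(p, q)) s :
  map_mx (horner_eval s \o @deriv C) A%:pmx = 0.
Proof. by apply/matrixP => i j; rewrite !mxE /= derivC /horner_eval horner0. Qed.

Lemma lineM (g X : 'M[C]_n) :
  g%:pmx + 'X *: (g *m X)%:pmx = g%:pmx *m ((1%:M)%:pmx + 'X *: X%:pmx).
Proof. by rewrite !map_mxM mulmxDr -scalemxAr map_mx1 mulmx1. Qed.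

Lemma mulline (g X : 'M[C]_n) :
  g%:pmx + 'X *: (X *m g)%:pmx = ((1%:M)%:pmx + 'X *: X%:pmx) *m g%:pmx.
Proof. by rewrite !map_mxM mulmxDl -scalemxAl map_mx1 mul1mx. Qed.

(** Derivative at s = 0 of r(g (1 + s X)) = r(g) r(1 + s X). *)
Lemma pmx_lie (g X : 'M[C]_n) : r g *m dr X = dpmx P g (g *m X).
Proof.
rewrite -deriv_rp_line lineM pmxM_poly deriv_mulmx rp_const.
by rewrite deriv0_constmx mul0mx add0r horner_constmx deriv_rp_line.
Qed.

Lemma lie_pmxl (g X : 'M[C]_n) : dr X *m r g = dpmx P g (X *m g).
Proof.
rewrite -deriv_rp_line mulline pmxM_poly deriv_mulmx rp_const.
by rewrite deriv0_constmx mulmx0 addr0 horner_constmx deriv_rp_line.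
Qed.

Lemma pmx_lie_conj (g X : 'M[C]_n) : g \in unitmx ->
  r g *m dr X = dr (g *m X *m invmx g) *m r g.
Proof. move=> gU; rewrite pmx_lie lie_pmxl. by rewrite mulmxKV. Qed.

Definition d2pmx (X Y : 'M[C]_n) : 'M[C]_m :=
  \matrix_(a, b) \sum_k \sum_l
   (P a b)^`M(k)^`M(l).@[fun k => mxvec 1%:M 0 k] * mxvec X 0 l * mxvec Y 0 k.

(** Differentiate r(1 + s X) dr(Y) at s = 0: by [pmx_lie] it is the differential at 1 + s X in the
    direction (1 + s X) Y. The Hessian [d2pmx] is symmetric and so cancels in the commutator. *)
Lemma lie_pmxM (X Y : 'M[C]_n) : dr X *m dr Y = d2pmx X Y + dr (X *m Y).
Proof.
have e : map_mx (horner_eval 0 \o @deriv C)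
    (rp ((1%:M)%:pmx + 'X *: X%:pmx) *m (dr Y)%:pmx) = dr X *m dr Y.
  rewrite deriv_mulmx deriv0_constmx mulmx0 addr0 horner_constmx.
  by rewrite deriv_rp_line.
rewrite -e; set line := _ + 'X *: _.
have -> : rp line *m (dr Y)%:pmx = \matrix_(a, b)
   \sum_k mmap polyC (fun k => mxvec line 0 k) (P a b)^`M(k) *
           mxvec (line *m Y%:pmx) 0 k.
  apply: (@polymx_ext _ _ _ 1) => [|s _]; first exact: oner_neq0.
  rewrite map_mxM horner_pmx horner_constmx pmx_lie.
  apply/matrixP => a b; rewrite !mxE /horner_eval horner_sum; apply: eq_bigr => k _.
  rewrite hornerM; congr (_ * _); last first.
    have -> : map_mx (horner_eval s) line *m Y =
              map_mx (horner_eval s) (line *m Y%:pmx).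
      by rewrite map_mxM horner_constmx.
    by rewrite -map_mxvec mxE.
  rewrite -[RHS]/(horner_eval s _) rmorph_mmap; apply: mmap_eq => [c|j] /=.
    by rewrite /horner_eval hornerC.
  by rewrite -map_mxvec mxE.
have line0 : map_mx (horner_eval 0) line = 1%:M.
  by rewrite horner_line scale0r addr0.
have lineY0 : map_mx (horner_eval 0) (line *m Y%:pmx) = Y.
  by rewrite map_mxM line0 horner_constmx mul1mx.
have lineY1 : map_mx (horner_eval 0 \o @deriv C) (line *m Y%:pmx) = X *m Y.
  by rewrite deriv_mulmx deriv0_constmx mulmx0 addr0 horner_constmx deriv_line.
have line1 : map_mx (horner_eval 0 \o @deriv C) line = X by rewrite deriv_line.
have mE k q : (mmap polyC (fun k => mxvec line 0 k) q).[0] = q.@[fun k => mxvec 1%:M 0 k]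
    /\ (mxvec (line *m Y%:pmx) 0 k).[0] = mxvec Y 0 k.
  split; last by rewrite -[in RHS]lineY0 -map_mxvec [RHS]mxE.
  rewrite -[LHS]/(horner_eval 0 _) rmorph_mmap; apply: mmap_eq => [c|j] /=.
    by rewrite /horner_eval hornerC.
  by rewrite -line0 -map_mxvec [RHS]mxE.
apply/matrixP => a b; rewrite !mxE /= /horner_eval.
rewrite (derivation_sum (@derivation_deriv C)) horner_sum -big_split.
apply: eq_bigr => k _ /=; rewrite derivM hornerD !hornerM.
rewrite (mE k _).1 (mE k 0).2; congr (_ + _ * _).
  rewrite (derivation_mmap _ _ (@derivation_deriv C)) => [|c]; last by rewrite derivC.
  rewrite horner_sum mulr_suml; apply: eq_bigr => l _.
  rewrite hornerM (mE k _).1; congr (_ * _ * _).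
  by rewrite -[in RHS]line1 -map_mxvec [RHS]mxE.
by rewrite -lineY1 -map_mxvec [RHS]mxE.
Qed.

Lemma d2pmxC (X Y : 'M[C]_n) : d2pmx X Y = d2pmx Y X.
Proof.
apply/matrixP => a b; rewrite !mxE exchange_big; apply: eq_bigr => k _.
by apply: eq_bigr => l _; rewrite mderiv_comm mulrAC.
Qed.

Lemma lie_pmx_bracket (X Y : 'M[C]_n) :
  dr X *m dr Y - dr Y *m dr X = dr (X *m Y - Y *m X).
Proof.
have -> : dr (X *m Y - Y *m X) = dr (X *m Y) - dr (Y *m X) by rewrite /lie_pmx raddfB.
rewrite !lie_pmxM [d2pmx Y X]d2pmxC.
by rewrite opprD addrACA subrr add0r.
Qed.

End PolynomialMatrixRepresentation.

(** * Density of the products L U *)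

Definition unilower (R : pzRingType) n (L : 'M[R]_n) : Prop :=
  (forall i, L i i = 1) /\ forall i j : 'I_n, (i < j)%N -> L i j = 0.

Definition upper (R : pzRingType) n (U : 'M[R]_n) : Prop :=
  forall i j : 'I_n, (j < i)%N -> U i j = 0.

Lemma upper_unit (C : fieldType) n (U : 'M[C]_n) :
  upper U -> (forall i, U i i != 0) -> U \in unitmx.
Proof.
move=> Uu U0; rewrite -unitmx_tr unitmxE det_trig.
  by rewrite unitfE; apply/prodf_neq0 => i _; rewrite mxE.
by apply/is_trig_mxP => i j ij; rewrite mxE Uu.
Qed.

(** The Schur complement is multiplied by the pivot [a] to remain polynomial. It inherits the value
    1 at s = 0, so no pivot is the zero polynomial, and [e] is their product. *)
Lemma generic_lu (C : fieldType) n (A : 'M[{poly C}]_n) :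
    map_mx (horner_eval 0) A = 1%:M ->
  exists2 e : {poly C}, e != 0 & forall s, e.[s] != 0 ->
    exists L U, [/\ map_mx (horner_eval s) A = L *m U, unilower L, upper U
                  & forall i, U i i != 0].
Proof.
elim: n => [|n IHn] in A *.
  move=> _; exists 1 => [|s _]; first exact: oner_neq0.
  by exists 1%:M, 1%:M; split=> [|||[]//]; [apply/matrixP => -[]|split=> [[]|[]]|case].
rewrite -[n.+1]/(1 + n)%N in A * => A0.
pose a := A 0 0; pose b := ursubmx A; pose c := dlsubmx A.
pose S := a *: drsubmx A - c *m b.
have a0 : a.[0] = 1 by move/matrixP/(_ 0 0): A0; rewrite !mxE.
have cE : map_mx (horner_eval 0) c = 0.
  apply/matrixP => i j; move/matrixP/(_ (rshift 1 i) (lshift n j)): A0.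
  by rewrite !mxE eq_rlshift.
have S0 : map_mx (horner_eval 0) S = 1%:M.
  rewrite map_mxB map_mxM cE mul0mx subr0.
  apply/matrixP => i j; move/matrixP/(_ (rshift 1 i) (rshift 1 j)): A0.
  rewrite !mxE /= /horner_eval hornerM a0 mul1r => ->.
  by rewrite (inj_eq (@rshift_inj _ _)).
have [e e0 He] := IHn _ S0.
exists (a * e) => [|s].
  by rewrite mulf_neq0 //; apply: contraTneq (oner_neq0 C) => a00; rewrite -a0 a00 horner0 eqxx.
rewrite hornerM mulf_eq0 negb_or => /andP[as0 /He[L [U [SE [L1 L0] Uu U0]]]].
pose L' : 'M[C]_(1 + n) := block_mx 1%:M 0 (a.[s]^-1 *: map_mx (horner_eval s) c) L.
pose U' : 'M[C]_(1 + n) := block_mx (a.[s])%:M (map_mx (horner_eval s) b) 0 (a.[s]^-1 *: U).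
exists L', U'; split.
- rewrite mulmx_block !mul1mx !mul0mx !mulmx0 !addr0.
  rewrite -[A]submxK map_block_mx; congr block_mx.
  + by apply/matrixP => i j; rewrite !ord1 !mxE eqxx mulr1n; congr (_ .[s]); congr (A _ _); apply/val_inj.
  + by rewrite mul_mx_scalar scalerA mulfV // scale1r.
  + rewrite -scalemxAl -scalemxAr -scalerDr -SE /S map_mxB map_mxM addrC subrK.
    by apply/matrixP => i j; rewrite !mxE /= /horner_eval hornerM mulKf.
- split=> [i|i j]; rewrite /L'.
    case: (split_ordP i) => k ->; rewrite ?block_mxEul ?block_mxEdr ?L1 //.
    by rewrite ord1 mxE eqxx.
  case: (split_ordP i) => k ->; case: (split_ordP j) => l ->;
    rewrite ?block_mxEul ?block_mxEur ?block_mxEdl ?block_mxEdr /=.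
  + by rewrite !ord1 ltnn.
  + by rewrite mxE.
  + by rewrite [l]ord1.
  + by rewrite ltn_add2l; apply: L0.
- move=> i j; rewrite /U'.
  case: (split_ordP i) => k ->; case: (split_ordP j) => l ->;
    rewrite ?block_mxEul ?block_mxEur ?block_mxEdl ?block_mxEdr /=.
  + by rewrite !ord1 ltnn.
  + by rewrite [k]ord1.
  + by rewrite mxE.
  + by rewrite ltn_add2l mxE => /Uu ->; rewrite mulr0.
- move=> i; rewrite /U'; case: (split_ordP i) => k ->.
    by rewrite block_mxEul ord1 mxE eqxx mulr1n.
  by rewrite block_mxEdr mxE mulf_neq0 ?invr_eq0.
Qed.

(** * Characters of highest weight representations *)

Section HighestWeight.
Variables (C : numFieldType) (n m : nat) (P : 'I_m -> 'I_m -> {mpoly C[n * n]}).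
Local Notation r := (pmx P idfun).
Local Notation rp := (pmx P polyC).
Local Notation "g %:pmx" := (map_mx polyC g) (at level 2, format "g %:pmx").
Hypothesis r1 : r 1%:M = 1%:M.
Hypothesis rM_unit : {in unitmx &, forall g h, r (g *m h) = r g *m r h}.

Variables (lam : 'I_n -> nat) (u : 'cV[C]_m).
Hypothesis hw : forall b, b \in unitmx -> upper b ->
  r b *m u = (\prod_i b i i ^+ lam i) *: u.
Hypothesis u0 : u != 0.
(** The form in which irreducibility is used: the orbit of u spans the space. *)
Hypothesis cyclic_u : forall phi : 'rV[C]_m,
  {in unitmx, forall g, phi *m r g *m u = 0} -> phi = 0.

(** Join 1 to g by a line. Almost every point of it is some L U, and U only rescales u; so phi
    vanishes along the whole line, in particular at g. *)
Lemma lower_cyclic (phi : 'rV[C]_m) :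
  (forall L, unilower L -> phi *m r L *m u = 0) -> phi = 0.
Proof.
move=> phi0; apply: cyclic_u => g _.
pose A : 'M[{poly C}]_n := (1%:M)%:pmx + 'X *: (g - 1%:M)%:pmx.
have A0 : map_mx (horner_eval 0) A = 1%:M by rewrite horner_line scale0r addr0.
have A1 : map_mx (horner_eval 1) A = g by rewrite horner_line scale1r addrC subrK.
have [e e0 He] := generic_lu A0.
have q0 : phi%:pmx *m rp A *m u%:pmx = 0.
  apply: (polymx_ext e0) => s /He[L [U [AE Ll Uu U0]]].
  rewrite !map_mxM horner_pmx !horner_constmx AE pmxM // mulmxA -[_ *m r U *m u]mulmxA.
  rewrite (hw (upper_unit Uu U0) Uu) -scalemxAr phi0 // scaler0.
  by apply/matrixP => i j; rewrite !mxE /horner_eval horner0.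
move/(congr1 (map_mx (horner_eval 1))): q0.
rewrite !map_mxM horner_pmx !horner_constmx A1 => ->.
by apply/matrixP => i j; rewrite !mxE /horner_eval horner0.
Qed.

Lemma lower_cyclic_mx k (M : 'M[C]_(k, m)) :
  (forall L, unilower L -> M *m r L *m u = 0) -> M = 0.
Proof.
move=> M0; apply/row_matrixP => i; rewrite row0; apply: lower_cyclic => L Ll.
by rewrite -!row_mul M0 // row0.
Qed.

Section Cocharacter.
Variable k : 'I_n -> nat.
Hypothesis k_mono : forall i j : 'I_n, (j <= i)%N -> (k j <= k i)%N.

Definition cochar_mx : 'M[{poly C}]_n := diag_mx (\row_i cocharacter C k i).
Local Notation t := cochar_mx.
Local Notation e := (\sum_i lam i * k i)%N.

Lemma horner_cochar_mx s : map_mx (horner_eval s) t = diag_mx (\row_i s ^+ k i).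
Proof.
apply/matrixP => i j; rewrite !mxE /cocharacter /horner_eval hornerMn hornerXn.
by [].
Qed.

Lemma diag_upper (d : 'rV[C]_n) : upper (diag_mx d).
Proof. by move=> i j ij; rewrite mxE -(inj_eq val_inj) /= (gtn_eqF ij). Qed.

Lemma diag_unit (d : 'rV[C]_n) : (forall i, d 0 i != 0) -> diag_mx d \in unitmx.
Proof.
move=> d0; apply: upper_unit (diag_upper _) _ => i.
by rewrite mxE eqxx mulr1n.
Qed.

Lemma cochar_hw : rp t *m u%:pmx = 'X^e *: u%:pmx.
Proof.
apply: (polymx_ext (negbT (polyX_eq0 C))) => s; rewrite hornerX => s0.
rewrite map_mxM horner_pmx horner_constmx horner_cochar_mx hw.
- apply/matrixP => i j; rewrite !mxE /horner_eval hornerM hornerXn hornerC.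
  congr (_ * _); rewrite -prodrXr; apply: eq_bigr => l _.
  by rewrite !mxE eqxx mulr1n -exprM mulnC.
- by apply: diag_unit => i; rewrite mxE expf_neq0.
- exact: diag_upper.
Qed.

(** This is t L t^-1; its entries are polynomials because L is lower triangular and k increases. *)
Definition cochar_conj (L : 'M[C]_n) : 'M[{poly C}]_n :=
  \matrix_(i, j) (if (j <= i)%N then (L i j)%:P * 'X^(k i - k j) else 0).

Lemma cochar_lower L : unilower L ->
  rp t *m (r L *m u)%:pmx = 'X^e *: (rp (cochar_conj L) *m u%:pmx).
Proof.
case=> _ L0; have -> : (r L *m u)%:pmx = rp L%:pmx *m u%:pmx.
  by rewrite map_mxM rp_const.
rewrite mulmxA -pmxM_poly //.
have -> : t *m L%:pmx = cochar_conj L *m t.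
  rewrite mul_diag_mx mul_mx_diag; apply/matrixP => i j; rewrite !mxE.
  case: leqP => ij; last by rewrite L0 // mulr0 mul0r.
  by rewrite /cocharacter -mulrA -exprD subnK ?k_mono // mulrC.
by rewrite pmxM_poly // -mulmxA cochar_hw -scalemxAr.
Qed.

Lemma coef_mulmx_const p q s (A : 'M[{poly C}]_(p, q)) (B : 'M[C]_(q, s)) j :
  map_mx (coefp j) (A *m B%:pmx) = map_mx (coefp j) A *m B.
Proof.
apply/matrixP => a b; rewrite !mxE /coefp coef_sum; apply: eq_bigr => l _.
by rewrite !mxE coefMC.
Qed.

(* On L u with L unipotent lower triangular, the cocharacter acts with exponents
   at least e, and these vectors span by the density of L U. *)
Lemma cochar_coef_lt j : (j < e)%N -> map_mx (coefp j) (rp t) = 0.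
Proof.
move=> je; apply: lower_cyclic_mx => L Ll; rewrite -mulmxA.
rewrite -coef_mulmx_const cochar_lower //; apply/matrixP => a b.
by rewrite !mxE /coefp mulrC coefMXn je.
Qed.

Hypothesis k_strict : forall i j : 'I_n, (j < i)%N -> (k j < k i)%N.

(** For strictly increasing k the conjugate t L t^-1 becomes 1 at X = 0, so the lowest coefficient
    sends every L u to u. As these vectors span, it is the projector [u *m phi] on the line of u. *)
Lemma cochar_top : exists2 phi : 'rV[C]_m,
  map_mx (coefp e) (rp t) = u *m phi & phi *m u = 1%:M.
Proof.
set E := map_mx _ _.
have EL L : unilower L -> E *m r L *m u = u.
  move=> Ll; have [L1 L0] := Ll; rewrite -mulmxA -coef_mulmx_const cochar_lower //.
  have c0 : map_mx (horner_eval 0) (cochar_conj L) = 1%:M.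
    apply/matrixP => i j; rewrite !mxE /horner_eval.
    case: (ltngtP j i) => ij.
    - rewrite hornerM hornerXn hornerC expr0n subn_eq0 leqNgt k_strict //= mulr0.
      by rewrite -(inj_eq val_inj) /= gtn_eqF.
    - by rewrite horner0 -(inj_eq val_inj) /= ltn_eqF.
    - by rewrite (val_inj ij) L1 subnn expr0 mulr1 hornerC eqxx.
  have := congr1 (fun M => M *m u) (horner_pmx P (cochar_conj L) 0).
  rewrite c0 r1 mul1mx => uE; rewrite -[RHS]uE.
  apply/matrixP => a b; rewrite !mxE /coefp mulrC coefMXn ltnn subnn coef_sum.
  by apply: eq_bigr => l _; rewrite !mxE coefMC /horner_eval horner_coef0.
have [a ua] : exists a, u a 0 != 0.
  apply/existsP; rewrite -negb_forall; apply: contra u0 => /forallP ua0.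
  by apply/eqP/matrixP => a b; rewrite ord1 mxE; apply/eqP.
pose phi := (u a 0)^-1 *: row a E.
have phiL L : unilower L -> phi *m r L *m u = 1%:M.
  move=> Ll; rewrite /phi -!scalemxAl -!row_mul EL //.
  by apply/matrixP => i j; rewrite !ord1 !mxE eqxx mulVf.
have I1 : unilower (1%:M : 'M[C]_n).
  split=> [i|i j ij]; rewrite mxE ?eqxx //.
  by rewrite -(inj_eq val_inj) /= ltn_eqF.
exists phi; last by have := phiL _ I1; rewrite r1 mulmx1.
apply/eqP; rewrite -subr_eq0; apply/eqP; apply: lower_cyclic_mx => L Ll.
by rewrite !mulmxBl EL // -!mulmxA [phi *m _]mulmxA phiL // mulmx1 subrr.
Qed.

End Cocharacter.

(** Schur's lemma without eigenvalues: Z commutes with the projector [E] on the line of u, hence Z u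
    = z u, and u is cyclic. *)
Lemma commutant_scalar (Z : 'M[C]_m) :
  {in unitmx, forall g, Z *m r g = r g *m Z} -> exists z, Z = z%:M.
Proof.
move=> Zr; pose k (i : 'I_n) := nat_of_ord i.
have [phi Eu phiu] := @cochar_top k (fun i j => id) (fun i j => id).
set E := map_mx _ _ in Eu.
have ZE : Z *m E = E *m Z.
  have Zt : Z%:pmx *m rp (cochar_mx k) = rp (cochar_mx k) *m Z%:pmx.
    apply: (polymx_ext (negbT (polyX_eq0 C))) => s; rewrite hornerX => s0.
    rewrite !map_mxM horner_pmx horner_constmx horner_cochar_mx Zr //.
    by apply: diag_unit => i; rewrite mxE expf_neq0.
  rewrite -[RHS]coef_mulmx_const -Zt; apply/matrixP => a b.
  rewrite !mxE /coefp coef_sum; apply: eq_bigr => l _.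
  by rewrite !mxE coefCM.
have Eu1 : E *m u = u by rewrite Eu -mulmxA phiu mulmx1.
pose z := (phi *m Z *m u) 0 0.
have Zu : Z *m u = z *: u.
  rewrite -{1}Eu1 mulmxA ZE -mulmxA Eu -mulmxA [phi *m _]mulmxA.
  by rewrite [phi *m Z *m u]mx11_scalar mul_mx_scalar.
exists z; apply/eqP; rewrite -subr_eq0; apply/eqP/row_matrixP => i; rewrite row0.
apply: cyclic_u => g gU; rewrite -!row_mul mulmxBl Zr // mulmxBl -[r g *m Z *m u]mulmxA.
by rewrite Zu mul_scalar_mx -scalemxAr -scalemxAl subrr row0.
Qed.

Local Notation dr := (lie_pmx P).

(** The matrices g E_ij and E_ji h are again dual bases for the trace form, and the canonical tensor
    does not depend on the choice of dual bases. *)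
Lemma casimir_sum (B : 'M[C]_n -> 'M[C]_n -> 'M[C]_m) (g h : 'M[C]_n) :
    (forall Y, linear (B^~ Y)) -> (forall X, linear (B X)) -> g *m h = 1%:M ->
  \sum_i \sum_j B (g *m delta_mx i j) (delta_mx j i *m h) =
  \sum_i \sum_j B (delta_mx i j) (delta_mx j i).
Proof.
move=> Bl Br gh.
have Bsuml I (s : seq I) (F : I -> C) (X : I -> 'M[C]_n) Y :
    B (\sum_(i <- s) F i *: X i) Y = \sum_(i <- s) F i *: B (X i) Y.
  elim: s => [|i s IHs]; last by rewrite !big_cons Bl IHs.
  by rewrite !big_nil; have := Bl Y (-1) 0 0; rewrite scaler0 addr0 scaleN1r addNr.
have Bsumr I (s : seq I) (F : I -> C) X (Y : I -> 'M[C]_n) :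
    B X (\sum_(i <- s) F i *: Y i) = \sum_(i <- s) F i *: B X (Y i).
  elim: s => [|i s IHs]; last by rewrite !big_cons Br IHs.
  by rewrite !big_nil; have := Br X (-1) 0 0; rewrite scaler0 addr0 scaleN1r addNr.
have gE i j : g *m delta_mx i j = \sum_k g k i *: delta_mx k j.
  rewrite [g in LHS]matrix_sum_delta mulmx_suml; apply: eq_bigr => k _.
  rewrite mulmx_suml (bigD1 i) //= -scalemxAl mul_delta_mx big1 ?addr0 // => l li.
  by rewrite -scalemxAl mul_delta_mx_0 ?scaler0.
have hE i j : delta_mx j i *m h = \sum_l h i l *: delta_mx j l.
  rewrite [h in LHS]matrix_sum_delta mulmx_sumr (bigD1 i) //= mulmx_sumr.
  rewrite [X in _ + X]big1 ?addr0 => [|k ki].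
    by apply: eq_bigr => l _; rewrite -scalemxAr mul_delta_mx.
  by rewrite mulmx_sumr big1 // => l _; rewrite -scalemxAr mul_delta_mx_0 ?scaler0 // eq_sym.
rewrite exchange_big [RHS]exchange_big; apply: eq_bigr => j _ /=.
transitivity (\sum_k \sum_l (\sum_i g k i * h i l) *: B (delta_mx k j) (delta_mx j l)).
  under eq_bigr => i _ do rewrite gE Bsuml.
  rewrite exchange_big; apply: eq_bigr => k _ /=.
  under [RHS]eq_bigr => l _ do rewrite scaler_suml.
  rewrite exchange_big; apply: eq_bigr => i _ /=.
  by rewrite hE Bsumr scaler_sumr; apply: eq_bigr => l _; rewrite scalerA.
apply: eq_bigr => k _.
have ghE l : \sum_i g k i * h i l = (k == l)%:R.
  by move/matrixP/(_ k l): gh; rewrite !mxE.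
under eq_bigr => l _ do rewrite ghE.
rewrite (bigD1 k) //= eqxx scale1r big1 ?addr0 // => l /negbTE lk.
by rewrite eq_sym lk scale0r.
Qed.

Definition casimir : 'M[C]_m :=
  \sum_i \sum_j dr (delta_mx i j) *m dr (delta_mx j i).

(** Conjugating both factors by g amounts to two applications of [casimir_sum], each moving one g
    and one inverse of g. *)
Lemma casimir_commute : {in unitmx, forall g, casimir *m r g = r g *m casimir}.
Proof.
move=> g gU.
have drl : linear dr by apply: linearP.
have Bl (h h' : 'M[C]_n) k (Y : 'M[C]_(m, k)) :
    linear (fun X => dr (h *m X *m h') *m Y).
  by move=> a X X'; rewrite mulmxDr mulmxDl -scalemxAr -scalemxAl drl mulmxDl -scalemxAl.
have Br (h h' : 'M[C]_n) k (Y : 'M[C]_(k, m)) :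
    linear (fun X => Y *m dr (h *m X *m h')).
  by move=> a X X'; rewrite mulmxDr mulmxDl -scalemxAr -scalemxAl drl mulmxDr -scalemxAr.
have ggi : g *m invmx g = 1%:M by rewrite mulmxV.
have e1 : \sum_i \sum_j dr (g *m delta_mx i j *m invmx g) *m
                         dr (g *m delta_mx j i *m invmx g) =
    \sum_i \sum_j dr (delta_mx i j *m invmx g) *m dr (g *m delta_mx j i).
  rewrite -(@casimir_sum (fun X Y => dr (X *m invmx g) *m dr (g *m Y)) g (invmx g)) //.
  - by apply: eq_bigr => i _; apply: eq_bigr => j _; rewrite mulmxA.
  - by move=> Y a X X'; have := Bl 1%:M (invmx g) _ (dr (g *m Y)) a X X'; rewrite !mul1mx.
  - by move=> X a Y Y'; have := Br g 1%:M _ (dr (X *m invmx g)) a Y Y'; rewrite !mulmx1.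
have e2 : \sum_i \sum_j dr (delta_mx i j *m invmx g) *m dr (g *m delta_mx j i) = casimir.
  rewrite exchange_big [RHS]exchange_big /=.
  apply: (@casimir_sum (fun X Y => dr Y *m dr X)) => //.
  - by move=> Y a X X'; have := Br 1%:M 1%:M _ (dr Y) a X X'; rewrite !mulmx1 !mul1mx.
  - by move=> X a Y Y'; have := Bl 1%:M 1%:M _ (dr X) a Y Y'; rewrite !mulmx1 !mul1mx.
rewrite -[X in X *m _ = _]e2 -e1 /casimir mulmx_suml mulmx_sumr; apply: eq_bigr => i _.
rewrite mulmx_suml mulmx_sumr; apply: eq_bigr => j _.
by rewrite [RHS]mulmxA pmx_lie_conj // -[RHS]mulmxA pmx_lie_conj // mulmxA.
Qed.

Definition torus_mx (a b : 'I_m) : {mpoly C[n]} :=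
  mmap (@mpolyC n C) (fun k => mxvec (diag_mx (\row_i 'X_i)) 0 k) (P a b).
Local Notation Pi := torus_mx.
Local Notation T t := (diag_mx (\row_i t i)).

Lemma meval_torus_mmap (q : {mpoly C[n * n]}) t :
  (mmap (@mpolyC n C) (fun k => mxvec (diag_mx (\row_i 'X_i)) 0 k) q).@[t] =
  q.@[fun k => mxvec (T t) 0 k].
Proof.
rewrite -[LHS]/(meval t _) rmorph_mmap; apply: mmap_eq => [c|k] /=.
  exact: mevalC.
have -> : T t = map_mx (meval t) (diag_mx (\row_i 'X_i)).
  apply/matrixP => i j; rewrite !mxE mevalMn; congr (_ *+ _).
  exact/esym/mevalXU.
by rewrite -map_mxvec mxE.
Qed.

Lemma meval_torus_mx a b t : (Pi a b).@[t] = r (T t) a b.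
Proof. by rewrite meval_torus_mmap mxE. Qed.

Lemma cochar_torus_mx k a b :
  mmap polyC (cocharacter C k) (Pi a b) = rp (cochar_mx k) a b.
Proof.
rewrite /torus_mx rmorph_mmap mxE; apply: mmap_eq => [c|i] /=; first by rewrite mmapC.
have -> : cochar_mx k =
  map_mx (mmap polyC (cocharacter C k)) (diag_mx (\row_i 'X_i)).
  apply/matrixP => a' b'; rewrite !mxE mmapMn; congr (_ *+ _).
  by rewrite mmapX mmap1U.
by rewrite -map_mxvec mxE.
Qed.

Lemma meval_euler_torus_mx i a b t :
  (euler i (Pi a b)).@[t] = (r (T t) *m dr (delta_mx i i)) a b.
Proof.
rewrite pmx_lie // /euler mevalM mevalXU /torus_mx.
rewrite (derivation_mmap _ _ (derivation_mderiv C i)) => [|c]; last exact: mderivC.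
have -> : T t *m delta_mx i i = t i *: delta_mx i i.
  apply/matrixP => j l; rewrite mul_diag_mx !mxE.
  by case: (eqVneq j i) => [->//|_]; rewrite !mulr0.
rewrite linearZ /= mxE mxE; congr (_ * _).
rewrite -[LHS]/(meval t _) raddf_sum; apply: eq_bigr => k _ /=.
rewrite mevalM; congr (_ * _); first exact: meval_torus_mmap.
have -> : delta_mx i i = map_mx (meval t \o @mderiv n C i) (diag_mx (\row_i 'X_i)).
  apply/matrixP => j l; rewrite !mxE /= mderivMn mevalMn mderivX mnm1E.
  rewrite mevalZ; case: (eqVneq j i) => [->|_] /=; last by rewrite mul0r mul0rn.
  by rewrite mul1r -[X in (X - _)%MM]add0m addmK mpolyX0 meval1 eq_sym.
by rewrite -map_mxvec mxE.
Qed.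

(** The polynomial tr(r(t) Z) on the torus. With Z arbitrary, the Euler operators act on this family
    by left multiplication of Z. *)
Definition torus_trace (Z : 'M[C]_m) : {mpoly C[n]} :=
  \sum_a \sum_b Z b a *: Pi a b.
Local Notation trPi := torus_trace.

Lemma meval_torus_trace Z t : (trPi Z).@[t] = \tr (r (T t) *m Z).
Proof.
rewrite /torus_trace -[LHS]/(meval t _) raddf_sum; apply: eq_bigr => a _.
rewrite [RHS]mxE raddf_sum; apply: eq_bigr => b _ /=.
by rewrite mevalZ meval_torus_mx mulrC.
Qed.

Lemma torus_traceD Z Z' : trPi (Z + Z') = trPi Z + trPi Z'.
Proof. by apply: mpoly_ext => t; rewrite mevalD !meval_torus_trace mulmxDr mxtraceD. Qed.

Lemma torus_traceZ z Z : trPi (z *: Z) = z *: trPi Z.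
Proof. by apply: mpoly_ext => t; rewrite mevalZ !meval_torus_trace -scalemxAr mxtraceZ. Qed.

Lemma torus_trace_sum I (s : seq I) (Z : I -> 'M[C]_m) :
  trPi (\sum_(i <- s) Z i) = \sum_(i <- s) trPi (Z i).
Proof.
elim: s => [|i s IHs]; last by rewrite !big_cons torus_traceD IHs.
by rewrite !big_nil -(scale0r 0) torus_traceZ scale0r.
Qed.

Local Notation H i := (dr (delta_mx i i)).

Lemma euler_torus_trace i Z : euler i (trPi Z) = trPi (H i *m Z).
Proof.
apply: mpoly_ext => t; rewrite meval_torus_trace mulmxA /euler /torus_trace.
rewrite raddf_sum mulr_sumr -[LHS]/(meval t _) raddf_sum; apply: eq_bigr => a _.
rewrite [RHS]mxE raddf_sum mulr_sumr raddf_sum; apply: eq_bigr => b _ /=.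
by rewrite mderivZ -scalerAr mevalZ -/(euler i _) meval_euler_torus_mx mulrC.
Qed.

Definition torus_character := trPi 1%:M.
Local Notation f := torus_character.

Lemma euler_character i : euler i f = trPi (H i).
Proof. by rewrite euler_torus_trace mulmx1. Qed.

Lemma euler2_character i : euler i (euler i f) = trPi (H i *m H i).
Proof. by rewrite euler_character euler_torus_trace. Qed.

(** Carrying E_ij around the trace past t turns E_ij E_ji into (t_i / t_j) E_ji E_ij, while the
    bracket of the two is H_i - H_j; the denominators are cleared. *)
Lemma root_trace i j : i != j ->
  ('X_i - 'X_j) * trPi (dr (delta_mx i j) *m dr (delta_mx j i)) =
  'X_i * (euler i f - euler j f).
Proof.
move=> ij; rewrite !euler_character; apply: mpoly_ext => t.
rewrite !(mevalM, mevalB, mevalXU, meval_torus_trace).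
have rE k l : t l *: (r (T t) *m dr (delta_mx k l)) = t k *: (dr (delta_mx k l) *m r (T t)).
  rewrite pmx_lie // lie_pmxl // -!linearZ /=; congr dpmx.
  apply/matrixP => k' l'; rewrite mul_diag_mx mul_mx_diag !mxE.
  case: (eqVneq k' k) => [->|_]; case: (eqVneq l' l) => [->|_] /=; rewrite ?mulr0 ?mul0r ?mulr0 //.
  by ring.
have br := lie_pmx_bracket rM_unit (delta_mx i j) (delta_mx j i).
rewrite !mul_delta_mx in br.
rewrite [RHS](_ : _ = H i - H j) in br; last by rewrite /lie_pmx raddfB.
set E := dr (delta_mx i j); set F := dr (delta_mx j i); set R := r (T t).
have EFE : E *m F = F *m E + (H i - H j).
  by apply/eqP; rewrite addrC -subr_eq; apply/eqP.
have e1 : t j * \tr (R *m (E *m F)) = t i * \tr (R *m (F *m E)).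
  rewrite -!mxtraceZ mulmxA scalemxAl rE -scalemxAl mxtraceZ -mulmxA.
  by rewrite mxtrace_mulC -mulmxA mxtraceZ.
by rewrite mulrBl e1 EFE mulmxDr mxtraceD mulmxBr raddfB /=; ring.
Qed.

Lemma character_casimir : exists z,
  \sum_i \sum_j trPi (dr (delta_mx i j) *m dr (delta_mx j i)) = z *: f.
Proof.
have [z zE] := commutant_scalar casimir_commute; exists z.
rewrite /f -torus_traceZ scalemx1 -zE /casimir torus_trace_sum.
by apply: eq_bigr => i _; rewrite torus_trace_sum.
Qed.

(** The identity matrix is central in the Lie algebra, so it acts by a scalar: f is homogeneous. *)
Lemma character_degree : exists z, \sum_i euler i f = z *: f.
Proof.
have [|z zE] := @commutant_scalar (dr 1%:M).
  by move=> g _; rewrite pmx_lie // lie_pmxl // mulmx1 mul1mx.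
have HE : \sum_i H i = dr 1%:M.
  rewrite -(raddf_sum (dpmx P 1%:M)) /=; congr dpmx.
  by rewrite -diag_const_mx diag_mx_sum_delta; apply: eq_bigr => i _; rewrite mxE scale1r.
exists z; rewrite /f -torus_traceZ scalemx1 -zE -HE torus_trace_sum.
by apply: eq_bigr => i _; rewrite euler_character.
Qed.

Definition weight_mnm : 'X_{1..n} := [multinom lam i | i < n].

Lemma weight_bound : exists2 B, (mdeg weight_mnm < B)%N &
  forall a b, {in msupp (Pi a b), forall mu, (mdeg mu < B)%N}.
Proof.
exists (mdeg weight_mnm + \sum_a \sum_b msize (Pi a b)).+1; first by rewrite ltnS leq_addr.
move=> a b mu /msize_mdeg_lt/leq_trans; apply; apply: leqW.
by rewrite (bigD1 a) //= (bigD1 b) //= -!addnA addnCA leq_addr.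
Qed.

(** The dominance order is expressed by tails: at equal degree, larger tails mean smaller initial
    sums. *)
Definition tail (mu : 'I_n -> nat) (k0 : nat) : nat := \sum_(i < n | (k0 <= i)%N) mu i.

(** The cocharacter gives the indices from k0 on an extra weight B^n, so exponents compare tails
    first while their base B digits still determine the monomial. A tail below that of lam would
    fall under the lowest exponent. *)
Lemma torus_mx_tail a b mu k0 : (Pi a b)@_mu != 0 -> (tail lam k0 <= tail mu k0)%N.
Proof.
rewrite -mcoeff_msupp => mu_supp; rewrite leqNgt; apply/negP => tl.
have [B lB PB] := weight_bound.
pose k (i : 'I_n) := (B ^ n * (k0 <= i) + B ^ i)%N.
have B0 : (0 < B)%N by case: (B) lB.
have kw (q : 'X_{1..n}) : cochar_weight k q =
    (tail q k0 * B ^ n + cochar_weight (fun i : 'I_n => B ^ i)%N q)%N.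
  rewrite /cochar_weight /k; under eq_bigr => i _ do rewrite mulnDr.
  rewrite big_split; congr addn; rewrite /tail big_distrl [RHS]big_mkcond.
  by apply: eq_bigr => i _ /=; case: (k0 <= i)%N; rewrite ?muln1 ?muln0.
have k_mono (i j : 'I_n) : (j <= i)%N -> (k j <= k i)%N.
  move=> ji; apply: leq_add; last by rewrite leq_pexp2l.
  by rewrite leq_mul2l; case: (leqP k0 j) => [/leq_trans->//|]; rewrite orbT.
have lamE : cochar_weight k weight_mnm = (\sum_i lam i * k i)%N.
  by apply: eq_bigr => i _; rewrite mnmE.
have := @coef_mmap_cocharacter C n k (Pi a b) mu; rewrite cochar_torus_mx.
have lt : (cochar_weight k mu < \sum_i lam i * k i)%N.
  have tlam : tail weight_mnm k0 = tail lam k0 by apply: eq_bigr => i _; rewrite mnmE.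
  rewrite -lamE !kw tlam; have := cochar_digits_lt (PB a b mu mu_supp).
  by move: (cochar_weight _ mu) (cochar_weight _ weight_mnm) (B ^ n)%N => x y z; nia.
have /matrixP/(_ a b) := cochar_coef_lt k_mono lt; rewrite !mxE /coefp => -> e.
have : (Pi a b)@_mu = 0.
  symmetry; apply: e => q q_supp; rewrite !kw => e.
  have lq := cochar_digits_lt (PB a b q q_supp).
  have lmu := cochar_digits_lt (PB a b mu mu_supp).
  apply: (cochar_digits_inj (PB a b q q_supp) (PB a b mu mu_supp)).
  by have := congr1 (modn^~ (B ^ n)%N) e; rewrite /= !modnMDl !modn_small.
by apply/eqP; rewrite -mcoeff_msupp.
Qed.

Lemma character_top : f@_weight_mnm = 1.
Proof.
have [B lB PB] := weight_bound.
(* Base B + 1, since B may be 1 and k must increase strictly. *)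
pose k (i : 'I_n) := (B.+1 ^ i)%N.
have lamE : cochar_weight k weight_mnm = (\sum_i lam i * k i)%N.
  by apply: eq_bigr => i _; rewrite mnmE.
have k_strict (i j : 'I_n) : (j < i)%N -> (k j < k i)%N.
  by move=> ij; rewrite ltn_exp2l //; case: (B) lB.
have k_mono (i j : 'I_n) : (j <= i)%N -> (k j <= k i)%N by move=> ji; rewrite leq_pexp2l.
have [phi phiE phiu] := cochar_top k_mono k_strict.
have cE a b : (Pi a b)@_weight_mnm = (u *m phi) a b.
  rewrite -phiE -(@coef_mmap_cocharacter C n k) => [|q q_supp].
    by rewrite cochar_torus_mx lamE !mxE.
  by apply: cochar_digits_inj; rewrite ltnS ltnW // (PB a b).
transitivity (\tr (u *m phi)); last by rewrite mxtrace_mulC phiu mxtrace1.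
rewrite /f /trPi raddf_sum; apply: eq_bigr => a _.
rewrite raddf_sum (bigD1 a) //= mcoeffZ cE mxE eqxx mul1r.
by rewrite big1 ?addr0 // => b /negbTE ba; rewrite mcoeffZ mxE ba mul0r.
Qed.

Lemma character_weight mu : f@_mu != 0 -> exists a b, (Pi a b)@_mu != 0.
Proof.
move=> fmu; have [/existsP[a /existsP[b ab]]|] :=
  boolP [exists a, exists b, (Pi a b)@_mu != 0]; first by exists a, b.
move/existsPn => P0; case/eqP: fmu.
have P0' a b : (Pi a b)@_mu = 0.
  by move/existsPn/(_ b): (P0 a); rewrite negbK => /eqP.
rewrite /f /trPi raddf_sum big1 // => a _; rewrite raddf_sum big1 // => b _ /=.
by rewrite mcoeffZ P0' mulr0.
Qed.

Lemma character_tail mu k0 : f@_mu != 0 -> (tail lam k0 <= tail mu k0)%N.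
Proof. by case/character_weight=> a [b]; apply: torus_mx_tail. Qed.

Lemma character_mdeg mu : f@_mu != 0 -> mdeg mu = mdeg weight_mnm.
Proof.
have [z zE] := character_degree.
have mdegz q : f@_q != 0 -> (mdeg q)%:R = z.
  move=> fq; apply: (mulIf fq); rewrite -[RHS]mcoeffZ -zE mdegE natr_sum mulr_suml.
  by rewrite [RHS]raddf_sum; apply: eq_bigr => i _; rewrite /= mcoeff_euler.
move=> /mdegz muz; apply/eqP; rewrite -(eqr_nat C) muz; apply/eqP.
by rewrite (mdegz weight_mnm) // character_top oner_neq0.
Qed.

Lemma character1 : f.@[fun=> 1] = m%:R.
Proof.
rewrite meval_torus_trace mulmx1.
have -> : T (fun _ : 'I_n => 1 : C) = 1%:M by apply/matrixP => i j; rewrite !mxE.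
by rewrite r1 mxtrace1.
Qed.

Lemma character_sym (s : {perm 'I_n}) : msym s f = f.
Proof.
apply: mpoly_ext => t.
have -> : (msym s f).@[t] = f.@[fun i => t (s i)].
  rewrite /msym -[LHS]/(meval t _) rmorph_mmap; apply: mmap_eq => [c|i] /=.
    exact: mevalC.
  exact: mevalXU.
rewrite !meval_torus_trace !mulmx1.
have -> : T (fun i => t (s i)) = perm_mx s *m T t *m perm_mx (s^-1)%g.
  rewrite -row_permE -col_permE; apply/matrixP => i j; rewrite !mxE.
  by rewrite (inj_eq perm_inj).
rewrite !pmxM // mxtrace_mulC mulmxA -pmxM // -perm_mxM mulVg perm_mx1.
by rewrite r1 mul1mx.
Qed.

End HighestWeight.

(** * Weyl's dimension formula *)

Section Alternants.
Variables (C : numFieldType) (n : nat).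

Definition alternant (l : 'I_n -> nat) : {mpoly C[n]} :=
  \det (\matrix_(i, j) 'X_j ^+ l i).

Lemma alternantE l : alternant l =
  \sum_(s : {perm 'I_n}) (-1) ^+ s *: 'X_[[multinom l (s^-1 j)%g | j < n]].
Proof.
rewrite /alternant /determinant; apply: eq_bigr => s _.
rewrite -[RHS]mul_mpolyC rmorph_sign; congr (_ * _).
rewrite [RHS]mpolyXE_id [RHS](reindex_inj (@perm_inj _ s)); apply: eq_bigr => i _ /=.
by rewrite mxE mnmE permK.
Qed.

Lemma msym_alternant l (s : {perm 'I_n}) : msym s (alternant l) = (-1) ^+ s *: alternant l.
Proof.
have -> : msym s (alternant l) = \det (\matrix_(i, j) ('X_(s j) ^+ l i : {mpoly C[n]})).
  rewrite /alternant -[LHS]/(mmap _ _ _) -det_map_mx; congr (\det _).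
  by apply/matrixP => i j; rewrite !mxE rmorphXn /= mmapX mmap1U.
have -> : \matrix_(i, j) ('X_(s j) ^+ l i : {mpoly C[n]}) =
          col_perm s (\matrix_(i, j) 'X_j ^+ l i).
  by apply/matrixP => i j; rewrite !mxE.
rewrite col_permE det_mulmx det_perm mulrC odd_permV -mul_mpolyC.
by rewrite rmorph_sign.
Qed.

Lemma alternant_supp l mu : (alternant l)@_mu != 0 ->
  exists s : {perm 'I_n}, mu = [multinom l (s j) | j < n].
Proof.
rewrite alternantE raddf_sum /= => h.
have [/existsP[s /eqP->]|] := boolP [exists s : {perm 'I_n}, mu == [multinom l (s j) | j < n]].
  by exists s.
move/existsPn => N; case/eqP: h; apply: big1 => s _.
by rewrite mcoeffZ mcoeffX eq_sym (negbTE (N _)) mulr0.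
Qed.

Lemma alternant_coef l (s : {perm 'I_n}) : injective l ->
  (alternant l)@_[multinom l (s j) | j < n] = (-1) ^+ s.
Proof.
move=> l_inj; rewrite alternantE raddf_sum /= (bigD1 s^-1%g) //= mcoeffZ mcoeffX.
rewrite invgK eqxx mulr1 odd_permV big1 ?addr0 // => s' s's.
rewrite mcoeffZ mcoeffX; case: eqP => [/mnmP e|]; last by rewrite mulr0.
case/eqP: s's; apply: invg_inj; rewrite invgK; apply/permP => j.
by have := e j; rewrite !mnmE => /l_inj.
Qed.

Lemma alternant_euler2 l : \sum_i euler i (euler i (alternant l)) =
  (\sum_i (l i)%:R ^+ 2) *: alternant l.
Proof.
apply/mpolyP => mu; rewrite mcoeffZ raddf_sum /=.
under eq_bigr => i _ do rewrite !mcoeff_euler mulrA -expr2.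
rewrite -mulr_suml; have [->|/alternant_supp[s ->]] := eqVneq (alternant l)@_mu 0.
  by rewrite !mulr0.
congr (_ * _); rewrite [RHS](reindex_inj (@perm_inj _ s)).
by apply: eq_bigr => i _; rewrite mnmE.
Qed.

Lemma alternant_ord :
  alternant (fun i => i) = \prod_(i < n) \prod_(j < n | (i < j)%N) ('X_j - 'X_i).
Proof.
have -> : alternant (fun i => i) = \det (Vandermonde n (\row_j ('X_j : {mpoly C[n]}))).
  by congr (\det _); apply/matrixP => i j; rewrite !mxE.
rewrite det_Vandermonde; apply: eq_bigr => i _; apply: eq_bigr => j _.
by rewrite !mxE.
Qed.

Lemma mcoeffM_supp (p q : {mpoly C[n]}) mu : (p * q)@_mu =
  \sum_(m1 <- msupp p) \sum_(m2 <- msupp q) p@_m1 * q@_m2 * (m1 + m2 == mu)%MM%:R.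
Proof.
rewrite mpolyME raddf_sum big_allpairs; apply: eq_bigr => m1 _.
by apply: eq_bigr => m2 _; rewrite /= mcoeffZ mcoeffX.
Qed.

Lemma mcoeffM_neq0 (p q : {mpoly C[n]}) mu : (p * q)@_mu != 0 ->
  exists m1 m2, [/\ p@_m1 != 0, q@_m2 != 0 & mu = (m1 + m2)%MM].
Proof.
rewrite -mcoeff_msupp => /msuppM_le/allpairsP[[m1 m2] [/= p1 q2 ->]].
by exists m1, m2; rewrite -!mcoeff_msupp.
Qed.

Local Notation V := (alternant (fun i : 'I_n => i)).

(** Factors 1 fill up a product over all pairs, so that [derivation_prod] differentiates it at
    once. *)
Definition pair_factor (p : 'I_n * 'I_n) : {mpoly C[n]} :=
  if (p.1 < p.2)%N then 'X_p.2 - 'X_p.1 else 1.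

Lemma alternant_ord_pairs : V = \prod_p pair_factor p.
Proof.
by rewrite alternant_ord pair_big_dep /= big_mkcond.
Qed.

Lemma eulerXU (k j : 'I_n) : euler k ('X_j : {mpoly C[n]}) = (j == k)%:R *: 'X_j.
Proof. by rewrite eulerX mnm1E. Qed.

Lemma meval_euler_alternant_ord k (t : 'I_n -> C) : (forall i j, i != j -> t i != t j) ->
  (euler k V).@[t] = V.@[t] * \sum_(j | j != k) t k / (t k - t j).
Proof.
move=> t_inj; have HEC := derivation_euler C k.
pose F p := (pair_factor p).@[t].
have F0 p : F p != 0.
  rewrite /F /pair_factor; case: ifP => pp; last by rewrite meval1 oner_neq0.
  rewrite mevalB !mevalXU subr_eq0 t_inj //.
  by apply: contraTneq pp => ->; rewrite ltnn.
have VE : V.@[t] = \prod_p F p.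
  by rewrite alternant_ord_pairs -[LHS]/(meval t _) rmorph_prod.
rewrite VE alternant_ord_pairs (derivation_prod HEC) ?index_enum_uniq //.
rewrite -[LHS]/(meval t _) raddf_sum /=.
transitivity (\prod_p F p * \sum_p (euler k (pair_factor p)).@[t] / F p).
  rewrite mulr_sumr; apply: eq_bigr => p _; rewrite mevalM [RHS]mulrCA.
  rewrite [in RHS](bigD1 p) //= [F p * _ / _]mulrAC divff // mul1r; congr (_ * _).
  by rewrite -[LHS]/(meval t _) rmorph_prod.
congr (_ * _).
pose G (i j : 'I_n) := if (i < j)%N then ((j == k)%:R - (i == k)%:R) * t k / (t j - t i) else 0.
transitivity (\sum_(p : 'I_n * 'I_n) G p.1 p.2).
  apply: eq_bigr => p _; rewrite /F /G /pair_factor; case: ifP => _; last first.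
    by rewrite (derivation1 HEC) meval0 mul0r.
  rewrite (derivationB HEC) !eulerXU !mevalB !mevalZ !mevalXU; congr (_ / _).
  rewrite mulrBl; congr (_ - _); case: eqP => [->//|]; by rewrite !mul0r.
rewrite -(pair_bigA _ G) /=.
pose A (i j : 'I_n) := if (i < j)%N then t k / (t j - t i) else 0.
transitivity (\sum_i \sum_j ((j == k)%:R * A i j - (i == k)%:R * A i j)).
  apply: eq_bigr => i _; apply: eq_bigr => j _; rewrite /G /A.
  by case: ifP => _; rewrite ?mulr0 ?subrr // -mulrBl mulrA.
transitivity (\sum_(i < n) \sum_(j < n) (j == k)%:R * A i j -
  \sum_(i < n) \sum_(j < n) (i == k)%:R * A i j).
  by rewrite -sumrB; apply: eq_bigr => i _; rewrite -sumrB.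
rewrite exchange_big /=.
have E1 : \sum_(j < n) \sum_(i < n) (j == k)%:R * A i j = \sum_i A i k.
  rewrite (bigD1 k) //= [X in _ + X]big1 ?addr0 => [|j /negbTE jk].
    by apply: eq_bigr => i _; rewrite eqxx mul1r.
  by rewrite big1 // => i _; rewrite jk mul0r.
have E2 : \sum_(i < n) \sum_(j < n) (i == k)%:R * A i j = \sum_j A k j.
  rewrite (bigD1 k) //= [X in _ + X]big1 ?addr0 => [|j /negbTE jk].
    by apply: eq_bigr => i _; rewrite eqxx mul1r.
  by rewrite big1 // => i _; rewrite jk mul0r.
rewrite E1 E2 -sumrB [RHS]big_mkcond; apply: eq_bigr => j _; rewrite /A.
rewrite -(inj_eq val_inj) /=; case: ltngtP => jk; rewrite ?subr0 ?sub0r //.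
by rewrite -mulrN -invrN opprB.
Qed.

End Alternants.

Section WeylFormula.
Variables (C : numFieldType) (n : nat) (f : {mpoly C[n]}).
Local Notation V := (alternant C (fun i : 'I_n => i)).
Variables (Q : 'I_n -> 'I_n -> {mpoly C[n]}) (z z' : C).
Hypothesis Q_root : forall i j, i != j ->
  ('X_i - 'X_j) * Q i j = 'X_i * (euler i f - euler j f).
Hypothesis f_casimir :
  \sum_i euler i (euler i f) + \sum_i \sum_(j | j != i) Q i j = z *: f.
Hypothesis f_degree : \sum_i euler i f = z' *: f.

(** By [Q_root], the off-diagonal part of the Casimir element is the cross term of the Laplacian of
    V f divided by V, minus (n - 1) times the degree operator; so only eigenvalues remain. *)
Lemma alternant_laplace : exists E, \sum_i euler i (euler i (V * f)) = E *: (V * f).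
Proof.
pose E := \sum_(i < n) (i : nat)%:R ^+ 2 + z + (n%:R - 1) * z'; exists E.
(* The additional factor V settles the points with two equal coordinates; elsewhere division by t_i
   - t_j is allowed. *)
suff VV : V * \sum_i euler i (euler i (V * f)) = V * (E *: (V * f)).
  have V0 : V != 0.
    apply/eqP => V0; have /eqP := @alternant_coef C n _ 1%g (@ord_inj n).
    by rewrite V0 mcoeff0 odd_perm1 expr0 eq_sym oner_eq0.
  by apply: (mulfI V0).
apply: mpoly_ext => t; rewrite !mevalM mevalZ mevalM.
have [->|Vt] := eqVneq V.@[t] 0; first by rewrite !mul0r.
congr (_ * _).
have t_inj i j : i != j -> t i != t j.
  move=> ij; apply: contraNneq Vt => tij.
  rewrite alternant_ord_pairs -[X in X == _]/(meval t _) rmorph_prod.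
  have [lt|gt|e] := ltngtP i j.
  - by rewrite (bigD1 (i, j)) //= /pair_factor lt mevalB !mevalXU tij subrr mul0r.
  - by rewrite (bigD1 (j, i)) //= /pair_factor gt mevalB !mevalXU tij subrr mul0r.
  - by rewrite (val_inj e) eqxx in ij.
have d0 i j : i != j -> t i - t j != 0 by move=> ij; rewrite subr_eq0 t_inj.
pose c i := \sum_(j | j != i) t i / (t i - t j).
pose fi i := (euler i f).@[t].
have cE := meval_euler_alternant_ord (t := t) _ t_inj.
have DE i : euler i (euler i (V * f)) =
    euler i (euler i V) * f + 2 * (euler i V * euler i f) + V * euler i (euler i f).
  have DD (p q : {mpoly C[n]}) : euler i (p + q) = euler i p + euler i q.
    exact: (derivation_euler C i).1.
  have DM (p q : {mpoly C[n]}) : euler i (p * q) = euler i p * q + p * euler i q.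
    exact: (derivation_euler C i).2.
  by rewrite DM DD !DM mulr_natl mulr2n !addrA.
have QE i j : j != i -> (Q i j).@[t] = t i / (t i - t j) * (fi i - fi j).
  rewrite eq_sym => ij; apply: (mulfI (d0 _ _ ij)).
  have := congr1 (meval t) (Q_root ij); rewrite mevalM [RHS]mevalM !mevalB !mevalXU => ->.
  by rewrite [t i / _]mulrC -mulrA mulVKf ?d0.
(* Exchanging i and j with t_i / (t_i - t_j) = 1 - t_j / (t_j - t_i) doubles the sum and leaves n -
   1 copies of the degree operator. *)
have SQ : \sum_i \sum_(j | j != i) (Q i j).@[t] =
    2 * (\sum_i c i * fi i) - (n%:R - 1) * (z' * f.@[t]).
  transitivity (\sum_i c i * fi i - \sum_i \sum_(j | j != i) t i / (t i - t j) * fi j).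
    rewrite -sumrB; apply: eq_bigr => i _; rewrite /c mulr_suml -sumrB.
    by apply: eq_bigr => j ij; rewrite QE // mulrBr.
  have -> : \sum_i \sum_(j | j != i) t i / (t i - t j) * fi j =
      \sum_j ((n%:R - 1) - c j) * fi j.
    rewrite (exchange_big_dep predT) //=; apply: eq_bigr => j _.
    rewrite -mulr_suml; congr (_ * _).
    under eq_bigl => i do rewrite eq_sym.
    transitivity (\sum_(i | i != j) (1 - t j / (t j - t i))).
      apply: eq_bigr => i ij; have := d0 _ _ ij; have : t j - t i != 0 by rewrite d0 // eq_sym.
      by move=> *; field; apply/andP.
    rewrite sumrB; congr (_ - _).
    rewrite sumr_const (_ : #|_| = #|predC1 j|); last exact: eq_card.
    by rewrite cardC1 card_ord -subn1 natrB // (leq_ltn_trans _ (ltn_ord j)).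
  rewrite mulr_sumr -sumrB -[z' * _]mevalZ -f_degree.
  rewrite -[(\sum_i euler i f).@[t]]/(meval t _) raddf_sum mulr_sumr -sumrB.
  by apply: eq_bigr => j _; rewrite /= -/(fi j); ring.
rewrite (eq_bigr _ (fun i _ => DE i)) !big_split /= -mulr_suml alternant_euler2.
rewrite -mulr_sumr -mulr_sumr (canRL (addrK _) f_casimir).
rewrite !(mevalD, mevalM, mevalN, mevalZ, meval1).
have -> : (\sum_i \sum_(j | j != i) Q i j).@[t] = \sum_i \sum_(j | j != i) (Q i j).@[t].
  rewrite -[LHS]/(meval t _) raddf_sum; apply: eq_bigr => i _ /=.
  by rewrite -[LHS]/(meval t _) raddf_sum.
have -> : (\sum_i euler i V * euler i f).@[t] = V.@[t] * \sum_i c i * fi i.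
  rewrite -[LHS]/(meval t _) raddf_sum mulr_sumr; apply: eq_bigr => i _.
  by rewrite /= mevalM cE mulrA.
rewrite SQ /E.
by ring.
Qed.

End WeylFormula.

(** * Majorization *)

Section Majorization.

(** Summation by parts. The lower bound c makes the induction work: it becomes [a n] in the
    induction step. *)
Lemma abel_le n (a x y : nat -> nat) c :
    (forall i j, (i <= j)%N -> (j < n)%N -> (a j <= a i)%N) ->
    (forall k, (k <= n)%N -> (\sum_(i < k) x i <= \sum_(i < k) y i)%N) ->
    (forall i, (i < n)%N -> (c <= a i)%N) ->
  (c * (\sum_(i < n) y i) + \sum_(i < n) a i * x i <=
   \sum_(i < n) a i * y i + c * (\sum_(i < n) x i))%N.
Proof.
elim: n c => [|n IHn] c a_mono xy ca; first by rewrite !big_ord0 muln0.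
have IH := IHn (a n) (fun i j ij jn => a_mono i j ij (ltnW jn))
  (fun k kn => xy k (leqW kn)) (fun i i_n => a_mono i n (ltnW i_n) (ltnSn n)).
have := xy n.+1 (leqnn _); have := ca n (ltnSn _); move: IH.
rewrite !big_ord_recr /=.
move: (\sum_(i < n) a i * x i)%N (\sum_(i < n) a i * y i)%N (\sum_(i < n) x i)%N
  (\sum_(i < n) y i)%N (a n) (x n) (y n) => ax ay X Y A u v IH cA xyn.
have AE := subnKC cA; move: (A - c)%N AE => e AE; rewrite -{A}AE in IH cA *.
have := leq_mul (leqnn e) xyn; nia.
Qed.

(** Summation by parts gives |a|^2 <= a.b, and |a| = |b|, so |a - b|^2 = 2 (|a|^2 - a.b) is not
    positive. *)
Lemma majorization_eq n (a b : nat -> nat) :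
    (forall i j, (i <= j)%N -> (j < n)%N -> (a j <= a i)%N) ->
    (forall k, (k <= n)%N -> (\sum_(i < k) a i <= \sum_(i < k) b i)%N) ->
    (\sum_(i < n) a i ^ 2 = \sum_(i < n) b i ^ 2)%N ->
  forall i, (i < n)%N -> a i = b i.
Proof.
move=> a_mono ab sq i i_n.
have := abel_le a_mono ab (fun i _ => leq0n (a i)); rewrite !mul0n add0n addn0 => le.
have : \sum_(i < n) ((a i)%:R - (b i)%:R) ^+ 2 = 0 :> int.
  apply/eqP; rewrite eq_le sumr_ge0 ?andbT => [|j _]; last exact: sqr_ge0.
  have -> : \sum_(i < n) ((a i)%:R - (b i)%:R) ^+ 2 =
    2 * ((\sum_(i < n) a i * a i)%N%:R - (\sum_(i < n) a i * b i)%N%:R) :> int.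
    have : (\sum_(i < n) a i ^ 2)%N%:R = (\sum_(i < n) b i ^ 2)%N%:R :> int by rewrite sq.
    rewrite !natr_sum => /eqP; rewrite -subr_eq0 => /eqP e0.
    rewrite mulrBr -[RHS]subr0 -[X in _ = _ - X]e0 !mulr_sumr -!sumrB.
    by apply: eq_bigr => j _; rewrite !natrM; ring.
  by rewrite pmulr_rle0 // subr_le0 ler_nat.
move/psumr_eq0P => /(_ (fun j _ => sqr_ge0 _) (Ordinal i_n) isT)/eqP.
by rewrite sqrf_eq0 subr_eq0 eqr_nat => /eqP.
Qed.

Lemma sum_set_ge n (A : {set 'I_n}) : ('C(#|A|, 2) <= \sum_(i in A) i)%N.
Proof.
have [k] := ubnP #|A|; elim: k A => // k IHk A Ak.
have [->|/set0Pn[i0 i0A]] := eqVneq A set0; first by rewrite cards0.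
have [x xA xmax] := arg_maxnP (fun i : 'I_n => i : nat) i0A.
have {}xA : x \in A := xA.
rewrite (big_setD1 x) //=; move: (Ak); rewrite (cardsD1 x) xA add1n => Ax.
rewrite binS bin1 addnC leq_add //; last exact: IHk.
have : (#|A| <= x.+1)%N.
  have sub : A \subset [set i : 'I_n | (i < x.+1)%N].
    by apply/subsetP => i iA; rewrite inE ltnS; apply: xmax.
  apply: leq_trans (subset_leq_card sub) _.
  rewrite -sum1dep_card -(big_ord_widen_cond n predT (fun=> 1%N)) //.
  by rewrite sum1_card card_ord.
by rewrite [#|A|](cardsD1 x) xA add1n ltnS.
Qed.

Definition staircase n (i : 'I_n) : nat := (n - i.+1)%N.

Lemma tail_staircase n k : (k <= n)%N -> tail (@staircase n) k = 'C(n - k, 2).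
Proof.
move=> kn; rewrite /tail (reindex_inj rev_ord_inj) -bin2_sum big_mkord.
rewrite (big_ord_widen n (fun i => i)) ?leq_subr //.
by apply: eq_big => i; rewrite /staircase /=; have := ltn_ord i; lia.
Qed.

(** The n - k values in the tail are distinct, so they sum to at least 0 + 1 + ... + (n - k - 1). *)
Lemma tail_perm n (s : {perm 'I_n}) k : (k <= n)%N ->
  (tail (@staircase n) k <= tail (fun i => s i) k)%N.
Proof.
move=> kn; rewrite tail_staircase //; pose B := [set i : 'I_n | (k <= i)%N].
have cB : #|s @: B| = (n - k)%N.
  rewrite card_imset; last exact: perm_inj.
  rewrite -sum1dep_card (reindex_inj rev_ord_inj).
  rewrite -[RHS]card_ord -sum1_card (big_ord_widen n (fun=> 1%N)) ?leq_subr //.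
  by apply: eq_bigl => i /=; have := ltn_ord i; lia.
rewrite -cB; apply: leq_trans (sum_set_ge _) _.
rewrite big_imset /=; last by move=> i j _ _; apply: perm_inj.
by apply/eq_leq/eq_bigl => i; rewrite inE.
Qed.

Lemma tailD n (a b : 'I_n -> nat) k :
  tail (fun i => a i + b i)%N k = (tail a k + tail b k)%N.
Proof. exact: big_split. Qed.

Lemma tailS n (a : 'I_n -> nat) (i : 'I_n) : tail a i = (a i + tail a i.+1)%N.
Proof.
rewrite /tail (bigD1 i) //=; congr addn; apply: eq_bigl => j.
by rewrite -(inj_eq val_inj) /= ltn_neqAle eq_sym andbC.
Qed.

Lemma tail_inj n (a b : 'I_n -> nat) : (forall k, (k <= n)%N -> tail a k = tail b k) -> a =1 b.
Proof.
move=> ab i; have := ab i (ltnW (ltn_ord i)); rewrite !tailS ab //.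
exact: addIn.
Qed.

End Majorization.

Section WeylDimension.
Variables (C : numFieldType) (n m : nat) (f : {mpoly C[n]}) (lam : 'I_n -> nat).
Local Notation V := (alternant C (fun i : 'I_n => i)).
Local Notation "m # s" := [multinom m (s i) | i < n]
  (at level 40, left associativity, format "m # s").

Variables (Q : 'I_n -> 'I_n -> {mpoly C[n]}) (z z' : C).
Hypothesis Q_root : forall i j, i != j ->
  ('X_i - 'X_j) * Q i j = 'X_i * (euler i f - euler j f).
Hypothesis f_casimir :
  \sum_i euler i (euler i f) + \sum_i \sum_(j | j != i) Q i j = z *: f.
Hypothesis f_degree : \sum_i euler i f = z' *: f.
Hypothesis f_sym : forall s : {perm 'I_n}, msym s f = f.
Hypothesis f_top : f@_(weight_mnm lam) = 1.
Hypothesis f_tail : forall mu k, f@_mu != 0 -> (tail lam k <= tail mu k)%N.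
Hypothesis f_mdeg : forall mu, f@_mu != 0 -> mdeg mu = mdeg (weight_mnm lam).
Hypothesis f_dim : f.@[fun=> 1] = m%:R.
Hypothesis lam_mono : forall i j : 'I_n, (i <= j)%N -> (lam j <= lam i)%N.

Definition shifted_part (i : 'I_n) : nat := (lam i + staircase i)%N.
Local Notation l := shifted_part.

Lemma shifted_part_lt (i j : 'I_n) : (i < j)%N -> (l j < l i)%N.
Proof.
move=> ij; have := lam_mono (ltnW ij); rewrite /l /staircase.
by have := ltn_ord j; lia.
Qed.

Lemma shifted_part_inj : injective l.
Proof.
move=> i j lij; apply: val_inj; case: (ltngtP i j) => // ij.
  by have := shifted_part_lt ij; rewrite lij ltnn.
by have := shifted_part_lt ij; rewrite lij ltnn.
Qed.

Local Notation G := (V * f).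
Local Notation lm := [multinom l i | i < n].

Lemma numerator_sym (s : {perm 'I_n}) (mu : 'X_{1..n}) : G@_(mu#s) = (-1) ^+ s * G@_mu.
Proof. by rewrite -mcoeff_sym msymM f_sym msym_alternant -scalerAl mcoeffZ. Qed.

Lemma numerator_supp mu : G@_mu != 0 ->
  (forall k, (k <= n)%N -> (tail l k <= tail mu k)%N) /\ mdeg mu = mdeg lm.
Proof.
case/mcoeffM_neq0 => m1 [m2 [V1 f2 ->]]; have [s m1E] := alternant_supp V1.
split=> [k kn|].
  rewrite /l tailD addnC; apply: (@leq_trans (tail m1 k + tail m2 k)%N).
    apply: leq_add; last exact: f_tail.
    rewrite (leq_trans (tail_perm s kn)) // m1E.
    by apply/eq_leq/eq_bigr => i _; rewrite mnmE.
  by rewrite -tailD; apply/eq_leq/eq_bigr => i _; rewrite mnmDE.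
rewrite mdegD (f_mdeg f2) m1E !mdegE addnC.
have -> : \sum_i [multinom s j | j < n] i = \sum_(i < n) staircase i.
  rewrite [RHS](reindex_inj rev_ord_inj) [RHS](reindex_inj (@perm_inj _ s)).
  apply: eq_bigr => i _; rewrite mnmE /staircase /=.
  by have := ltn_ord (s i); lia.
by rewrite -big_split; apply: eq_bigr => i _; rewrite !mnmE.
Qed.

Lemma numerator_norm : exists E : C, forall mu, G@_mu != 0 ->
  (\sum_i (mu i) ^ 2)%N%:R = E.
Proof.
have [E GE] := alternant_laplace Q_root f_casimir f_degree; exists E => mu G0.
apply: (mulIf G0); rewrite -[RHS]mcoeffZ -GE [RHS]raddf_sum natr_sum mulr_suml.
by apply: eq_bigr => i _; rewrite /= !mcoeff_euler mulrA natrX expr2.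
Qed.

Lemma alternant_staircase :
  V@_[multinom staircase i | i < n] = (-1) ^+ (perm (@rev_ord_inj n) : {perm 'I_n}).
Proof.
rewrite -(@alternant_coef C n _ (perm (@rev_ord_inj n)) (@ord_inj n)).
by congr (V@__); apply/mnmP => i; rewrite !mnmE permE.
Qed.

(** In a product of two terms giving [lm], both exponents have tails bounded below and the bounds
    add up to the tails of [lm]; so only one pair of terms contributes. *)
Lemma numerator_top : G@_lm = V@_[multinom staircase i | i < n].
Proof.
rewrite mcoeffM_supp.
have e m1 m2 : V@_m1 != 0 -> f@_m2 != 0 -> (m1 + m2)%MM = lm ->
    m1 = [multinom staircase i | i < n] /\ m2 = weight_mnm lam.
  move=> V1 f2 /mnmP e; have [s m1E] := alternant_supp V1.
  have t1 k : (k <= n)%N -> (tail (@staircase n) k <= tail m1 k)%N.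
    move=> kn; rewrite (leq_trans (tail_perm s kn)) // m1E.
    by apply/eq_leq/eq_bigr => i _; rewrite mnmE.
  have t2 k := f_tail k f2.
  have t k : (tail m1 k + tail m2 k = tail (@staircase n) k + tail lam k)%N.
    rewrite -!tailD; apply: eq_bigr => i _; have := e i.
    by rewrite mnmDE mnmE /l addnC [RHS]addnC => ->.
  split; apply/mnmP => i; rewrite mnmE.
    by apply: tail_inj => k kn; have := t1 k kn; have := t2 k; have := t k; lia.
  by apply: tail_inj => k kn; have := t1 k kn; have := t2 k; have := t k; lia.
have st : V@_[multinom staircase i | i < n] != 0 by rewrite alternant_staircase signr_eq0.
rewrite (bigD1_seq [multinom staircase i | i < n]) ?msupp_uniq ?mcoeff_msupp //=.
rewrite (bigD1_seq (weight_mnm lam)) ?msupp_uniq ?mcoeff_msupp ?f_top ?oner_neq0 //=.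
have -> : ([multinom staircase i | i < n] + weight_mnm lam == lm)%MM.
  by apply/eqP/mnmP => i; rewrite mnmDE !mnmE addnC.
rewrite !mulr1 big_seq_cond big1 ?addr0 => [|m2 /andP[f2 ne]].
  rewrite big_seq_cond big1 ?addr0 // => m1 /andP[V1 ne].
  rewrite big_seq big1 // => m2 f2; case: eqP => [eq|]; last by rewrite mulr0.
  rewrite !mcoeff_msupp in V1 f2.
  by have [m1E _] := e _ _ V1 f2 eq; rewrite m1E eqxx in ne.
rewrite mcoeff_msupp in f2; case: eqP => [eq|]; last by rewrite mulr0.
by have [_ m2E] := e _ _ st f2 eq; rewrite m2E eqxx in ne.
Qed.

Lemma sort_mnm (mu : 'X_{1..n}) : exists s : {perm 'I_n},
  forall i j : 'I_n, (i <= j)%N -> ((mu#s) j <= (mu#s) i)%N.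
Proof.
pose t := [tuple mu i | i < n].
have /tuple_permP[s sE] : perm_eq (sort geq t) t by rewrite perm_sort.
exists s => i j ij.
have nthE k : (mu#s) k = nth 0%N (sort geq t) k.
  by rewrite sE mnmE (nth_map k) ?size_enum_ord // nth_ord_enum tnth_mktuple.
rewrite !nthE; apply: (sorted_leq_nth (leT := geq)) => //.
- by move=> a b c ba cb; apply: leq_trans cb ba.
- exact: leqnn.
- by apply: sort_sorted => a b; apply: leq_total.
- by rewrite inE size_sort size_tuple.
- by rewrite inE size_sort size_tuple.
Qed.

Lemma prefix_tail (h : nat -> nat) k : (k <= n)%N ->
  (\sum_(i < k) h i + tail (fun i : 'I_n => h i) k = \sum_(i < n) h i)%N.
Proof.
move=> kn; rewrite (big_ord_widen n h kn) [RHS](bigID (fun i : 'I_n => (i < k)%N)) /=.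
by congr addn; apply: eq_bigl => i; rewrite -leqNgt.
Qed.

(* A dominant weight of the numerator is majorized by the shifted highest weight
   and has the same norm, so it equals it. *)
Lemma numerator_sorted (mu : 'X_{1..n}) : G@_mu != 0 ->
  (forall i j : 'I_n, (i <= j)%N -> (mu j <= mu i)%N) -> mu = lm.
Proof.
move=> G0 mu_mono; have [tl deg] := numerator_supp G0.
have Gl : G@_lm != 0 by rewrite numerator_top alternant_staircase signr_eq0.
have [E normE] := numerator_norm.
pose ext (h : 'I_n -> nat) i := if insub i is Some j then h j else 0%N.
have extE h (i : 'I_n) : ext h i = h i by rewrite /ext valK.
have extE' h i (i_n : (i < n)%N) : ext h i = h (Ordinal i_n).
  exact: (extE h (Ordinal i_n)).
have sumE h : (\sum_(i < n) ext h i = \sum_(i < n) h i)%N by apply: eq_bigr => i _.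
have tailE h k : tail (fun i : 'I_n => ext h i) k = tail h k by apply: eq_bigr => i _.
have maj := @majorization_eq n (ext mu) (ext l).
apply/mnmP => i; rewrite mnmE -(extE mu i) -(extE l i); apply: maj => //.
- move=> i' j' ij jn; rewrite (extE' _ _ jn) (extE' _ _ (leq_ltn_trans ij jn)).
  exact: mu_mono.
- move=> k kn; have := prefix_tail (ext mu) kn; have := prefix_tail (ext l) kn.
  rewrite !sumE !tailE; have := tl k kn; move: deg; rewrite !mdegE.
  rewrite [X in _ = X -> _](_ : _ = \sum_i l i)%N; last by apply: eq_bigr => j _; rewrite mnmE.
  move=> -> t1 e1 e2; have {e1 e2} := etrans e2 (esym e1); move: t1.
  by move: (tail l k) (tail mu k) (bigop.body _ _ _) (bigop.body _ _ _) => *; lia.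
- apply/eqP; rewrite -(eqr_nat C); apply/eqP.
  transitivity E.
    rewrite -(normE _ G0); congr (_%:R); apply: eq_bigr => j _.
    by rewrite (extE mu).
  rewrite -(normE _ Gl); congr (_%:R); apply: eq_bigr => j _.
  by rewrite (extE l) mnmE.
Qed.

(** Both sides are antisymmetric, so sorted exponents suffice, and there [numerator_sorted] leaves
    only [lm]. *)
Lemma numeratorE : G = V@_[multinom staircase i | i < n] *: alternant C l.
Proof.
apply/mpolyP => mu; rewrite mcoeffZ.
have [s [sl|sN]] : exists s : {perm 'I_n}, mu#s = lm \/
    G@_mu = 0 /\ (alternant C l)@_mu = 0.
  have [G0|G0] := eqVneq G@_mu 0.
    have [A0|/alternant_supp[s ->]] := eqVneq (alternant C l)@_mu 0; first by exists 1%g; right.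
    by exists s^-1%g; left; apply/mnmP => i; rewrite !mnmE permKV.
  have [s mono] := sort_mnm mu; exists s; left; apply: numerator_sorted => //.
  by rewrite numerator_sym mulf_neq0 ?signr_eq0.
- have e1 := numerator_sym s mu; rewrite sl numerator_top in e1.
  have e2 : (alternant C l)@_(mu#s) = (-1) ^+ s * (alternant C l)@_mu.
    by rewrite -mcoeff_sym msym_alternant mcoeffZ.
  have e3 : (alternant C l)@_lm = 1.
    have := @alternant_coef C n l 1%g shifted_part_inj; rewrite odd_perm1 expr0 => <-.
    by congr ((alternant C l)@__); apply/mnmP => i; rewrite !mnmE perm1.
  rewrite sl e3 in e2; rewrite {}e1 mulrAC -[RHS]mulrA -[(alternant C l)@_mu](signrMK s) -e2.
  by rewrite mulr1 mulrC signrMK.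
- by rewrite sN.1 sN.2 mulr0.
Qed.

(** Principal specialization t_i = X^i: after transposition an alternant is a Vandermonde
    determinant in the X^(h j). *)
Lemma cochar_alternant (h : 'I_n -> nat) :
  mmap polyC (cocharacter C (fun i : 'I_n => i)) (alternant C h) =
  \prod_(i < n) \prod_(j < n | (i < j)%N) ('X^(h j) - 'X^(h i)).
Proof.
transitivity (\det (Vandermonde n (\row_j ('X^(h j) : {poly C})))).
  rewrite /alternant -det_map_mx -det_tr; congr (\det _).
  apply/matrixP => i j; rewrite !mxE rmorphXn /= mmapX mmap1U /cocharacter.
  by rewrite -!exprM mulnC.
rewrite det_Vandermonde; apply: eq_bigr => i _; apply: eq_bigr => j _.
by rewrite !mxE.
Qed.

(* The factors 'X - 1 cancel between the two sides, after which 'X is set to 1. *)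
Lemma prod_XnsubXn (h : 'I_n -> nat) : exists2 q : {poly C},
  \prod_(i < n) \prod_(j < n | (i < j)%N) ('X^(h j) - 'X^(h i)) =
  (\prod_(i < n) \prod_(j < n | (i < j)%N) ('X - 1)) * q &
  q.[1] = \prod_(i < n) \prod_(j < n | (i < j)%N) ((h j)%:R - (h i)%:R).
Proof.
pose g a : {poly C} := \sum_(k < a) 'X^k.
exists (\prod_(i < n) \prod_(j < n | (i < j)%N) (g (h j) - g (h i))).
  rewrite -big_split; apply: eq_bigr => i _; rewrite -big_split.
  by apply: eq_bigr => j _; rewrite /= mulrBr -!subrX1 opprB addrA subrK.
have g1 c : (g c).[1] = c%:R.
  rewrite horner_sum (eq_bigr (fun=> 1)) ?sumr_const ?card_ord // => k _.
  by rewrite hornerXn expr1n.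
rewrite horner_prod; apply: eq_bigr => i _; rewrite horner_prod.
by apply: eq_bigr => j _; rewrite hornerD hornerN !g1.
Qed.

Lemma weyl_dimension :
  (m * \prod_(i < n) \prod_(j < n | i < j) (j - i) =
   \prod_(i < n) \prod_(j < n | i < j) (l i - l j))%N.
Proof.
have := congr1 (mmap polyC (cocharacter C (fun i : 'I_n => i))) numeratorE.
rewrite rmorphM mmapZ !cochar_alternant /= cochar_alternant.
have [q1 -> q1E] := prod_XnsubXn (fun i => i); have [q2 -> q2E] := prod_XnsubXn l.
set c := V@__; set X1 := \prod_(i < n) _; set phif := mmap _ _ f => e.
have X10 : X1 != 0.
  by apply/prodf_neq0 => i _; apply/prodf_neq0 => j _; rewrite -polyC1 polyXsubC_eq0.
have {}e : q1 * phif = c%:P * q2 by apply: (mulfI X10); rewrite mulrA e mulrCA.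
have phif1 : phif.[1] = m%:R.
  rewrite -f_dim /phif -[LHS]/(horner_eval 1 _) rmorph_mmap; apply: mmap_eq => [a|i] /=.
    by rewrite /horner_eval hornerC.
  by rewrite /horner_eval hornerXn expr1n.
(* Absolute values discard the sign [c] and the order inside the differences; the remaining numbers
   are naturals. *)
have := congr1 (fun p => `|p.[1]|) e; rewrite !hornerM hornerC phif1 q1E q2E !normrM.
rewrite /c alternant_staircase normr_sign mul1r normr_nat !normr_prod.
have -> : \prod_(i < n) `|\prod_(j < n | (i < j)%N) (j%:R - i%:R)| =
    (\prod_(i < n) \prod_(j < n | i < j) (j - i))%N%:R :> C.
  rewrite natr_prod; apply: eq_bigr => i _; rewrite normr_prod natr_prod.
  by apply: eq_bigr => j ij; rewrite -natrB ?(ltnW ij) // normr_nat.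
have -> : \prod_(i < n) `|\prod_(j < n | (i < j)%N) ((l j)%:R - (l i)%:R)| =
    (\prod_(i < n) \prod_(j < n | i < j) (l i - l j))%N%:R :> C.
  rewrite natr_prod; apply: eq_bigr => i _; rewrite normr_prod natr_prod.
  apply: eq_bigr => j ij; rewrite -normrN opprB -natrB ?normr_nat //.
  by rewrite ltnW // shifted_part_lt.
by move=> e1; apply/eqP; rewrite -(eqr_nat C) natrM mulrC e1.
Qed.

End WeylDimension.

(** * The partitions of the expansion *)

Section FrobeniusSymbol.
Variable lam : seq nat.
Hypothesis lam_part : is_partition lam.

Lemma partition_nth i j : (i <= j)%N -> (nth 0%N lam j <= nth 0%N lam i)%N.
Proof.
move=> ij; have [jl|lj] := ltnP j (size lam); last by rewrite (nth_default _ lj).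
case/andP: lam_part => srt _.
apply: (sorted_leq_nth (leT := geq) _ _ _ srt) => //.
- by move=> a b c ba cb; apply: leq_trans cb ba.
- exact: leqnn.
- by rewrite inE (leq_ltn_trans ij).
Qed.

(** It turns the counts in [diag_length] and [conj_part] into thresholds. *)
Lemma count_prefix (a : pred nat) N : (forall i j, (i <= j)%N -> a j -> a i) ->
  forall i, (i < N)%N -> a i = (i < count a (iota 0 N))%N.
Proof.
move=> a_down i i_N.
have cN m : count a (iota 0 m) = if a m.-1 then m else count a (iota 0 m.-1).
  case: m => [|m]; first by case: (a _).
  rewrite -addn1 iotaD count_cat /= add0n addn0 addn1 /=.
  case: ifP => am; last by rewrite addn0.
  rewrite addn1 (eq_in_count (a2 := predT)) ?count_predT ?size_iota // => j.
  by rewrite mem_iota add0n => /andP[_ jm]; rewrite (a_down _ _ (ltnW jm) am).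
elim: N i_N => // N IHN; rewrite ltnS leq_eqVlt cN /=.
have cle m : (count a (iota 0 m) <= m)%N.
  by rewrite -[X in (_ <= X)%N](size_iota 0) count_size.
case: ifP => aN /predU1P[->|iN].
- by rewrite aN ltnSn.
- by rewrite (a_down _ _ (ltnW iN) aN) ltnS ltnW.
- by rewrite aN ltnNge cle.
- exact: IHN.
Qed.

Lemma diag_lengthP i : (i < nth 0%N lam i)%N = (i < diag_length lam)%N.
Proof.
have [il|li] := ltnP i (size lam).
  apply: (count_prefix (a := fun i => (i < nth 0%N lam i)%N)) => // j k jk.
  move=> kl; apply: leq_trans (leq_trans (leq_ltn_trans jk kl) _) (leqnn _).
  exact: partition_nth.
rewrite nth_default // ltn0; apply/esym/negbTE; rewrite -leqNgt.
by rewrite (leq_trans _ li) // -[X in (_ <= X)%N](size_iota 0) count_size.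
Qed.

Lemma conj_partP i j : (j < nth 0%N lam i)%N = (i < conj_part lam j)%N.
Proof.
have cE : conj_part lam j = count (fun i => (j < nth 0%N lam i)%N) (iota 0 (size lam)).
  rewrite /conj_part -[in LHS](mkseq_nth 0%N lam) /mkseq count_map.
  exact: eq_count.
have [il|li] := ltnP i (size lam).
  rewrite cE; apply: (count_prefix (a := fun i => (j < nth 0%N lam i)%N)) => // k k' kk'.
  by move=> kl; apply: leq_trans kl (partition_nth kk').
rewrite nth_default // ltn0; apply/esym/negbTE; rewrite -leqNgt.
by rewrite (leq_trans _ li) // count_size.
Qed.

Variables (n : nat) (I : {set 'I_n}).
Hypothesis symb : frobenius_symbol lam =
    ([seq i.-1 | i <- decreasing_elts I], decreasing_elts I).
Hypothesis I_pos : I \subset brange n.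
Hypothesis size_lam : (size lam <= n)%N.

(* The shifted parts of lambda(I) are the numbers n - 1 + k for k in I and
   n - 1 - k for k not in I. *)
Definition signed_point (k : 'I_n) : nat := if k \in I then (n.-1 + k)%N else (n.-1 - k)%N.

Lemma mem_decreasing_elts (k : 'I_n) : (val k \in decreasing_elts I) = (k \in I).
Proof. by rewrite mem_sort (mem_map val_inj) mem_enum. Qed.

Lemma decreasing_eltsP k : k \in decreasing_elts I ->
  exists2 i : 'I_n, i \in I & k = i.
Proof. by rewrite mem_sort => /mapP[i]; rewrite mem_enum => iI ->; exists i. Qed.

Lemma shifted_part_signed (i : 'I_n) :
  exists k, shifted_part (fun i => nth 0%N lam i) i = signed_point k.
Proof.
have [sa sb] : [seq nth 0%N lam i - i.+1 | i <- iota 0 (diag_length lam)]%N =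
    [seq i.-1 | i <- decreasing_elts I] /\
  [seq conj_part lam i - i.+1 | i <- iota 0 (diag_length lam)]%N = decreasing_elts I.
  by case: symb.
have szD : size (decreasing_elts I) = diag_length lam by rewrite -sb size_map size_iota.
rewrite /shifted_part /staircase; have i_n := ltn_ord i.
have [ip|pi] := ltnP i (diag_length lam).
  have iD : (i < size (decreasing_elts I))%N by rewrite szD.
  have [k kI kE] := decreasing_eltsP (mem_nth 0%N iD).
  exists k; rewrite /signed_point kI.
  have := congr1 (fun s => nth 0%N s i) sa.
  rewrite (nth_map 0%N) ?size_iota // nth_iota // (nth_map 0%N) ?szD // kE add0n.
  have := diag_lengthP i; rewrite ip.
  move: (subsetP I_pos _ kI); rewrite inE; lia.
have li : (nth 0%N lam i <= i)%N by rewrite leqNgt diag_lengthP -leqNgt.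
have kn : (i - nth 0%N lam i < n)%N by lia.
exists (Ordinal kn); rewrite /signed_point ifF /=; first by lia.
(* i - lam_i is never a leg length lam'_j - j - 1: it is smaller if the box (i, j) lies in the
   diagram and larger if not. *)
apply/negbTE; rewrite -mem_decreasing_elts -sb /=; apply/mapP => -[j].
rewrite mem_iota add0n => /andP[_ jp].
have jl := diag_lengthP j; rewrite jp in jl.
have := conj_partP j j; rewrite jl => /esym jc.
have := conj_partP i j; case: leqP => ij; last by move=> ic; lia.
move/esym/negbT; rewrite -leqNgt; lia.
Qed.

Lemma vandermonde_perm m (a : 'I_m -> int) (s : {perm 'I_m}) :
  `|\prod_(i < m) \prod_(j < m | (i < j)%N) (a (s j) - a (s i))| =
  `|\prod_(i < m) \prod_(j < m | (i < j)%N) (a j - a i)|.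
Proof.
have VE (b : 'I_m -> int) : \prod_(i < m) \prod_(j < m | (i < j)%N) (b j - b i) =
    \det (Vandermonde m (\row_j b j)).
  rewrite det_Vandermonde; apply: eq_bigr => i _; apply: eq_bigr => j _.
  by rewrite !mxE.
rewrite !VE (_ : Vandermonde m (\row_j a (s j)) = col_perm s (Vandermonde m (\row_j a j))).
  by rewrite col_permE det_mulmx det_perm normrM normr_sign mulr1.
by apply/matrixP => i j; rewrite !mxE.
Qed.

(** The shifted parts are distinct, so k is a permutation of the indices; differences ignore the
    translation by n - 1, and absolute values ignore the permutation. *)
Lemma shifted_vandermonde :
  (\prod_(i < n) \prod_(j < n | i < j)
     (shifted_part (fun i : 'I_n => nth 0 lam i) i - shifted_part (fun i : 'I_n => nth 0 lam i) j)
   = signed_vandermonde I)%N.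
Proof.
set l := shifted_part _.
have lam_mono (i j : 'I_n) : (i <= j)%N -> (nth 0%N lam j <= nth 0%N lam i)%N.
  exact: partition_nth.
have [sigma sigmaE] := fin_all_exists shifted_part_signed.
have sigma_inj : injective sigma.
  move=> i j ij; apply: (@shifted_part_inj _ _ lam_mono).
  by rewrite (sigmaE i) (sigmaE j) ij.
pose s := perm sigma_inj; apply/eqP; rewrite -eqz_nat; apply/eqP.
have -> : (\prod_(i < n) \prod_(j < n | i < j) (l i - l j))%N%:Z =
    `|\prod_(i < n) \prod_(j < n | (i < j)%N) ((signed_point (s j))%:Z - (signed_point (s i))%:Z)|.
  rewrite -[LHS]natz natr_prod normr_prod; apply: eq_bigr => i _.
  rewrite natr_prod normr_prod; apply: eq_bigr => j ij; rewrite !permE -(sigmaE i) -(sigmaE j) -/l.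
  rewrite distrC -!natz -natrB ?normr_nat //.
  by rewrite ltnW // (shifted_part_lt lam_mono).
rewrite (vandermonde_perm (fun k => (signed_point k)%:Z)) /signed_vandermonde.
rewrite -[RHS]natz natr_prod normr_prod; apply: eq_bigr => i _.
rewrite natr_prod normr_prod; apply: eq_bigr => j ij.
rewrite /signed_point /signed_dist; have := ltn_ord j.
case: (i \in I); case: (j \in I) => /=; lia.
Qed.

End FrobeniusSymbol.

Lemma prod_ord_diff n :
  (\prod_(i < n) \prod_(j < n | i < j) (j - i) = superfact n)%N.
Proof.
rewrite (exchange_big_dep predT) //=; apply: eq_bigr => j _.
rewrite -(big_ord_widen_cond n predT (fun i => j - i)%N (ltnW (ltn_ord j))).
rewrite fact_prod big_add1 /= big_mkord (reindex_inj rev_ord_inj) /=.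
by apply: eq_bigr => i _; have := ltn_ord i; lia.
Qed.

(* The subspace exists only classically, as S need not be decidable; this is
   enough because the goal it serves is a boolean equality. *)
Lemma classically_largest_subspace (F : fieldType) (V : vectType F) (S : V -> Prop) :
    S 0 -> (forall a x y, S x -> S y -> S (a *: x + y)) ->
  classically (exists W : {vspace V}, forall x, x \in W <-> S x).
Proof.
move=> S0 SP.
have [k] := ubnP (\dim {:V} - \dim (0%VS : {vspace V})).
have : forall x, x \in (0%VS : {vspace V}) -> S x by move=> x; rewrite memv0 => /eqP ->.
elim: k (0%VS : {vspace V}) => // k IHk W WS Wk b Wb.
apply: (@classic_EM (exists2 x, S x & x \notin W)) => -[[x Sx xW]|N].
  apply: (IHk (<[x]> + W)%VS) => // [y|].
    by case/memv_addP => _ /vlineP[a ->] [w /WS Sw ->]; apply: SP.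
  have lt : (\dim W < \dim (<[x]> + W))%N.
    rewrite ltn_neqAle dimvS ?addvSr // andbT.
    apply: contraNneq xW => dW; have /eqP -> : W == (<[x]> + W)%VS by rewrite eqEdim addvSr dW leqnn.
    by rewrite (subvP (addvSl _ _)) // memv_line.
  have : (\dim (<[x]> + W) <= \dim {:V})%N by rewrite dimvS ?subvf.
  by move: Wk lt; lia.
apply: Wb; exists W => x; split=> [/WS//|Sx].
by apply: contraT => xW; case: N; exists x.
Qed.

(** * From abstract representations to matrices *)

Section DimensionOfIrreducible.
Variables (C : numClosedFieldType) (n : nat) (V : vectType C).
Variables (rho : 'M[C]_n -> 'End(V)) (lam : seq nat).
Hypotheses (rho_repr : is_repr rho) (rho_poly : is_polynomial_repr rho).
Hypotheses (rho_irr : is_irreducible rho) (rho_hw : has_highest_weight rho lam).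

Local Notation m := (\dim {:V}).
Local Notation e := (vbasis {:V}).

Definition coord_col (x : V) : 'cV[C]_m := \col_a coord e a x.
Definition repr_mx (g : 'M[C]_n) : 'M[C]_m := \matrix_(a, b) coord e a (rho g e`_b).

Let e_free : free e := basis_free (vbasisP {:V}).

Lemma repr_mx_col g x : repr_mx g *m coord_col x = coord_col (rho g x).
Proof.
apply/colP => a; rewrite !mxE {2}(coord_vbasis (memvf x)) raddf_sum raddf_sum.
by apply: eq_bigr => b _; rewrite !mxE /= !linearZ /= mulrC.
Qed.

Lemma coord_col_inj : injective coord_col.
Proof.
move=> x y /colP xy; rewrite (coord_vbasis (memvf x)) (coord_vbasis (memvf y)).
by apply: eq_bigr => a _; have := xy a; rewrite !mxE => ->.
Qed.

Lemma coord_colK (c : 'cV[C]_m) : coord_col (\sum_a c a 0 *: e`_a) = c.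
Proof. by apply/colP => a; rewrite mxE coord_sum_free. Qed.

Lemma repr_mx1 : repr_mx 1%:M = 1%:M.
Proof.
by apply/matrixP => a b; rewrite !mxE (proj1 rho_repr) id_lfunE coord_free ?e_free // eq_sym.
Qed.

Lemma repr_mxM : {in unitmx &, forall g h, repr_mx (g *m h) = repr_mx g *m repr_mx h}.
Proof.
move=> g h gU hU; have eq (x : 'cV_m) : repr_mx (g *m h) *m x = repr_mx g *m repr_mx h *m x.
  rewrite -(coord_colK x) -mulmxA !repr_mx_col (proj2 rho_repr) //.
  by rewrite lfunE.
by apply/matrixP => a b; have /colP/(_ a) := eq (delta_mx b 0); rewrite -!colE !mxE.
Qed.

(** The vectors whose orbit phi kills form an invariant subspace containing u, hence everything. *)
Lemma cyclic_vector (u : V) (phi : 'rV[C]_m) : u != 0 ->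
  {in unitmx, forall g, phi *m repr_mx g *m coord_col u = 0} -> phi = 0.
Proof.
move=> u0 phi0; apply/eqP.
pose S x := {in unitmx, forall g, phi *m repr_mx g *m coord_col x = 0}.
have col_lin a x y : coord_col (a *: x + y) = a *: coord_col x + coord_col y.
  by apply/colP => i; rewrite !mxE linearP.
have S0 : S 0.
  move=> g _; rewrite (_ : coord_col 0 = 0) ?mulmx0 //.
  by apply/colP => i; rewrite !mxE linear0.
have SP a x y : S x -> S y -> S (a *: x + y).
  by move=> Sx Sy g gU; rewrite col_lin mulmxDr -scalemxAr Sx // Sy // scaler0 addr0.
apply: (classically_largest_subspace S0 SP) => -[W WS].
have stable : {in unitmx, forall g, (rho g @: W <= W)%VS}.
  move=> g gU; apply/subvP => _ /memv_imgP[x /WS Sx ->]; apply/WS => h hU.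
  by rewrite -repr_mx_col mulmxA -(mulmxA phi) -repr_mxM // Sx // unitmx_mul hU.
have [W0|WV] := (proj2 rho_irr) W stable.
  by case/negP: u0; rewrite -memv0 -W0; apply/WS.
apply/eqP/rowP => a; rewrite mxE.
have : S e`_a by apply/WS; rewrite WV memvf.
move/(_ _ (unitmx1 _ _)); rewrite repr_mx1 mulmx1.
move/matrixP/(_ 0 0); rewrite !mxE (bigD1 a) //= !mxE coord_free ?e_free // eqxx mulr1.
rewrite big1 ?addr0 // => b ba; rewrite !mxE coord_free ?e_free //.
by rewrite eq_sym (negbTE ba) mulr0.
Qed.

Lemma repr_mx_poly : exists P : 'I_m -> 'I_m -> {mpoly C[n * n]},
  {in unitmx, forall g, pmx P idfun g = repr_mx g}.
Proof.
have PE (a b : 'I_m) : exists P : {mpoly C[n * n]},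
    {in unitmx, forall g, coord e a (rho g e`_b) = P.@[fun k => mxvec g 0 k]}.
  have [P PE] := rho_poly (linfun (coord e a : V -> C^o)) e`_b.
  by exists P => g gU; rewrite -PE // lfunE.
have [P PP] := fin_all_exists (fun a => fin_all_exists (PE a)).
by exists P => g gU; apply/matrixP => a b; rewrite !mxE PP.
Qed.

Lemma dim_irr_weyl : is_partition lam ->
  (m * \prod_(i < n) \prod_(j < n | i < j) (j - i) =
   \prod_(i < n) \prod_(j < n | i < j)
     (shifted_part (fun i : 'I_n => nth 0 lam i) i - shifted_part (fun i : 'I_n => nth 0 lam i) j))%N.
Proof.
move=> lam_part; have [P PE] := repr_mx_poly.
have [_ [u u0 hw]] := rho_hw.
have P1 : pmx P idfun 1%:M = 1%:M by rewrite PE ?unitmx1 // repr_mx1.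
have PM : {in unitmx &, forall g h, pmx P idfun (g *m h) = pmx P idfun g *m pmx P idfun h}.
  by move=> g h gU hU; rewrite !PE ?unitmx_mul ?gU // repr_mxM.
pose l (i : 'I_n) := nth 0%N lam i.
have phw b : b \in unitmx -> upper b ->
    pmx P idfun b *m coord_col u = (\prod_i b i i ^+ l i) *: coord_col u.
  move=> bU bu; rewrite PE // repr_mx_col hw //.
  by apply/colP => a; rewrite !mxE linearZ.
have cu0 : coord_col u != 0.
  apply: contraNneq u0 => cu; apply/eqP/coord_col_inj; rewrite cu.
  by apply/colP => a; rewrite !mxE linear0.
have cyc (phi : 'rV_m) : {in unitmx, forall g, phi *m pmx P idfun g *m coord_col u = 0} -> phi = 0.
  by move=> phi0; apply: (cyclic_vector u0) => g gU; rewrite -PE // phi0.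
have [z cas] := character_casimir P1 PM phw cu0 cyc.
have [z' deg] := character_degree P1 PM phw cu0 cyc.
pose Q i j := torus_trace P (lie_pmx P (delta_mx i j) *m lie_pmx P (delta_mx j i)).
apply: (@weyl_dimension C n m (torus_character P) l Q z z').
- by move=> i j ij; apply: root_trace.
- rewrite -cas -big_split; apply: eq_bigr => i _.
  rewrite [RHS](bigD1 i) //=; congr (_ + _).
  exact: euler2_character.
- exact: deg.
- exact: character_sym.
- exact: (character_top P1 PM phw cu0 cyc).
- by move=> mu k; apply: (character_tail PM phw cu0 cyc).
- by move=> mu; apply: (character_mdeg P1 PM phw cu0 cyc).
- exact: character1.
- by move=> i j; apply: partition_nth.
Qed.

End DimensionOfIrreducible.

Lemma is_dim_irrE (C : numClosedFieldType) n (I : {set 'I_n}) k :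
  I \subset brange n -> is_dim_irr C I k -> (k * superfact n = signed_vandermonde I)%N.
Proof.
move=> sI [lam [V [rho [[[part symb] repr poly irr hw] <-]]]].
rewrite -prod_ord_diff (dim_irr_weyl repr poly irr hw part).
by apply: shifted_vandermonde => //; case: hw.
Qed.

(** * The field of rational functions *)

Section NonVanishing.
Variables (S : comNzRingType) (K F : fieldType).
Variables (g : {rmorphism S -> K}) (ev : {rmorphism S -> F}) (z w c d : S).
Hypothesis g_inj : forall p, g p = 0 -> p = 0.
Hypothesis natr_neq0 : forall n, n.+1%:R != 0 :> F.
Hypotheses (ev_z : ev z = 0) (ev_w : ev w = 1) (ev_d : ev d = 0).

Let oddsq (y : S) i := \prod_(1 <= k < i.+1) (y + (2 * k%:R - 1) ^+ 2).

Let g_oddsq y i : g (oddsq y i) = oddsq_prod (g y) i.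
Proof.
rewrite rmorph_prod; apply: eq_bigr => k _.
by rewrite rmorphD rmorphXn rmorphB rmorphM !rmorph_nat rmorph1.
Qed.

(** A specialization is not defined on the whole fraction field, so the sum is first lifted along
    [g] to the ring S. *)
Lemma umemura_sum_neq0 n :
  \sum_(I : {set 'I_n} | I \subset brange n)
    (signed_vandermonde I)%:R * (\prod_(i in I) oddsq_prod (g c) i)
    * (\prod_(i in brange n :\: I) oddsq_prod (g d) i)
    * g z ^+ wt I * g w ^+ wt (brange n :\: I) != 0.
Proof.
pose s := \sum_(I : {set 'I_n} | I \subset brange n)
    (signed_vandermonde I)%:R * (\prod_(i in I) oddsq c i)
    * (\prod_(i in brange n :\: I) oddsq d i)
    * z ^+ wt I * w ^+ wt (brange n :\: I).
have gs : g s = \sum_(I : {set 'I_n} | I \subset brange n)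
    (signed_vandermonde I)%:R * (\prod_(i in I) oddsq_prod (g c) i)
    * (\prod_(i in brange n :\: I) oddsq_prod (g d) i)
    * g z ^+ wt I * g w ^+ wt (brange n :\: I).
  rewrite rmorph_sum; apply: eq_bigr => I _.
  rewrite !rmorphM rmorph_nat !rmorphXn !rmorph_prod.
  by congr (_ * _ * _ * _ * _); apply: eq_bigr => i _; rewrite g_oddsq.
rewrite -gs; apply/eqP => /g_inj/(congr1 ev)/eqP; rewrite rmorph0; apply/negP.
rewrite rmorph_sum (bigD1 set0) ?sub0set //= [X in _ + X]big1 ?addr0 => [|I /andP[sI I0]].
  have := signed_vandermonde_gt0 (set0 : {set 'I_n}).
  move: (signed_vandermonde set0) => q q0.
  rewrite !rmorphM rmorph_nat !rmorphXn !rmorph_prod ev_w expr1n mulr1 setD0.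
  rewrite /wt !big_set0 expr0 !mulr1 mulf_neq0 //.
    by rewrite -(prednK q0) natr_neq0.
  apply/prodf_neq0 => i _; rewrite rmorph_prod prodf_seq_neq0.
  apply/allP => -[|k]; rewrite mem_index_iota // => _ /=.
  rewrite rmorphD ev_d add0r rmorphXn rmorphB rmorphM !rmorph_nat rmorph1 expf_neq0 //.
  have -> : 2 * k.+1%:R - 1 = (2 * k).+1%:R :> F by rewrite -!natr1 natrM; ring.
  exact: natr_neq0.
have wI : (0 < wt I)%N.
  have /set0Pn[i iI] := I0; have := subsetP sI _ iI; rewrite inE => i0.
  by rewrite /wt (bigD1 i) //= addn_gt0 i0.
by rewrite !rmorphM !rmorphXn ev_z expr0n (gtn_eqF wI) mulr0 mul0r.
Qed.

End NonVanishing.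

Lemma umemura_tauM (K : fieldType) (v b1 b2 : K) n :
    (forall n, n.+1%:R != 0 :> K) -> 2 + v != 0 ->
  umemura_tau v b1 b2 n * (superfact n)%:R = \sum_(I : {set 'I_n} | I \subset brange n)
    (signed_vandermonde I)%:R * (\prod_(i in I) oddsq_prod (- 4 * b1 ^+ 2) i)
    * (\prod_(i in brange n :\: I) oddsq_prod (- 4 * b2 ^+ 2) i)
    * ((2 - v) / 4) ^+ wt I * ((2 + v) / 4) ^+ wt (brange n :\: I).
Proof.
move=> natr_neq0 v2; have s0 : (superfact n)%:R != 0 :> K.
  by rewrite -(prednK (superfact_gt0 n)) natr_neq0.
rewrite umemura_tauE // mulr_suml; apply: eq_bigr => I _.
move: (((2 - v) / 4) ^+ wt I) (((2 + v) / 4) ^+ wt (brange n :\: I)) => p q.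
by field.
Qed.

(* At v = 2 and b2 = 0 only the term I = set0 survives, and it is a product of
   odd squares. *)
Lemma umemura_tau_neq0 (S : comNzRingType) (K F : fieldType)
    (g : {rmorphism S -> K}) (ev : {rmorphism S -> F}) (v b1 b2 : K) (sv sb1 sb2 q : S) n :
    (forall p, g p = 0 -> p = 0) -> (forall k, k.+1%:R != 0 :> K) ->
    (forall k, k.+1%:R != 0 :> F) -> g sv = v -> g sb1 = b1 -> g sb2 = b2 -> 4 * q = 1 ->
    2 + v != 0 -> ev sv = 2 -> ev sb2 = 0 ->
  umemura_tau v b1 b2 n != 0.
Proof.
move=> g_inj natK natF gv gb1 gb2 q4 v2 ev_v ev_b2.
have gq : g q = 4^-1.
  have K4 := natK 3; apply: (mulfI K4); rewrite (mulfV K4).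
  by rewrite -(rmorph_nat g) -rmorphM q4 rmorph1.
have evq : ev q = 4^-1.
  have F4 := natF 3; apply: (mulfI F4); rewrite (mulfV F4).
  by rewrite -(rmorph_nat ev) -rmorphM q4 rmorph1.
have g4 b : g (- 4 * b ^+ 2) = - 4 * g b ^+ 2.
  by rewrite rmorphM rmorphN rmorph_nat rmorphXn.
have gz : g ((2 - sv) * q) = (2 - v) / 4 by rewrite rmorphM rmorphB rmorph_nat gv gq.
have gw : g ((2 + sv) * q) = (2 + v) / 4 by rewrite rmorphM rmorphD rmorph_nat gv gq.
have : umemura_tau v b1 b2 n * (superfact n)%:R != 0; last first.
  by rewrite mulf_eq0 negb_or => /andP[].
rewrite umemura_tauM // -gz -gw -gb1 -gb2 -!g4.
apply: (@umemura_sum_neq0 S K F g ev).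
- exact: g_inj.
- exact: natF.
- by rewrite rmorphM rmorphB rmorph_nat ev_v subrr mul0r.
- by rewrite rmorphM rmorphD rmorph_nat ev_v evq -natrD mulfV // (natF 3).
- by rewrite rmorphM rmorphXn ev_b2 expr0n mulr0.
Qed.

(** * Existence and uniqueness for the recursion *)

Section TodaSolution.
Variables (K : fieldType) (dv : K -> K) (v b1 b2 : K).
Hypotheses (Hdv : derivation dv) (dv_v : dv v = 1).
Hypotheses (dv_b1 : dv b1 = 0) (dv_b2 : dv b2 = 0).
Hypothesis natr_neq0 : forall n, n.+1%:R != 0 :> K.
Hypothesis v2 : 2 + v != 0.
Hypothesis tau_neq0 : forall n, umemura_tau v b1 b2 n != 0.

Local Notation T := (umemura_T v b1 b2).
Local Notation toda := (toda_operator dv v b1 b2).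

Lemma umemura_T01 : T 0%N = 1 /\ T 1%N = 1.
Proof.
have superfact1 : superfact 1 = 1%N by rewrite superfactS /superfact big_ord0.
rewrite /umemura_T /umemura_tau /exp_wronskian superfact1 /superfact big_ord0 det_mx00.
rewrite det_mx11 mxE /exp_wronskian_entry /exp_pos /exp_neg /oddsq_prod big_geq //.
rewrite !bin_small // !expr0 mulr0n mulr0 add0r !mul1r !divr1.
by rewrite invr1 big_geq.
Qed.

Lemma umemura_T_neq0 n : T n != 0.
Proof. by rewrite mulf_neq0 ?tau_neq0 // invr_eq0 expf_neq0 // (natr_neq0 1). Qed.

Lemma umemura_T_rec n : (0 < n)%N -> T n.-1 * T n.+1 = toda n (T n).
Proof. by case: n => // n _; exact: umemura_T_toda Hdv _ _ _ _ _ _ (tau_neq0 _). Qed.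

Lemma umemura_T_unique (T' : nat -> K) : T' 0%N = 1 -> T' 1%N = 1 ->
    (forall n, (1 <= n)%N -> T' n.-1 * T' n.+1 = toda n (T' n)) ->
  T' =1 T.
Proof.
move=> T'0 T'1 T'S n.
suff [] : T' n = T n /\ T' n.+1 = T n.+1 by [].
elim: n => [|n [IH0 IH1]]; first by have [-> ->] := umemura_T01.
split=> //; apply: (mulfI (umemura_T_neq0 n)).
rewrite (umemura_T_rec (ltn0Sn n)) -IH0 -IH1.
exact: (T'S n.+1).
Qed.

Lemma umemura_T_formula n (dimI : {set 'I_n} -> nat) :
    (forall I : {set 'I_n}, I \subset brange n -> (dimI I * superfact n = signed_vandermonde I)%N) ->
  let z := (2 - v) / 4 in let w := (2 + v) / 4 in
  let c := - 4 * b1 ^+ 2 in let d := - 4 * b2 ^+ 2 in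
  2 ^+ (n * (n - 1))%N * T n =
  \sum_(I : {set 'I_n} | I \subset brange n)
    (dimI I)%:R * (\prod_(i in I) oddsq_prod c i)
    * (\prod_(i in brange n :\: I) oddsq_prod d i)
    * z ^+ wt I * w ^+ wt (brange n :\: I).
Proof.
move=> dimE z w c d; rewrite /umemura_T mulrC divfK; last first.
  by rewrite expf_neq0 // (natr_neq0 1).
rewrite umemura_tauE //; apply: eq_bigr => I sI; congr (_ * _ * _ * _ * _).
rewrite -dimE // natrM mulfK // -(prednK (superfact_gt0 n)).
exact: natr_neq0.
Qed.

End TodaSolution.

Section RationalFunctionField.
Variable C : numClosedFieldType.
Local Notation R := {mpoly C[2]}.
Local Notation K := (ratfun C).

Lemma natr_ratfun_neq0 n : n.+1%:R != 0 :> K.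
Proof.
rewrite -(rmorph_nat (@FracField.tofrac {poly R})) tofrac_eq0.
by rewrite -polyC_natr polyC_eq0 -mpolyC_nat mpolyC_eq0 pnatr_eq0.
Qed.

Lemma two_plus_v_neq0 : 2 + v C != 0.
Proof.
rewrite -(rmorph_nat (@FracField.tofrac {poly R})) /v -tofracD tofrac_eq0.
by rewrite addrC -polyC_natr -[2%:R]opprK polyCN polyXsubC_eq0.
Qed.

Lemma dfrac_v : dfrac (v C) = 1.
Proof. by rewrite /v dfrac_tofrac derivX tofrac1. Qed.

Lemma dfrac_const (a : R) : dfrac (a%:P%:F) = 0.
Proof. by rewrite dfrac_tofrac derivC tofrac0. Qed.

Lemma ratfun_tau_neq0 n : umemura_tau (v C) (b1 C) (b2 C) n != 0.
Proof.
(* The constant 1/4 as a polynomial: z and w have to be lifted to a ring without division. *)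
pose q : {poly R} := (4^-1)%:MP%:P.
pose ev : {rmorphism {poly R} -> C} := meval (fun=> 0) \o horner_eval (2 : R).
have e4 : 4 * 4^-1 = 1 :> C by rewrite mulfV ?pnatr_eq0.
have q4 : 4 * q = 1.
  by rewrite /q -polyC_natr -polyCM -mpolyC_nat -mpolyCM e4 mpolyC1 polyC1.
apply: (@umemura_tau_neq0 {poly R} K C (@FracField.tofrac {poly R}) ev (v C) (b1 C) (b2 C)
  'X ('X_(0 : 'I_2) : R)%:P ('X_(1 : 'I_2) : R)%:P q n _ natr_ratfun_neq0).
- by move=> p /eqP; rewrite tofrac_eq0 => /eqP.
- by move=> k; rewrite pnatr_eq0.
- by [].
- by [].
- by [].
- exact: q4.
- exact: two_plus_v_neq0.
- by rewrite /ev /= /horner_eval hornerX -mpolyC_nat mevalC.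
- by rewrite /ev /= /horner_eval hornerC mevalXU.
Qed.

Lemma toda_rhsE n (f : K) :
  toda_rhs n f = @toda_operator K (@dfrac R) (v C) (b1 C) (b2 C) n f.
Proof. rewrite /toda_rhs /toda_operator; reflexivity. Qed.

End RationalFunctionField.

Theorem mainTheorem7 (C : numClosedFieldType) :
  exists T : nat -> ratfun C,
    [/\ toda_sequence T,
        forall T' : nat -> ratfun C, toda_sequence T' -> T' =1 T &
        forall n : nat, (1 <= n)%N ->
        forall dimI : {set 'I_n} -> nat,
          (forall I : {set 'I_n}, I \subset brange n ->
             is_dim_irr C I (dimI I)) ->
        let z : ratfun C := (2 - v C) / 4 in
        let w : ratfun C := (2 + v C) / 4 in
        let c : ratfun C := - 4 * b1 C ^+ 2 in
        let d : ratfun C := - 4 * b2 C ^+ 2 in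
        2 ^+ (n * (n - 1))%N * T n =
        \sum_(I : {set 'I_n} | I \subset brange n)
          (dimI I)%:R
          * (\prod_(i in I) oddsq_prod c i)
          * (\prod_(i in brange n :\: I) oddsq_prod d i)
          * z ^+ wt I * w ^+ wt (brange n :\: I)].
Proof.
have Hdv : @derivation (ratfun C) (@dfrac {mpoly C[2]}) := derivation_dfrac _.
have dv_b1 : dfrac (b1 C) = 0 := dfrac_const _.
have dv_b2 : dfrac (b2 C) = 0 := dfrac_const _.
have nat0 := @natr_ratfun_neq0 C; have v2 := two_plus_v_neq0 C.
have tau0 := @ratfun_tau_neq0 C.
have [T0 T1] := @umemura_T01 (ratfun C) (v C) (b1 C) (b2 C).
have toda := @umemura_T_rec (ratfun C) (@dfrac {mpoly C[2]}) (v C) (b1 C) (b2 C)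
  Hdv (dfrac_v C) dv_b1 dv_b2 nat0 v2 tau0.
have uniq := @umemura_T_unique (ratfun C) (@dfrac {mpoly C[2]}) (v C) (b1 C) (b2 C)
  Hdv (dfrac_v C) dv_b1 dv_b2 nat0 v2 tau0.
exists (@umemura_T (ratfun C) (v C) (b1 C) (b2 C)); split.
- split.
  + exact: T0.
  + exact: T1.
  + move=> n n1.
    apply: etrans (esym (toda_rhsE _ _)).
    exact: toda.
- move=> T' [T'0 T'1 T'S]; apply: (uniq T' T'0 T'1) => n n1.
  rewrite -toda_rhsE; exact: T'S.
- move=> n _ dimI dimE.
  apply: (@umemura_T_formula (ratfun C) (v C) (b1 C) (b2 C) nat0 v2) => I sI.
  exact: is_dim_irrE sI (dimE I sI).
Qed.
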